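(* Let $a\in\Omega_X$. Then $GR_X(a)$ is countably $d(N-1)$-rectifiable in $TX$, and its Hausdorff dimension satisfies $\dim_H GR_X(a)=d(N-1)$.
   Context: Let $E=\mathbb R^d$, $d\ge2$, $N$ bodies with masses $m_i>0$, mass inner product $\langle x,y\rangle=\sum_i m_i(x_i,y_i)$ on $E^N$ with norm $\|\cdot\|$, $U(x)=\sum_{i<j}\frac{m_im_j}{|x_i-x_j|}$, $\Omega=\{x\in E^N: x_i\ne x_j,\ i\ne j\}$, Newton's equation $\ddot x=\nabla U(x)$. Let $X=\{x\in E^N:\sum_i m_ix_i=0\}$ (a $d(N-1)$-dimensional space), $\Omega_X=\Omega\cap X$, $TX\simeq X\times X$, $T\Omega_X\simeq\Omega_X\times X$. With $L(x,v)=\frac12\|v\|^2+U(x)$, $A_h(\gamma)=\int(L(\gamma,\dot\gamma)+h)dt$ and $\phi_h(x,y)$ the infimum of $A_h$ over absolutely continuous curves from $x$ to $y$ defined on any compact interval, a geodesic ray of energy $h\ge0$ is a solution $\gamma:[0,\infty)\to\Omega$ with $A_h(\gamma|_{[s,t]})=\phi_h(\gamma(s),\gamma(t))$ for all $0\le s<t$. A motion $\gamma$ is hyperbolic with limit shape $a\in\Omega$ if $\gamma(t)=ta+o(t)$ as $t\to+\infty$. $GR_X(a)$ is the set of $(x,v)\in T\Omega_X$ such that the solution of Newton's equation with initial datum $(x,v)$ is a hyperbolic geodesic ray with limit shape $a$ (its energy is then $\frac12\|a\|^2$). *)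

(* Defs.v *)
From HB Require Import structures.
From mathcomp Require Import all_boot all_order all_algebra.
From mathcomp Require Import all_classical all_reals all_analysis.
Set Implicit Arguments. Unset Strict Implicit. Unset Printing Implicit Defensive.
Import Order.TTheory GRing.Theory Num.Theory.
Import numFieldNormedType.Exports.
Local Open Scope classical_set_scope.
Local Open Scope ring_scope.

Section NBody.
Variables (R : realType) (d N : nat) (m : 'I_N -> R).

(* A configuration x in E^N, E = R^d, is an N x d matrix: row i = position of body i. *)
Definition config := 'M[R]_(N, d).

Definition dist_bodies (x : config) (i j : 'I_N) : R :=
  Num.sqrt (\sum_(k < d) (x i k - x j k) ^+ 2).

Definition mdot (x y : config) : R := \sum_(i < N) m i * \sum_(k < d) x i k * y i k.
Definition mnorm2 (x : config) : R := mdot x x.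

Definition inOmega (x : config) : Prop := forall i j : 'I_N, i != j -> row i x != row j x.
Definition inX (x : config) : Prop := \sum_(i < N) m i *: row i x = 0.
Definition inOmegaX (x : config) : Prop := inOmega x /\ inX x.

Definition U (x : config) : R :=
  \sum_(i < N) \sum_(j < N | (i < j)%N) m i * m j / dist_bodies x i j.

(* U extended by +oo on collisions (so that the action of a curve meeting
   collisions is computed with U = +oo there) *)
Definition Uext (x : config) : \bar R :=
  if pselect (inOmega x) then (U x)%:E else +oo%E.

(* gradient of U with respect to the mass inner product:
   (grad U)_i = (1/m_i) dU/dx_i = sum_{j<>i} m_j (x_j - x_i) / |x_i - x_j|^3 *)
Definition gradU (x : config) : config :=
  \matrix_(i < N, k < d)
    \sum_(j < N | j != i) m j * (x j k - x i k) / (dist_bodies x i j) ^+ 3.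

(* absolutely continuous curve gamma on [a,b] with (a.e.) derivative v:
   gamma(t) = gamma(a) + int_a^t v, v integrable on [a,b] (componentwise) *)
Definition abs_cont_with (gamma v : R -> config) (a b : R) : Prop :=
  forall (i : 'I_N) (k : 'I_d),
    (lebesgue_measure : measure _ R).-integrable `[a, b] (fun s => (v s i k)%:E) /\
    forall t, a <= t <= b ->
      gamma t i k = gamma a i k + Rintegral lebesgue_measure `[a, t] (fun s => v s i k).

Definition action (h : R) (gamma v : R -> config) (a b : R) : \bar R :=
  (\int[lebesgue_measure]_(t in `[a, b]) (((2^-1 * mnorm2 (v t) + h)%:E + Uext (gamma t))))%E.

Definition phi (h : R) (x y : config) : \bar R :=
  ereal_inf [set c | exists (gamma v : R -> config) (a b : R),
     a < b /\ abs_cont_with gamma v a b /\ gamma a = x /\ gamma b = y /\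
     c = action h gamma v a b].

(* gamma is a solution of Newton's equation xddot = grad U(x) on [0,+oo)
   (on an open interval containing [0,+oo)), staying in Omega *)
Definition newton_solution_on_ray (gamma : R -> config) : Prop :=
  exists eps : R, 0 < eps /\
    forall t, - eps < t ->
      inOmega (gamma t) /\ derivable gamma t 1 /\ derivable (derive1 gamma) t 1 /\
      derive1 (derive1 gamma) t = gradU (gamma t).

Definition energy (x v : config) : R := 2^-1 * mnorm2 v - U x.

Definition geodesic_ray (h : R) (gamma : R -> config) : Prop :=
  0 <= h /\ newton_solution_on_ray gamma /\
  forall s t, 0 <= s -> s < t ->
    action h gamma (derive1 gamma) s t = phi h (gamma s) (gamma t).

Definition hyperbolic_with_shape (gamma : R -> config) (a : config) : Prop :=
  inOmega a /\ (fun t => t^-1 *: (gamma t - t *: a)) x @[x --> +oo] --> (0 : config).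

(* GR_X(a) in T Omega_X ~ Omega_X x X *)
Definition GR_X (a : config) : set (config * config) :=
  [set xv | inOmegaX xv.1 /\ inX xv.2 /\
     exists gamma : R -> config,
       gamma 0 = xv.1 /\ derive1 gamma 0 = xv.2 /\
       newton_solution_on_ray gamma /\
       geodesic_ray (energy xv.1 xv.2) gamma /\
       hyperbolic_with_shape gamma a].

End NBody.

Section Hausdorff.
Variables (R : realType) (V : normedModType R).

(* diameter, in \bar R (-oo for the empty set) *)
Definition ediam (A : set V) : \bar R :=
  ereal_sup [set r | exists x y, A x /\ A y /\ r = (`|x - y|)%:E].

(* diam(A)^s, with diam(empty)^s = 0 *)
Definition diam_pow (A : set V) (s : R) : \bar R :=
  match ediam A with
  | EFin r => (r `^ s)%:E
  | +oo%E => +oo%E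
  | -oo%E => 0%E
  end.

Definition hausdorff_delta (s delta : R) (A : set V) : \bar R :=
  ereal_inf [set c | exists C : nat -> set V,
     A `<=` \bigcup_n C n /\ (forall n, (ediam (C n) <= delta%:E)%E) /\
     c = (\sum_(0 <= n <oo) diam_pow (C n) s)%E].

(* s-dimensional Hausdorff (outer) measure, up to normalisation constant *)
Definition hausdorff_measure (s : R) (A : set V) : \bar R :=
  ereal_sup [set c | exists delta : R, 0 < delta /\ c = hausdorff_delta s delta A].

Definition hausdorff_dim (A : set V) : \bar R :=
  ereal_inf [set c | exists s : R, 0 <= s /\ hausdorff_measure s A = 0%E /\ c = s%:E].

Definition countably_rectifiable (k : nat) (A : set V) : Prop :=
  exists f : nat -> ('rV[R]_k -> V),
    (forall n, exists L : R, forall x y, `|f n x - f n y| <= L * `|x - y|) /\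
    A `<=` \bigcup_n range (f n).

End Hausdorff.

(* Main.v *)
Require Import Defs.
From HB Require Import structures.
From mathcomp Require Import all_boot all_order all_algebra.
From mathcomp Require Import all_classical all_reals all_analysis.
From mathcomp Require Import measurable_realfun ring lra.
Import Order.TTheory GRing.Theory Num.Theory.
Import numFieldNormedType.Exports.
Set Implicit Arguments. Unset Strict Implicit. Unset Printing Implicit Defensive.
Local Open Scope classical_set_scope.
Local Open Scope ring_scope.

(* For T large, Newton's equation has exactly one solution with limit shape a through every
   configuration near the half-line of the multiples ta, t >= T: the force decays like 1/t^2 and
   its Lipschitz constant like 1/t^3, so the equation is a contraction for the accelerations
   weighted by t^2. This solution depends in a Lipschitz way on its initial position. Hence an
   element of GR_X(a) is determined, in a Lipschitz way (Gronwall), by the position of its motion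
   at a large integer time, which gives rectifiability and the upper bound for the dimension.

   For the lower bound, the solutions starting in a convex cone C around the half-line calibrate:
   u_t(x) = <a, gamma_x(t)> - A_h(gamma_x on [0, t]) has gradient close to the initial velocity
   of gamma_x for t large, so a curve inside C has action at least the increment of u_t, with
   equality in the limit along the solutions. A curve that leaves C is cut at its last exit point
   z: reaching z from x costs at least |a||z - x|, which exceeds the increment of u_t because
   z - x makes a definite angle with a. So the solutions starting in a smaller cone are geodesic
   rays, and GR_X(a) projects onto a set with nonempty interior in X. *)

(** The motions drift away from [ta] like log t. The unknown of the fixed point is therefore the
    acceleration: the velocity is recovered by integration from infinity, where it must be [a], and
    the position by integration from 0. A square root stands in for the logarithm, being still
    negligible against t.

    Differentiability in the initial position is never established. The gradient of u_t is replaced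
    by a one-sided inequality whose linear part is the initial velocity, with one error quadratic in
    the displacement, its factor growing with t, and one linear error, its factor decaying in t.
    Fixing t first and shortening the steps afterwards makes both small, and u_t need not converge.

    Three apertures are nested: [e] for the tube where the force is controlled, e/4 for the cone in
    which solutions are launched and calibrate, e/8 for the invariant cone of the minimizing rays.
    The gap between the last two gives the angle at the exit.

    The lower bound for the dimension uses no volume: covers of a cube are tested on the points of a
    fine grid. *)

Section Calculus.
Context {R : realType}.
Implicit Types (f g : R -> R) (x a b c : R).

(** * Derivatives of real functions, and the growth estimates drawn from them *)

Lemma is_derive_cont f x a : is_derive x 1 f a -> {for x, continuous f}.
Proof.
by move=> fx; apply/differentiable_continuous/derivable1_diffP; exact: ex_derive.
Qed.

Lemma derD f g x a b : is_derive x 1 f a -> is_derive x 1 g b ->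
  is_derive x 1 (fun s => f s + g s) (a + b).
Proof. by move=> fx gx; exact: is_deriveD. Qed.

Lemma derB f g x a b : is_derive x 1 f a -> is_derive x 1 g b ->
  is_derive x 1 (fun s => f s - g s) (a - b).
Proof. by move=> fx gx; exact: is_deriveB. Qed.

Lemma derN f x a : is_derive x 1 f a -> is_derive x 1 (fun s => - f s) (- a).
Proof. by move=> fx; exact: is_deriveN. Qed.

Lemma derC x c : is_derive x 1 (fun=> c) (0 : R).
Proof. exact: is_derive_cst. Qed.

Lemma derM f g x a b : is_derive x 1 f a -> is_derive x 1 g b ->
  is_derive x 1 (fun s => f s * g s) (a * g x + f x * b).
Proof.
move=> fx gx; apply: (is_derive_eq (is_deriveM fx gx)).
by rewrite addrC /GRing.scale/= (mulrC a).
Qed.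

Lemma derMl f x a c : is_derive x 1 f a -> is_derive x 1 (fun s => c * f s) (c * a).
Proof.
by move=> fx; have := derM (derC x c) fx; rewrite mul0r add0r.
Qed.

Lemma derX x : is_derive x 1 (fun s : R => s) 1.
Proof. exact: is_derive_id. Qed.

Lemma derV f x a : f x != 0 -> is_derive x 1 f a ->
  is_derive x 1 (fun s => (f s)^-1) (- a / f x ^+ 2).
Proof.
move=> fx0 fx; apply: (is_derive_eq (is_deriveV fx0 fx)).
by rewrite /GRing.scale/= mulNr mulNr mulrC.
Qed.

Lemma der_sum (I : Type) (r : seq I) (P : pred I) (F : I -> R -> R) (dF : I -> R) x :
  (forall i, P i -> is_derive x 1 (F i) (dF i)) ->
  is_derive x 1 (fun s => \sum_(i <- r | P i) F i s) (\sum_(i <- r | P i) dF i).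
Proof.
move=> H; elim: r => [|i r IH].
  rewrite big_nil; under eq_fun do rewrite big_nil; exact: derC.
rewrite big_cons; under eq_fun do rewrite big_cons.
by case: ifP => // Pi; apply: derD => //; exact: H.
Qed.

Lemma der_comp f g x a b : is_derive (g x) 1 f a -> is_derive x 1 g b ->
  is_derive x 1 (fun s => f (g s)) (a * b).
Proof. by move=> fx gx; exact: is_derive1_comp. Qed.

Lemma der_shift f x a c : is_derive (x + c) 1 f a ->
  is_derive x 1 (fun s => f (s + c)) a.
Proof.
move=> fx; by have := @der_comp f (fun s => s + c) _ _ _ fx (derD (derX x) (derC x c)); rewrite addr0 mulr1.
Qed.

Lemma der_sqrt f x a : 0 < f x -> is_derive x 1 f a ->
  is_derive x 1 (fun s => Num.sqrt (f s)) (a / (2 * Num.sqrt (f x))).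
Proof.
move=> fx0 fx; by have := @der_comp _ f _ _ _ (is_derive1_sqrt fx0) fx; rewrite mulrC.
Qed.

Lemma der_near f g x a : (\forall s \near x, f s = g s) -> is_derive x 1 f a ->
  is_derive x 1 g a.
Proof. exact: near_eq_is_derive. Qed.

Lemma deriv_ge0_le f (df : R -> R) a b : a <= b ->
  (forall s, a <= s <= b -> is_derive s 1 f (df s)) ->
  (forall s, a <= s <= b -> 0 <= df s) -> f a <= f b.
Proof.
move=> ab fd d0; rewrite -subr_ge0.
have [| |c cab ->] := @MVT_segment _ f df _ _ ab.
- by move=> x /[!in_itv]/= /andP[? ?]; apply: fd; rewrite !ltW.
- apply: derivable_within_continuous => x /[!in_itv]/= xab.
  by have ? := fd _ xab; exact: ex_derive.
- by rewrite mulr_ge0 ?subr_ge0 ?d0//; rewrite in_itv in cab.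
Qed.

Lemma deriv_abs_le f (df : R -> R) g (dg : R -> R) a b : a <= b ->
  (forall s, a <= s <= b -> is_derive s 1 f (df s)) ->
  (forall s, a <= s <= b -> is_derive s 1 g (dg s)) ->
  (forall s, a <= s <= b -> `|df s| <= dg s) -> `|f b - f a| <= g b - g a.
Proof.
move=> ab fd gd H; rewrite ler_norml; apply/andP; split.
- pose F s := f s + g s; have : F a <= F b.
    apply: (@deriv_ge0_le _ (fun s => df s + dg s)) => // s sab.
      by apply: derD; [exact: fd|exact: gd].
    by have := H _ sab; rewrite ler_norml => /andP[]; lra.
  by rewrite /F; lra.
- pose F s := g s - f s; have : F a <= F b.
    apply: (@deriv_ge0_le _ (fun s => dg s - df s)) => // s sab.
      by apply: derB; [exact: gd|exact: fd].
    by have := H _ sab; rewrite ler_norml => /andP[]; lra.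
  by rewrite /F; lra.
Qed.

Lemma deriv_bound f (df : R -> R) c a b : a <= b ->
  (forall s, a <= s <= b -> is_derive s 1 f (df s)) ->
  (forall s, a <= s <= b -> `|df s| <= c) -> `|f b - f a| <= c * (b - a).
Proof.
move=> ab fd H; rewrite mulrBr.
apply: (@deriv_abs_le _ df (fun s => c * s) (fun=> c)) => // s sab.
by have := derMl c (derX s); rewrite mulr1.
Qed.

(* If the derivative exceeded [c / (s + r)] once, it would stay bounded away from [0]
   and [f] would grow linearly. *)
Lemma sublinear_deriv_le f (df ddf : R -> R) (c r : R) : 0 < r -> 0 <= c ->
  (forall s : R, 0 <= s -> is_derive s 1 f (df s)) ->
  (forall s : R, 0 <= s -> is_derive s 1 df (ddf s)) ->
  (forall s : R, 0 <= s -> `|ddf s| <= c / (s + r) ^+ 2) ->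
  (forall e : R, 0 < e -> exists S, forall s, S <= s -> `|f s| <= e * s) ->
  forall s : R, 0 <= s -> `|df s| <= c / (s + r).
Proof.
move=> r0 c0 + + + + s0 s00.
wlog suff W : f df ddf / (forall s : R, 0 <= s -> is_derive s 1 f (df s)) ->
    (forall s : R, 0 <= s -> is_derive s 1 df (ddf s)) ->
    (forall s : R, 0 <= s -> `|ddf s| <= c / (s + r) ^+ 2) ->
    (forall e : R, 0 < e -> exists S, forall s, S <= s -> `|f s| <= e * s) ->
    df s0 <= c / (s0 + r).
  move=> f1 f2 f3 f4; rewrite ler_norml W// andbT.
  have : - df s0 <= c / (s0 + r).
    apply: (W (fun s => - f s) (fun s => - df s) (fun s => - ddf s)).
    - by move=> s /f1; exact: derN.
    - by move=> s /f2; exact: derN.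
    - by move=> s /f3; rewrite normrN.
    - by move=> e /f4[S HS]; exists S => s /HS; rewrite normrN.
  by lra.
move=> f1 f2 f3 f4; rewrite leNgt; apply/negP => lt.
pose e := df s0 - c / (s0 + r); have e0 : 0 < e by rewrite subr_gt0.
have df_ge s : s0 <= s -> e <= df s.
  move=> ss.
  pose F s := df s - c / (s + r); have : F s0 <= F s.
    apply: (@deriv_ge0_le _ (fun s => ddf s - c * (- 1 / (s + r) ^+ 2))) => // t /andP[t0 _].
      apply: derB; first by apply: f2; lra.
      apply: derMl; apply: derV; first by rewrite gt_eqF//; lra.
      by have := derD (derX t) (derC t r); rewrite addr0.
    have := f3 t; rewrite ler_norml => /(_ ltac:(lra)) /andP[+ _].
    by rewrite mulN1r mulrN; lra.
  have : 0 <= c / (s + r) by rewrite divr_ge0//; lra.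
  by rewrite /e /F; lra.
have f_ge s : s0 <= s -> e * (s - s0) <= f s - f s0.
  move=> ss.
  pose F s := f s - e * s; have : F s0 <= F s.
    apply: (@deriv_ge0_le _ (fun s => df s - e * 1)) => // t /andP[t0 _].
      by apply: (derB (f1 _ _) (derMl e (derX t))); lra.
    by have := df_ge _ t0; lra.
  by rewrite /F; lra.
have [S HS] := f4 (e / 2) ltac:(lra).
(* At [s1] the lower bound e (s - s0) - |f s0| exceeds (e / 2) s. *)
pose s1 := Num.max (Num.max S s0) (2 * (s0 + `|f s0| / e) + 1).
have h1 : S <= s1 by rewrite /s1 !le_max lexx.
have h2 : s0 <= s1 by rewrite /s1 !le_max lexx orbT.
have h3 : 2 * (s0 + `|f s0| / e) + 1 <= s1 by rewrite /s1 !le_max lexx !orbT.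
have := HS _ h1; have := f_ge _ h2; rewrite ler_norml => k1 /andP[_ k2].
have h4 : e * (2 * (s0 + `|f s0| / e) + 1) <= e * s1 by rewrite ler_wpM2l// ltW.
have h5 : e * (`|f s0| / e) = `|f s0| by rewrite mulrC divfK// gt_eqF.
have := ler_norm (- f s0); rewrite normrN.
by nra.
Qed.

(* [sqrt] replaces the logarithm that integrating [c / (s + r)] would give. *)
Lemma deriv_sqrt_bound f (df : R -> R) (c r s : R) : 0 < r -> 0 <= c -> 0 <= s ->
  (forall s : R, 0 <= s -> is_derive s 1 f (df s)) ->
  (forall s : R, 0 <= s -> `|df s| <= c / (s + r)) ->
  `|f s - f 0| <= 2 * c / Num.sqrt r * Num.sqrt (s + r).
Proof.
move=> r0 c0 s0 fd H.
have sr0 : 0 < Num.sqrt r by rewrite sqrtr_gt0.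
pose C := 2 * c / Num.sqrt r.
pose F s := C * Num.sqrt (s + r); apply: (@le_trans _ _ (F s - F 0)).
  have fd' (t : R) : 0 <= t <= s -> is_derive t 1 f (df t) by move=> /andP[t0 _]; exact: fd.
  have Fd (t : R) : 0 <= t <= s -> is_derive t 1 F (C * (1 / (2 * Num.sqrt (t + r)))).
    move=> /andP[t0 _]; have tr : 0 < t + r by lra.
    have dX : is_derive t 1 (fun s => s + r) 1.
      by have := derD (derX t) (derC t r); rewrite addr0.
    exact: (derMl C (@der_sqrt (fun s => s + r) t 1 tr dX)).
  apply: (deriv_abs_le s0 fd' Fd) => t /andP[t0 _].
  apply: (le_trans (H _ t0)).
  have tr0 : 0 < Num.sqrt (t + r) by rewrite sqrtr_gt0; lra.
  have -> : C * (1 / (2 * Num.sqrt (t + r))) = c / (Num.sqrt r * Num.sqrt (t + r)).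
    by rewrite /C; field; rewrite !gt_eqF.
  rewrite ler_wpM2l// lef_pV2 ?posrE ?mulr_gt0//; last lra.
  rewrite -[leRHS]sqr_sqrtr ?expr2; last lra.
  by rewrite ler_pM2r// ler_wsqrtr//; lra.
rewrite /F gerBl mulr_ge0 ?sqrtr_ge0//.
by rewrite /C divr_ge0 ?sqrtr_ge0// mulr_ge0.
Qed.

End Calculus.

(** * The sup norm of a matrix and its entries *)

Section MatrixNorm.
Context {R : realType} {p q : nat}.
Implicit Types x : 'M[R]_(p, q).

Lemma ler_coord_norm x i j : `|x i j| <= `|x|.
Proof.
rewrite [leRHS]/Num.Def.normr/= mx_normrE.
by apply: le_trans; last exact: (le_bigmax _ _ (i, j)).
Qed.

Lemma mxnorm_le x (c : R) : 0 <= c -> (forall i j, `|x i j| <= c) -> `|x| <= c.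
Proof.
move=> c0 H; rewrite /Num.Def.normr/= mx_normrE.
by apply: bigmax_le => // -[i j] _; exact: H.
Qed.

Lemma mxB_coord (x y : 'M[R]_(p, q)) i j : (x - y) i j = x i j - y i j.
Proof. by rewrite !mxE. Qed.

End MatrixNorm.

(** * The potential and the force away from collisions *)

Section Potential.
Context {R : realType} {d N : nat}.
Variable m : 'I_N -> R.
Hypothesis m_gt0 : forall i, 0 < m i.
Implicit Types x y z : 'M[R]_(N, d).

(** A quantitative [inOmega]: the bounds on [U] and [gradU] depend on the configuration through
    [eta] alone. *)
Definition well_separated (eta : R) x := forall i j, i != j -> eta <= dist_bodies x i j.

Lemma dist_bodies_sym x i j : dist_bodies x i j = dist_bodies x j i.
Proof. by congr Num.sqrt; apply: eq_bigr => k _; rewrite -sqrrN opprB. Qed.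

Lemma dist_bodies_ge0 x i j : 0 <= dist_bodies x i j.
Proof. exact: sqrtr_ge0. Qed.

Lemma dist_bodies_sqr x i j :
  dist_bodies x i j ^+ 2 = \sum_(k < d) (x i k - x j k) ^+ 2.
Proof. by rewrite sqr_sqrtr// sumr_ge0// => k _; rewrite sqr_ge0. Qed.

Lemma coord_le_dist x i j k : `|x i k - x j k| <= dist_bodies x i j.
Proof.
rewrite -[leLHS]ger0_norm// -ler_sqr ?nnegrE ?dist_bodies_ge0// ger0_norm//.
rewrite dist_bodies_sqr real_normK ?num_real// (bigD1 k)//= lerDl.
by rewrite sumr_ge0// => l _; rewrite sqr_ge0.
Qed.

Lemma dist_bodies_gt0 x i j : row i x != row j x -> 0 < dist_bodies x i j.
Proof.
move=> /eqP nij; rewrite lt_neqAle dist_bodies_ge0 andbT eq_sym.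
apply/eqP => d0; apply: nij; apply/rowP => k; rewrite !mxE; apply/eqP.
by rewrite -subr_eq0 -normr_le0 -d0 coord_le_dist.
Qed.

Lemma inOmega_dist x : inOmega x <-> forall i j, i != j -> 0 < dist_bodies x i j.
Proof.
split=> [xO i j ij|H i j ij]; first exact/dist_bodies_gt0/xO.
apply/eqP => /rowP e; have := H _ _ ij.
rewrite /dist_bodies big1 ?sqrtr0 ?ltxx// => k _.
by have := e k; rewrite !mxE => ->; rewrite subrr expr0n.
Qed.

Lemma well_separated_inOmega eta x : 0 < eta -> well_separated eta x -> inOmega x.
Proof. by move=> e0 sx; apply/inOmega_dist => i j /sx; exact: lt_le_trans. Qed.

(** Multiplying by the sum of the two distances turns their difference into a difference of squares,
    which factors coordinate by coordinate. The Euclidean triangle inequality is bypassed at the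
    price of the factor [d]. *)
Lemma dist_bodies_lip x y i j :
  `|dist_bodies x i j - dist_bodies y i j| <= 2 * d%:R * `|x - y|.
Proof.
set P := dist_bodies x i j; set Q := dist_bodies y i j.
have [PQ0|PQ0] := leP (P + Q) 0.
  have P0 := dist_bodies_ge0 x i j; have Q0 := dist_bodies_ge0 y i j.
  have [-> ->] : P = 0 /\ Q = 0 by rewrite /P /Q in PQ0 *; split; lra.
  by rewrite subrr normr0 !mulr_ge0.
rewrite -(ler_pM2r PQ0) -[X in _ * X <= _](gtr0_norm PQ0) -normrM.
rewrite -subr_sqr !dist_bodies_sqr -sumrB.
apply: (le_trans (ler_norm_sum _ _ _)).
have -> : 2 * d%:R * `|x - y| * (P + Q) = \sum_(k < d) 2 * `|x - y| * (P + Q).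
  by rewrite sumr_const card_ord -mulr_natl; ring.
apply: ler_sum => k _; rewrite subr_sqr normrM ler_pM//.
  have -> : x i k - x j k - (y i k - y j k) = (x - y) i k - (x - y) j k.
    by rewrite !mxE; ring.
  apply: (le_trans (ler_normB _ _)).
  by have := ler_coord_norm (x - y) i k; have := ler_coord_norm (x - y) j k; lra.
apply: (le_trans (ler_normD _ _)).
by rewrite lerD// coord_le_dist.
Qed.

Lemma dist_bodiesZ (t : R) x i j : 0 <= t ->
  dist_bodies (t *: x) i j = t * dist_bodies x i j.
Proof.
move=> t0; rewrite /dist_bodies -[X in X * _](ger0_norm t0) -sqrtr_sqr -sqrtrM ?sqr_ge0//.
by congr Num.sqrt; rewrite mulr_sumr; apply: eq_bigr => k _; rewrite !mxE; ring.
Qed.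

(** Passes from the sum over [j != i] in [gradU] to the sum over [i < j] in [U]; the derivative of
    [U] and the conservation of momentum both rest on it. *)
Lemma sum_offdiag (G : 'I_N -> 'I_N -> R) :
  \sum_i \sum_(j | j != i) G i j =
  \sum_(i < N) \sum_(j < N | (i < j)%N) (G i j + G j i).
Proof.
under [RHS]eq_bigr do rewrite big_split/=.
rewrite big_split/= [X in _ = _ + X](exchange_big_dep xpredT)//= -big_split/=.
apply: eq_bigr => i _; rewrite (bigID (fun j : 'I_N => (i < j)%N))/=; congr (_ + _).
  apply: eq_bigl => j; case: ltnP => //= ij; last by rewrite andbF.
  by rewrite andbT -val_eqE/= gtn_eqF.
by apply: eq_bigl => j; rewrite -leqNgt -val_eqE/= ltn_neqAle.
Qed.

(** Here [P], [Q] are distances and [p], [q] coordinate differences. The factor 4 counts one term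
    for changing [p] and three for telescoping the cube, each at most D / eta^3 because |p / P| <=
    1. *)
Lemma inv_cube_lip (p q P Q D eta : R) : 0 < eta -> eta <= P -> eta <= Q ->
  `|p| <= P -> `|P - Q| <= D -> `|p - q| <= D ->
  `|p / P ^+ 3 - q / Q ^+ 3| <= 4 * D / eta ^+ 3.
Proof.
move=> e0 eP eQ pP PQ pq.
have P0 : 0 < P by lra. have Q0 : 0 < Q by lra.
have D0 : 0 <= D by apply: le_trans PQ.
have inv A : eta <= A -> 0 <= A^-1 <= eta^-1.
  by move=> eA; rewrite invr_ge0 lef_pV2 ?posrE//; lra.
have /andP[iP iP'] := inv _ eP; have /andP[iQ iQ'] := inv _ eQ.
have ie : 0 <= eta^-1 by lra.
have -> : p / P ^+ 3 - q / Q ^+ 3 = (p - q) * (Q^-1 ^+ 3)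
   + p / P * ((Q - P) * (P^-1 ^+ 2 * Q^-1 + P^-1 * Q^-1 ^+ 2 + Q^-1 ^+ 3)).
  by field; rewrite !gt_eqF.
have m3 (A B C : R) : 0 <= A <= eta^-1 -> 0 <= B <= eta^-1 -> 0 <= C <= eta^-1 ->
    0 <= A * B * C <= eta^-1 ^+ 3.
  move=> /andP[A0 A1] /andP[B0 B1] /andP[C0 C1].
  by rewrite !mulr_ge0//= !exprS expr0 mulr1 mulrA ler_pM ?mulr_ge0// ler_pM.
have /andP[c1 c2] := m3 _ _ _ (inv _ eQ) (inv _ eQ) (inv _ eQ).
have /andP[b1 b2] := m3 _ _ _ (inv _ eP) (inv _ eP) (inv _ eQ).
have /andP[a1 a2] := m3 _ _ _ (inv _ eP) (inv _ eQ) (inv _ eQ).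
set E := eta^-1 ^+ 3 in a2 b2 c2.
have -> : 4 * D / eta ^+ 3 = D * E + 1 * (D * (E + E + E)).
  by rewrite /E -exprVn; ring.
apply: (le_trans (ler_normD _ _)); rewrite !normrM; apply: lerD.
  by apply: ler_pM => //; rewrite ger0_norm ?exprn_ge0//; lra.
apply: ler_pM; rewrite ?normr_ge0 ?mulr_ge0//.
  by rewrite normfV ?(gtr0_norm P0) ler_pdivrMr// mul1r.
apply: ler_pM => //; first by rewrite distrC.
by rewrite ger0_norm; lra.
Qed.

Let Mm := \sum_i m i.
Let Mm_ge0 : 0 <= Mm. Proof. by rewrite sumr_ge0// => i _; exact/ltW. Qed.

Lemma gradU_bound eta x : 0 < eta -> well_separated eta x -> `|gradU m x| <= Mm / eta ^+ 2.
Proof.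
move=> e0 sx; apply: mxnorm_le => [|i k]; first by rewrite divr_ge0// sqr_ge0.
rewrite mxE (le_trans (ler_norm_sum _ _ _))// /Mm mulr_suml.
rewrite [leRHS](bigID (fun j => j != i))/=.
apply: ler_wpDr.
  by rewrite sumr_ge0// => j _; rewrite divr_ge0 ?sqr_ge0 ?ltW.
apply: ler_sum => j ji; have sij := sx i j; rewrite eq_sym in sij.
have dp : 0 < dist_bodies x i j by apply: lt_le_trans (sij ji).
rewrite -mulrA normrM (gtr0_norm (m_gt0 j)) ler_pM2l//.
rewrite normrM normfV (gtr0_norm (exprn_gt0 _ dp)) distrC.
apply: (@le_trans _ _ (dist_bodies x i j / dist_bodies x i j ^+ 3)).
  by rewrite ler_pM2r ?coord_le_dist// invr_gt0 exprn_gt0.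
have -> : dist_bodies x i j / dist_bodies x i j ^+ 3 = (dist_bodies x i j ^+ 2)^-1.
  by field; rewrite gt_eqF.
by rewrite lef_pV2 ?posrE ?exprn_gt0// lerXn2r ?nnegrE ?(ltW e0) ?(ltW dp) ?sij.
Qed.

Lemma gradU_lip eta x y : 0 < eta -> well_separated eta x -> well_separated eta y ->
  `|gradU m x - gradU m y| <= Mm * (4 * (2 * d.+1%:R)) / eta ^+ 3 * `|x - y|.
Proof.
move=> e0 sx sy; apply: mxnorm_le => [|i k].
  by rewrite !mulr_ge0// invr_ge0 exprn_ge0// ltW.
rewrite !mxE -sumrB (le_trans (ler_norm_sum _ _ _))//.
have -> : Mm * (4 * (2 * d.+1%:R)) / eta ^+ 3 * `|x - y| =
   \sum_j m j * (4 * (2 * d.+1%:R * `|x - y|) / eta ^+ 3).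
  by rewrite -mulr_suml -/Mm; ring.
rewrite [leRHS](bigID (fun j => j != i))/=.
apply: ler_wpDr.
  rewrite sumr_ge0// => j _; rewrite mulr_ge0 ?(ltW (m_gt0 j))// mulr_ge0//.
  by rewrite invr_ge0 exprn_ge0// ltW.
apply: ler_sum => j ji; rewrite eq_sym in ji.
rewrite -[X in `|X - _|]mulrA -[X in `|_ - X|]mulrA -mulrBr.
rewrite normrM (gtr0_norm (m_gt0 j)) ler_pM2l//.
apply: inv_cube_lip => //; [exact: sx|exact: sy| | |].
- by rewrite distrC coord_le_dist.
- apply: (le_trans (dist_bodies_lip _ _ _ _)).
  by rewrite ler_wpM2r// ler_wpM2l// ler_nat.
- have -> : x j k - x i k - (y j k - y i k) = (x - y) j k - (x - y) i k.
    by rewrite !mxE; ring.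
  apply: (le_trans (ler_normB _ _)).
  have := ler_coord_norm (x - y) i k; have := ler_coord_norm (x - y) j k.
  (* With [d.+1] the constant also dominates the bound 2 |x - y| on the coordinate differences,
     whatever [d]. *)
  have : 1 * `|x - y| <= d.+1%:R * `|x - y| by rewrite ler_wpM2r// ler1n.
  by lra.
Qed.

Lemma U_ge0 x : 0 <= U m x.
Proof.
rewrite /U sumr_ge0// => i _; rewrite sumr_ge0// => j _.
by rewrite divr_ge0 ?dist_bodies_ge0// mulr_ge0// ltW.
Qed.

Lemma U_term_bound (c : R) (F : 'I_N -> 'I_N -> R) : 0 <= c ->
  (forall i j : 'I_N, (i < j)%N -> `|F i j| <= m i * m j * c) ->
  `|\sum_(i < N) \sum_(j < N | (i < j)%N) F i j| <= Mm ^+ 2 * c.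
Proof.
move=> c0 H; have -> : Mm ^+ 2 * c = \sum_i \sum_j m i * m j * c.
  rewrite expr2 /Mm -mulrA mulr_suml; apply: eq_bigr => i _.
  by rewrite mulr_suml mulr_sumr; apply: eq_bigr => j _; rewrite mulrA.
apply: (le_trans (ler_norm_sum _ _ _)); apply: ler_sum => i _.
apply: (le_trans (ler_norm_sum _ _ _)).
rewrite [leRHS](bigID (fun j : 'I_N => (i < j)%N))/= ler_wpDr//.
  by rewrite sumr_ge0// => j _; rewrite !mulr_ge0// ltW.
by apply: ler_sum => j; exact: H.
Qed.

Lemma U_bound eta x : 0 < eta -> well_separated eta x -> U m x <= Mm ^+ 2 / eta.
Proof.
move=> e0 sx; apply: (le_trans (ler_norm _)); apply: U_term_bound => [|i j ij].
  by rewrite invr_ge0 ltW.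
have sij : eta <= dist_bodies x i j by apply: sx; rewrite -val_eqE/= ltn_eqF.
have dp : 0 < dist_bodies x i j by lra.
rewrite ger0_norm; last by rewrite !mulr_ge0 ?invr_ge0// ltW.
by rewrite ler_pM2l ?mulr_gt0// lef_pV2 ?posrE.
Qed.

Lemma U_lip eta x y : 0 < eta -> well_separated eta x -> well_separated eta y ->
  `|U m x - U m y| <= Mm ^+ 2 * (2 * d%:R) / eta ^+ 2 * `|x - y|.
Proof.
move=> e0 sx sy; rewrite /U -sumrB.
under eq_bigr do rewrite -sumrB.
rewrite [leRHS](_ : _ = Mm ^+ 2 * (2 * d%:R / eta ^+ 2 * `|x - y|)); last by ring.
apply: U_term_bound => [|i j ij].
  by rewrite !mulr_ge0// invr_ge0 exprn_ge0// ltW.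
have ij' : i != j by rewrite -val_eqE/= ltn_eqF.
have sxij := sx _ _ ij'; have syij := sy _ _ ij'.
have lip := dist_bodies_lip x y i j.
move: sxij syij lip; set P := dist_bodies x i j; set Q := dist_bodies y i j => sP sQ lip.
have P0 : 0 < P by lra. have Q0 : 0 < Q by lra.
rewrite -mulrBr normrM ger0_norm; last by rewrite mulr_ge0// ltW.
rewrite ler_pM2l ?mulr_gt0//.
have -> : P^-1 - Q^-1 = (Q - P) * (P^-1 * Q^-1) by field; rewrite !gt_eqF.
rewrite normrM distrC [leRHS](_ : _ = 2 * d%:R * `|x - y| * (eta^-1 * eta^-1)).
  have iP : 0 <= P^-1 by rewrite invr_ge0 ltW.
  have iQ : 0 <= Q^-1 by rewrite invr_ge0 ltW.
  by rewrite ler_pM// (ger0_norm (mulr_ge0 iP iQ)) ler_pM// lef_pV2 ?posrE.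
by rewrite -exprVn; ring.
Qed.

(** Confirms that [gradU] is the gradient for the mass product: the derivative of a pair splits into
    one term per moving body, and the weight [m i] of [mdot] restores the factor absent from
    [gradU]. *)
Lemma der_U (p : R -> 'M[R]_(N, d)) (dp : 'M[R]_(N, d)) t : inOmega (p t) ->
  (forall i k, is_derive t 1 (fun s => p s i k) (dp i k)) ->
  is_derive t 1 (fun s => U m (p s)) (mdot m (gradU m (p t)) dp).
Proof.
move=> /inOmega_dist pO pd.
pose G i j := m i * m j * \sum_(k < d) (p t j k - p t i k) * dp i k / dist_bodies (p t) i j ^+ 3.
suff -> : mdot m (gradU m (p t)) dp = \sum_(i < N) \sum_(j < N | (i < j)%N) (G i j + G j i).
  apply: der_sum => i _; apply: der_sum => j ij.
  have dij : 0 < dist_bodies (p t) i j by apply: pO; rewrite -val_eqE/= ltn_eqF.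
  pose S' := \sum_(k < d) ((dp i k - dp j k) * (p t i k - p t j k) + (p t i k - p t j k) * (dp i k - dp j k)).
  have dS : is_derive t 1 (fun s => \sum_(k < d) (p s i k - p s j k) ^+ 2) S'.
    by apply: der_sum => k _; apply: derM; apply: derB.
  have dD : is_derive t 1 (fun s => dist_bodies (p s) i j) (S' / (2 * dist_bodies (p t) i j)).
    by apply: der_sqrt => //; rewrite -sqrtr_gt0.
  apply: is_derive_eq; first by apply: derMl; apply: derV dD; rewrite gt_eqF.
  rewrite /G (dist_bodies_sym _ j i) !mulr_sumr -big_split/= /S' !mulNr mulr_suml mulr_suml mulrN mulr_sumr -sumrN.
  by apply: eq_bigr => k _; field; rewrite gt_eqF.
rewrite -sum_offdiag; apply: eq_bigr => i _; rewrite mulr_sumr.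
under [RHS]eq_bigr do rewrite /G mulr_sumr.
rewrite exchange_big/=; apply: eq_bigr => k _.
by rewrite !mxE mulrA mulr_sumr mulr_suml; apply: eq_bigr => j _; ring.
Qed.

(** Action and reaction: the two terms of a pair cancel. Conservation of the total momentum
    follows. *)
Lemma gradU_com x k : \sum_i m i * gradU m x i k = 0.
Proof.
pose G i j := m i * (m j * (x j k - x i k) / dist_bodies x i j ^+ 3).
rewrite (_ : \sum_i _ = \sum_i \sum_(j | j != i) G i j); last first.
  by apply: eq_bigr => i _; rewrite mxE mulr_sumr.
rewrite sum_offdiag big1// => i _; rewrite big1// => j ij.
by rewrite /G (dist_bodies_sym _ j i); ring.
Qed.

End Potential.

(** * The mass inner product and its comparison with the sup norm *)

Section MassProduct.
Context {R : realType} {d N : nat}.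
Variable m : 'I_N -> R.
Hypothesis m_gt0 : forall i, 0 < m i.
Implicit Types x y z : 'M[R]_(N, d).

Lemma mdotC x y : mdot m x y = mdot m y x.
Proof. by apply: eq_bigr => i _; congr (_ * _); apply: eq_bigr => k _; rewrite mulrC. Qed.

Lemma mdotDl x y z : mdot m (x + y) z = mdot m x z + mdot m y z.
Proof.
rewrite /mdot -big_split/=; apply: eq_bigr => i _; rewrite -mulrDr -big_split/=.
by congr (_ * _); apply: eq_bigr => k _; rewrite mxE mulrDl.
Qed.

Lemma mdotZl c x y : mdot m (c *: x) y = c * mdot m x y.
Proof.
rewrite /mdot mulr_sumr; apply: eq_bigr => i _; rewrite [RHS]mulrCA.
by congr (_ * _); rewrite mulr_sumr; apply: eq_bigr => k _; rewrite mxE mulrA.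
Qed.

Lemma mdotNl x y : mdot m (- x) y = - mdot m x y.
Proof. by rewrite -scaleN1r mdotZl mulN1r. Qed.

Lemma mdotBl x y z : mdot m (x - y) z = mdot m x z - mdot m y z.
Proof. by rewrite mdotDl mdotNl. Qed.

Lemma mdotDr x y z : mdot m x (y + z) = mdot m x y + mdot m x z.
Proof. by rewrite mdotC mdotDl !(mdotC x). Qed.

Lemma mdotBr x y z : mdot m x (y - z) = mdot m x y - mdot m x z.
Proof. by rewrite mdotC mdotBl !(mdotC x). Qed.

Lemma mdotZr c x y : mdot m x (c *: y) = c * mdot m x y.
Proof. by rewrite mdotC mdotZl mdotC. Qed.

Lemma mnorm2_ge0 x : 0 <= mnorm2 m x.
Proof.
rewrite /mnorm2 /mdot sumr_ge0// => i _; rewrite mulr_ge0 ?(ltW (m_gt0 _))//.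
by rewrite sumr_ge0// => k _; rewrite -expr2 sqr_ge0.
Qed.

(** With a fixed vector and a velocity as arguments, this bounds the Lagrangian below by a linear
    form: it is the Fenchel inequality behind every calibration. *)
Lemma mdot_le_halves x y : mdot m x y <= 2^-1 * mnorm2 m x + 2^-1 * mnorm2 m y.
Proof.
have := mnorm2_ge0 (x - y); rewrite /mnorm2 mdotBl !mdotBr (mdotC y x).
by lra.
Qed.

Lemma mdot_bound : exists2 C : R, 0 < C & forall x y, `|mdot m x y| <= C * `|x| * `|y|.
Proof.
exists (\sum_i m i * d%:R + 1).
  by rewrite ltr_wpDl// sumr_ge0// => i _; rewrite mulr_ge0// ltW.
move=> x y; apply: (@le_trans _ _ ((\sum_i m i * d%:R) * `|x| * `|y|)); last first.
  by rewrite !ler_wpM2r// lerDl.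
rewrite (le_trans (ler_norm_sum _ _ _))// !mulr_suml; apply: ler_sum => i _.
rewrite normrM gtr0_norm// -!mulrA ler_pM2l// (le_trans (ler_norm_sum _ _ _))//.
rewrite mulr_natl -[X in _ *+ X]card_ord -sumr_const; apply: ler_sum => k _.
by rewrite normrM ler_pM// ler_coord_norm.
Qed.

Lemma mnorm2_lower : exists2 c : R, 0 < c & forall x, c * `|x| ^+ 2 <= mnorm2 m x.
Proof.
have S0 : 0 <= \sum_i (m i)^-1 by rewrite sumr_ge0// => i _; rewrite invr_ge0 ltW.
exists (1 + \sum_i (m i)^-1)^-1; first by rewrite invr_gt0 ltr_wpDr.
move=> x; rewrite mulrC ler_pdivrMr ?ltr_wpDr//.
set c := _ + _; have c0 : 0 < c by rewrite ltr_wpDr.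
have D0 : 0 <= mnorm2 m x * c by rewrite mulr_ge0 ?mnorm2_ge0// ltW.
rewrite -[leRHS](sqr_sqrtr D0) ler_sqr ?nnegrE ?sqrtr_ge0//.
apply: mxnorm_le => [|i k]; first exact: sqrtr_ge0.
rewrite -ler_sqr ?nnegrE ?sqrtr_ge0// sqr_sqrtr// real_normK ?num_real//.
have h1 : m i * x i k ^+ 2 <= mnorm2 m x.
  rewrite /mnorm2 /mdot (bigD1 i)//= ler_wpDr//.
    rewrite sumr_ge0// => j _; rewrite mulr_ge0 ?(ltW (m_gt0 _))//.
    by rewrite sumr_ge0// => l _; rewrite -expr2 sqr_ge0.
  rewrite ler_pM2l// (bigD1 k)//= -expr2 lerDl.
  by rewrite sumr_ge0// => l _; rewrite -expr2 sqr_ge0.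
have h2 : (m i)^-1 <= c.
  rewrite /c (bigD1 i)//= addrCA lerDl addr_ge0// sumr_ge0// => j _.
  by rewrite invr_ge0 ltW.
rewrite -[leLHS](mulKf (lt0r_neq0 (m_gt0 i))) mulrC ler_pM// ?invr_ge0 ?(ltW (m_gt0 i))//.
by rewrite mulr_ge0 ?sqr_ge0// ltW.
Qed.

Lemma der_mdot (p q : R -> 'M[R]_(N, d)) (dp dq : 'M[R]_(N, d)) (t : R) :
  (forall i k, is_derive t 1 (fun s => p s i k) (dp i k)) ->
  (forall i k, is_derive t 1 (fun s => q s i k) (dq i k)) ->
  is_derive t 1 (fun s => mdot m (p s) (q s)) (mdot m dp (q t) + mdot m (p t) dq).
Proof.
move=> pd qd; rewrite /mdot -big_split/=; apply: der_sum => i _; rewrite -mulrDr.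
by apply: derMl; rewrite -big_split/=; apply: der_sum => k _; exact: derM.
Qed.

End MassProduct.

(** * Estimates in a tube around the half-line of the multiples of [a] *)

Section Tube.
Context {R : realType} {d N : nat}.
Variable m : 'I_N -> R.
Hypothesis m_gt0 : forall i, 0 < m i.
Implicit Types x y z : 'M[R]_(N, d).

(** [e] is the aperture of the tube and [K] a common constant. The exponents come from homogeneity:
    in the tube the mutual distances grow like t. *)
Definition tube_const (a : 'M[R]_(N, d)) (e K : R) := [/\ 0 < e, 0 < K &
  forall t y z, 0 < t -> `|y - t *: a| <= e * t -> `|z - t *: a| <= e * t ->
  [/\ inOmega y, `|gradU m y| <= K / t ^+ 2,
      `|gradU m y - gradU m z| <= K / t ^+ 3 * `|y - z|,
      U m y <= K / t & `|U m y - U m z| <= K / t ^+ 2 * `|y - z| ] ].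

Lemma inOmega_separated x : inOmega x -> exists2 c : R, 0 < c & well_separated c x.
Proof.
move=> /inOmega_dist xO.
pose S := \sum_i \sum_(j | j != i) (dist_bodies x i j)^-1.
have S0 : 0 <= S.
  by apply: sumr_ge0 => i _; apply: sumr_ge0 => j _; rewrite invr_ge0 dist_bodies_ge0.
(* Below every mutual distance, and positive even when there is no pair of bodies. *)
exists (1 + S)^-1; first by rewrite invr_gt0 ltr_wpDr.
move=> i j ij; rewrite -[leRHS]invrK lef_pV2 ?posrE ?invr_gt0 ?xO ?ltr_wpDr//.
rewrite ler_wpDl// /S (bigD1 i)//= (bigD1 j) 1?eq_sym//= -addrA lerDl addr_ge0//.
  by apply: sumr_ge0 => l _; rewrite invr_ge0 dist_bodies_ge0.
by apply: sumr_ge0 => l _; apply: sumr_ge0 => k _; rewrite invr_ge0 dist_bodies_ge0.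
Qed.

Lemma tube_separated a : inOmega a -> exists e c : R, [/\ 0 < e, 0 < c &
  forall t y, 0 < t -> `|y - t *: a| <= e * t -> well_separated (c * t) y].
Proof.
move=> /inOmega_separated[c c0 sa]; have d0 : (0 : R) <= d%:R by [].
(* The distances in [t *: a] are at least c t, and this aperture changes them by at most c t / 2. *)
exists (c / (4 * d%:R + 1)), (c / 2).
split; [by rewrite divr_gt0//; lra|by lra|move=> t y t0 yt i j ij].
have := dist_bodies_lip y (t *: a) i j; rewrite (dist_bodiesZ _ _ _ (ltW t0)).
rewrite ler_norml => /andP[h _].
have h1 : 2 * d%:R * `|y - t *: a| <= c / 2 * t.
  apply: (@le_trans _ _ (2 * d%:R * (c / (4 * d%:R + 1) * t))).
    by rewrite ler_wpM2l// mulr_ge0.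
  rewrite mulrA ler_wpM2r ?(ltW t0)// mulrA ler_pdivrMr; last lra.
  by nra.
have h2 : t * c <= t * dist_bodies a i j by rewrite ler_pM2l// sa.
by lra.
Qed.

Lemma tube_const_exists a : inOmega a -> exists e K, tube_const a e K.
Proof.
move=> /tube_separated[e [c [e0 c0 H]]]; exists e.
pose M := \sum_i m i; have M0 : 0 <= M by rewrite sumr_ge0// => i _; exact/ltW.
pose K1 := M / c ^+ 2; pose K2 := M * (4 * (2 * d.+1%:R)) / c ^+ 3.
pose K3 := M ^+ 2 / c; pose K4 := M ^+ 2 * (2 * d%:R) / c ^+ 2.
have cp : 0 <= c by exact: ltW.
have K10 : 0 <= K1 by rewrite divr_ge0 ?exprn_ge0.
have K20 : 0 <= K2 by rewrite divr_ge0 ?mulr_ge0 ?exprn_ge0.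
have K30 : 0 <= K3 by rewrite divr_ge0 ?exprn_ge0.
have K40 : 0 <= K4 by rewrite divr_ge0 ?mulr_ge0 ?exprn_ge0.
exists (1 + K1 + K2 + K3 + K4); split => //; first lra.
move=> t y z t0 /(H _ _ t0) sy /(H _ _ t0) sz.
have ct0 : 0 < c * t by rewrite mulr_gt0.
have cn0 : c != 0 by rewrite gt_eqF.
have tn0 : t != 0 by rewrite gt_eqF.
split.
- exact: well_separated_inOmega sy.
- apply: (le_trans (gradU_bound m_gt0 ct0 sy)); rewrite exprMn invfM mulrA -/M -/K1.
  by rewrite ler_wpM2r ?invr_ge0 ?exprn_ge0 ?(ltW t0)//; lra.
- apply: (le_trans (gradU_lip m_gt0 ct0 sy sz)).
  rewrite exprMn invfM ler_wpM2r// (mulrA _ (c ^+ 3)^-1) -/M -/K2.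
  by rewrite ler_wpM2r ?invr_ge0 ?exprn_ge0 ?(ltW t0)//; lra.
- apply: (le_trans (U_bound m_gt0 ct0 sy)); rewrite invfM mulrA -/M -/K3.
  by rewrite ler_wpM2r ?invr_ge0 ?(ltW t0)//; lra.
- apply: (le_trans (U_lip m_gt0 ct0 sy sz)).
  rewrite exprMn invfM ler_wpM2r// (mulrA _ (c ^+ 2)^-1) -/M -/K4.
  by rewrite ler_wpM2r ?invr_ge0 ?exprn_ge0 ?(ltW t0)//; lra.
Qed.

End Tube.

(** * Solutions in the tube: decay of the velocity error, stability, uniqueness *)

Section Stability.
Context {R : realType} {d N : nat}.
Variable m : 'I_N -> R.
Implicit Types (x y z : 'M[R]_(N, d)) (g v : R -> 'M[R]_(N, d)).

Definition newton_from (t0 : R) g v := forall t, t0 < t ->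
  [/\ inOmega (g t), forall i k, is_derive t 1 (fun s => g s i k) (v t i k) &
      forall i k, is_derive t 1 (fun s => v s i k) (gradU m (g t) i k)].

Definition sublinear g := forall eta : R, 0 < eta ->
  exists S, forall s, S <= s -> `|g s| <= eta * s.

(** [r] is a time label: the motion starts near [r *: a] and feels at time s a force at most K / (s
    + r)^2. Staying in the tube does not fix the asymptotic velocity, hence the separate clause on
    sublinearity. *)
Definition tube_sol (a : 'M[R]_(N, d)) (e r : R) g v :=
  [/\ exists2 eps, 0 < eps & newton_from (- eps) g v,
      forall s : R, 0 <= s -> `|g s - (s + r) *: a| <= e * (s + r) &
      sublinear (fun s => g s - s *: a)].

Lemma sublinearB g v : sublinear g -> sublinear v -> sublinear (fun s => g s - v s).
Proof.
move=> gs vs eta eta0; have [S HS] := gs (eta / 2) ltac:(lra).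
have [S' HS'] := vs (eta / 2) ltac:(lra).
exists (Num.max S S') => s; rewrite ge_max => /andP[/HS h1 /HS' h2].
by apply: (le_trans (ler_normB _ _)); lra.
Qed.

Lemma sublinear_coord g i k : sublinear g ->
  forall eta : R, 0 < eta -> exists S, forall s, S <= s -> `|g s i k| <= eta * s.
Proof.
move=> gs eta /gs[S HS]; exists S => s /HS; apply: le_trans.
exact: ler_coord_norm.
Qed.

Lemma sublinear_shift g (a : 'M[R]_(N, d)) (c : R) : 0 <= c ->
  sublinear (fun s => g s - s *: a) -> sublinear (fun s => g (s + c) - s *: a).
Proof.
move=> c0 gs eta eta0; have [S HS] := gs (eta / 2) ltac:(lra).
exists (Num.max (Num.max S 0) (c + 2 * c * `|a| / eta)) => u; rewrite !ge_max.
move=> /andP[/andP[uS u0] uc].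
have h := HS (u + c) ltac:(lra).
have -> : g (u + c) - u *: a = (g (u + c) - (u + c) *: a) + c *: a.
  by apply/matrixP => i k; rewrite !mxE; ring.
apply: (le_trans (ler_normD _ _)); rewrite normrZ (ger0_norm c0).
have : eta * (c + 2 * c * `|a| / eta) <= eta * u by rewrite ler_pM2l.
have -> : eta * (c + 2 * c * `|a| / eta) = eta * c + 2 * c * `|a|.
  by field; rewrite gt_eqF.
by lra.
Qed.

Lemma newton_from_shift (t0 c : R) g v : 0 <= c -> newton_from t0 g v ->
  newton_from t0 (fun s => g (s + c)) (fun s => v (s + c)).
Proof.
move=> c0 nw t t0t; have [gO gd vd] := nw (t + c) ltac:(lra).
by split=> // i k; [exact: (der_shift (gd i k))|exact: (der_shift (vd i k))].
Qed.

Variables (a : 'M[R]_(N, d)) (e K : R).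
Hypothesis tK : tube_const m a e K.
Let e_gt0 : 0 < e. Proof. by case: tK. Qed.
Let K_gt0 : 0 < K. Proof. by case: tK. Qed.
Let tubeP t y z : 0 < t -> `|y - t *: a| <= e * t -> `|z - t *: a| <= e * t ->
  [/\ inOmega y, `|gradU m y| <= K / t ^+ 2,
      `|gradU m y - gradU m z| <= K / t ^+ 3 * `|y - z|,
      U m y <= K / t & `|U m y - U m z| <= K / t ^+ 2 * `|y - z| ].
Proof. by case: tK => _ _; exact. Qed.

(** The force bound is integrated from infinity; sublinearity of the deviation from [s *: a]
    excludes any limit velocity other than [a]. *)
Lemma tube_sol_velocity r g v : 0 < r -> tube_sol a e r g v ->
  forall s : R, 0 <= s -> `|v s - a| <= K / (s + r).
Proof.
move=> r0 [[eps eps0 gN] gT gs] s s0.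
apply: mxnorm_le => [|i k]; first by rewrite divr_ge0 ?(ltW K_gt0)//; lra.
rewrite !mxE.
apply: (@sublinear_deriv_le _ (fun s => (g s - s *: a) i k) (fun s => v s i k - a i k)
   (fun s => gradU m (g s) i k)) => //; first exact: ltW.
- move=> t t0; have [_ gd _] := gN t ltac:(lra).
  rewrite (_ : (fun s => _) = (fun s => g s i k - s * a i k)); last first.
    by apply/funext => u; rewrite !mxE.
  apply: derB => //; rewrite -[X in is_derive _ _ _ X]mulr1.
  by under eq_fun do rewrite mulrC; exact: (derMl _ (derX t)).
- move=> t t0; have [_ _ vd] := gN t ltac:(lra).
  by rewrite -[X in is_derive _ _ _ X]subr0; apply: derB => //; exact: derC.
- move=> t t0; apply: le_trans (ler_coord_norm _ _ _) _.
  by have [] := tubeP (_ : 0 < t + r) (gT _ t0) (gT _ t0); first lra.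
- exact: sublinear_coord.
Qed.

Section TwoSolutions.
Variables (r : R) (g1 v1 g2 v2 : R -> 'M[R]_(N, d)).
Hypothesis rK : 2 * K <= r.
Hypothesis sol1 : tube_sol a e r g1 v1.
Hypothesis sol2 : tube_sol a e r g2 v2.
Let r_gt0 : 0 < r. Proof. by move: rK K_gt0; lra. Qed.
Let dg (s : R) : 'M[R]_(N, d) := g1 s - g2 s.
Let dv (s : R) : 'M[R]_(N, d) := v1 s - v2 s.
Let d0 := `|dg 0|.

Let dg_der (s : R) i k : 0 <= s -> is_derive s 1 (fun s => dg s i k) (dv s i k).
Proof.
move=> s0; have [[e1 e10 /(_ s ltac:(lra))[_ h1 _]] _ _] := sol1.
have [[e2 e20 /(_ s ltac:(lra))[_ h2 _]] _ _] := sol2.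
rewrite /dg /dv !mxE; under eq_fun do rewrite !mxE; exact: derB.
Qed.

Let dv_der (s : R) i k : 0 <= s ->
  is_derive s 1 (fun s => dv s i k) ((gradU m (g1 s) - gradU m (g2 s)) i k).
Proof.
move=> s0; have [[e1 e10 /(_ s ltac:(lra))[_ _ h1]] _ _] := sol1.
have [[e2 e20 /(_ s ltac:(lra))[_ _ h2]] _ _] := sol2.
rewrite mxE [in X in is_derive _ _ _ (_ + X)]mxE.
by rewrite /dv; under eq_fun do rewrite !mxE; exact: derB.
Qed.

(** The forces differ by at most K / (s + r)^3 times M (s + r), which has the decay treated in
    [tube_sol_velocity] with K M in place of K. *)
Let dv_bound (M : R) : 0 <= M -> (forall s : R, 0 <= s -> `|dg s| <= M * (s + r)) ->
  forall s : R, 0 <= s -> `|dv s| <= K * M / (s + r).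
Proof.
have r0 := r_gt0; move=> M0 H s s0; have KM : 0 <= K * M by rewrite mulr_ge0// ltW.
apply: mxnorm_le => [|i k]; first by rewrite divr_ge0//; lra.
apply: (@sublinear_deriv_le _ (fun s => dg s i k) (fun s => dv s i k)
  (fun s => (gradU m (g1 s) - gradU m (g2 s)) i k)) => //.
- by move=> t; exact: dg_der.
- by move=> t; exact: dv_der.
- move=> t t0; have tr : 0 < t + r by lra.
  apply: le_trans (ler_coord_norm _ _ _) _.
  have [_ T1 _] := sol1; have [_ T2 _] := sol2.
  have [_ _ + _ _] := tubeP tr (T1 _ t0) (T2 _ t0).
  move=> /le_trans; apply; rewrite -/(dg t).
  apply: (@le_trans _ _ (K / (t + r) ^+ 3 * (M * (t + r)))).
    by rewrite ler_wpM2l ?H// divr_ge0 ?(ltW K_gt0)// exprn_ge0// ltW.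
  have -> : K / (t + r) ^+ 3 * (M * (t + r)) = K * M / (t + r) ^+ 2.
    by field; rewrite gt_eqF.
  exact: lexx.
- apply: sublinear_coord => eta eta0.
  have [_ _ s1] := sol1; have [_ _ s2] := sol2.
  have [S HS] := sublinearB s1 s2 eta0; exists S => t /HS.
  by rewrite opprB addrA subrK.
Qed.

(** [M] is the best constant in |dg s| <= M (s + r), finite because both motions are in the tube.
    Integrating twice improves it to d0 / r + M / 2, so it is at most 2 d0 / r. *)
Let dg_crude (s : R) : 0 <= s -> `|dg s| <= 2 * d0 / r * (s + r).
Proof.
have r0 := r_gt0; have e0 := e_gt0.
pose E := [set x | exists2 s, 0 <= s & x = `|dg s| / (s + r)].
have En : E (`|dg 0| / (0 + r)) by exists 0.
have Eb : ubound E (2 * e).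
  move=> _ [t t0 ->]; rewrite ler_pdivrMr; last lra.
  have [_ T1 _] := sol1; have [_ T2 _] := sol2.
  have -> : dg t = (g1 t - (t + r) *: a) - (g2 t - (t + r) *: a).
    by rewrite opprB addrA subrK.
  by apply: le_trans (ler_normB _ _) _; have := T1 _ t0; have := T2 _ t0; lra.
have Es : has_sup E by split; [exists (`|dg 0| / (0 + r))|exists (2 * e)].
pose M := sup E.
have HM t : 0 <= t -> `|dg t| <= M * (t + r).
  by move=> t0; rewrite -ler_pdivrMr; [apply: ub_le_sup; [exists (2 * e)|exists t]|lra].
have M0 : 0 <= M.
  by apply: le_trans (ub_le_sup _ En); [rewrite divr_ge0//; lra|exists (2 * e)].
have dvM := dv_bound M0 HM.
have h t : 0 <= t -> `|dg t| <= (d0 / r + M / 2) * (t + r).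
  move=> t0; have KMr : 0 <= K * M / r by rewrite divr_ge0 ?mulr_ge0 ?(ltW K_gt0)// ltW.
  have h1 : `|dg t - dg 0| <= K * M / r * t.
    apply: mxnorm_le => [|i k]; first by rewrite mulr_ge0.
    rewrite (_ : (dg t - dg 0) i k = dg t i k - dg 0 i k); last by rewrite !mxE.
    rewrite -[t in leRHS]subr0.
    apply: (@deriv_bound _ (fun s => dg s i k) (fun s => dv s i k)) => // u /andP[u0 _]; first exact: dg_der.
    apply: le_trans (ler_coord_norm _ _ _) _; apply: le_trans (dvM _ u0) _.
    by rewrite ler_wpM2l ?mulr_ge0 ?(ltW K_gt0)// lef_pV2 ?posrE//; lra.
  have h2 : `|dg t| <= d0 + K * M / r * t.
    rewrite -[X in `|X|](subrK (dg 0)); apply: le_trans (ler_normD _ _) _.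
    by rewrite -/d0; lra.
  apply: (le_trans h2).
  (* The assumption [2 * K <= r] enters here and provides the factor 1/2. *)
  have h3 : K * M / r * t <= M / 2 * (t + r).
    apply: (@le_trans _ _ (M / 2 * t)); last by rewrite ler_wpM2l//; lra.
    rewrite ler_wpM2r// ler_pdivrMr//.
    have : 0 <= M * (r - 2 * K) by rewrite mulr_ge0// subr_ge0.
    by lra.
  have h4 : d0 <= d0 / r * (t + r).
    rewrite -[X in X <= _](divfK (lt0r_neq0 r_gt0)) ler_wpM2l//; last lra.
    by rewrite divr_ge0// ?normr_ge0 ?(ltW r_gt0).
  by lra.
have : M <= d0 / r + M / 2.
  apply: ge_sup; first by exists (`|dg 0| / (0 + r)).
  by move=> _ [t t0 ->]; rewrite ler_pdivrMr ?h//; lra.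
move=> MM s0; apply: (le_trans (HM _ s0)); rewrite ler_wpM2r//; lra.
Qed.

Let c0 : 0 <= 2 * d0 / r.
Proof. by rewrite divr_ge0 ?mulr_ge0 ?normr_ge0 ?(ltW r_gt0). Qed.

Lemma stability_velocity (s : R) : 0 <= s -> `|v1 s - v2 s| <= 2 * K / r * `|g1 0 - g2 0| / (s + r).
Proof.
move=> s0; apply: (le_trans (dv_bound c0 dg_crude s0)).
by rewrite le_eqVlt; apply/orP; left; apply/eqP; rewrite /d0 /dg; ring.
Qed.

(** The growth is allowed to be that of a square root: multiplied by the velocity error, which is
    O(1/s), it still tends to 0, and this is how it enters the calibration. *)
Lemma stability_position (s : R) : 0 <= s ->
  `|g1 s - g2 s| <= `|g1 0 - g2 0| * (1 + 4 * K / r / Num.sqrt r * Num.sqrt (s + r)).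
Proof.
move=> s0; rewrite -/(dg s) -/(dg 0) -/d0.
rewrite -[X in `|X|](subrK (dg 0)); apply: le_trans (ler_normD _ _) _.
rewrite mulrDr mulr1 addrC lerD2l.
apply: mxnorm_le => [|i k].
  by rewrite !mulr_ge0 ?normr_ge0 ?invr_ge0 ?sqrtr_ge0 ?(ltW r_gt0)// ltW.
rewrite (_ : (dg s - dg 0) i k = dg s i k - dg 0 i k); last by rewrite !mxE.
have := @deriv_sqrt_bound _ (fun s => dg s i k) (fun s => dv s i k) (K * (2 * d0 / r)) r s r_gt0.
move=> /(_ _ s0 _ _)/le_trans; apply.
- by rewrite mulr_ge0// ltW.
- by move=> t; exact: dg_der.
- move=> t t0; apply: le_trans (ler_coord_norm _ _ _) _.
  exact: dv_bound.
- by rewrite le_eqVlt; apply/orP; left; apply/eqP; ring.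
Qed.

End TwoSolutions.

Lemma tube_sol_unique r g1 v1 g2 v2 : 2 * K <= r ->
  tube_sol a e r g1 v1 -> tube_sol a e r g2 v2 -> g1 0 = g2 0 ->
  forall s : R, 0 <= s -> g1 s = g2 s /\ v1 s = v2 s.
Proof.
move=> rK s1 s2 g0 s s0; split; apply/eqP; rewrite -subr_eq0 -normr_le0.
- by apply: le_trans (stability_position rK s1 s2 s0) _; rewrite g0 subrr normr0 mul0r.
- by apply: le_trans (stability_velocity rK s1 s2 s0) _; rewrite g0 subrr normr0 mulr0 mul0r.
Qed.

End Stability.

(** * Primitives on a half-line, and limits obtained by bracketing *)

Section Primitives.
Context {R : realType}.

Lemma half_pow_small (A eta : R) : 0 <= A -> 0 < eta ->
  exists n, A * 2^-1 ^+ n <= eta.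
Proof.
move=> A0 eta0; exists (Num.Def.archi_bound (A / eta)).
set n := Num.Def.archi_bound _.
have h1 : A / eta < n%:R by apply: archi_boundP; rewrite divr_ge0// ltW.
have h2 : n%:R <= 2 ^+ n :> R by rewrite -natrX ler_nat ltnW// ltn_expl.
have h3 : 0 < (2 : R) ^+ n by rewrite exprn_gt0.
rewrite exprVn ler_pdivrMr// mulrC -ler_pdivrMr//.
exact: le_trans (ltW h1) h2.
Qed.

Lemma half_pow_le0 (A x : R) : 0 <= A -> (forall n, x <= A * 2^-1 ^+ n) -> x <= 0.
Proof.
move=> A0 H; apply/ler_addgt0Pr => eta eta0; rewrite add0r.
by have [n] := half_pow_small A0 eta0; apply: le_trans.
Qed.

(** Completeness in a form that serves both for a sequence with geometric steps and for the limit at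
    infinity of a function with integrable derivative. *)
Lemma nested_limit (T : Type) (t0 : T) (le : T -> T -> Prop) (lo hi : T -> R) :
  (forall s t, le s t \/ le t s) ->
  (forall s t, le s t -> lo s <= lo t) -> (forall s t, le s t -> hi t <= hi s) ->
  (forall t, lo t <= hi t) -> exists l, forall t, lo t <= l <= hi t.
Proof.
move=> tot lo_inc hi_dec lohi; exists (sup (range lo)).
have ub t : ubound (range lo) (hi t).
  move=> _ [s _ <-]; case: (tot s t) => st.
    exact: le_trans (lo_inc _ _ st) (lohi _).
  exact: le_trans (lohi _) (hi_dec _ _ st).
move=> t; apply/andP; split.
  by apply: ub_le_sup; [exists (hi t0); exact: ub|exists t].
by apply: ge_sup; [exists (lo t0), t0|exact: ub].
Qed.

Lemma geometric_limit (u : nat -> R) (A : R) : 0 <= A ->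
  (forall n, `|u n.+1 - u n| <= A * 2^-1 ^+ n) ->
  exists l, forall n, `|l - u n| <= 2 * A * 2^-1 ^+ n.
Proof.
move=> A0 H.
(* The steps from n on add up to at most 2 A / 2^n, so these brackets are nested. *)
pose lo n := u n - 2 * A * 2^-1 ^+ n; pose hi n := u n + 2 * A * 2^-1 ^+ n.
have step n : lo n <= lo n.+1 /\ hi n.+1 <= hi n.
  have := H n; rewrite ler_norml /lo /hi exprS => /andP[].
  by split; lra.
have [| | |t|l Hl] := @nested_limit nat 0%N (fun s t => (s <= t)%N) lo hi.
- by move=> s t; case: (leqP s t) => h; [left|right; exact: ltnW].
- apply: (homo_leq (f := lo) (r := fun x y => x <= y)) => //.
  + by move=> y x z; exact: le_trans.
  + by move=> n; have [] := step n.
- apply: (homo_leq (f := hi) (r := fun x y => y <= x)) => //.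
  + by move=> y x z h1 h2; exact: le_trans h2 h1.
  + by move=> n; have [] := step n.
- have : 0 <= A * 2^-1 ^+ t by rewrite mulr_ge0// exprn_ge0.
  by rewrite /lo /hi; lra.
- exists l => n; have := Hl n; rewrite /lo /hi ler_norml => /andP[h1 h2].
  by apply/andP; split; lra.
Qed.

(** The derivative is obtained only in the open half-line, so each integration gives up a little at
    the left end. Hence the starting times -2, -3/2 and -1 below, all negative because the equation
    is wanted around time 0. *)
Lemma primitive_from (f : R -> R) (b : R) : (forall s, b <= s -> {for s, continuous f}) ->
  exists F : R -> R, forall s, b < s -> is_derive s 1 F (f s).
Proof.
move=> fc; exists (fun x => \int[lebesgue_measure]_(t in `[b, x]) f t) => s bs.
have fi : lebesgue_measure.-integrable `[b, s + 1] (EFin \o f).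
  apply: continuous_compact_integrable; first exact: segment_compact.
  apply: continuous_in_subspaceT => x; rewrite inE/= in_itv/= => /andP[bx _].
  exact: fc.
have [] := @continuous_FTC1_closed R f b s (s + 1) ltac:(lra) fi bs (fc _ (ltW bs)).
by move=> dF F'; split; [exact: dF|rewrite -derive1E; exact: F'].
Qed.

(** [V] is the primitive that vanishes at infinity: the limit of an arbitrary primitive [J] is
    bracketed by J(s) - C / (s + r) and J(s) + C / (s + r), then subtracted. *)
Lemma bounded_primitive (f : R -> R) (C r : R) : 0 <= C -> 2 <= r ->
  (forall s : R, -2 <= s -> {for s, continuous f}) ->
  (forall s : R, -1 <= s -> `|f s| <= C / (s + r) ^+ 2) ->
  exists V : R -> R, (forall s : R, -2 < s -> is_derive s 1 V (f s)) /\
    forall s : R, -1 <= s -> `|V s| <= C / (s + r).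
Proof.
move=> C0 r2 fc fb; have [J HJ] := primitive_from fc.
pose T := {s : R | -1 <= s}.
have dinv (t : R) : -1 <= t -> is_derive t 1 (fun s => C / (s + r)) (C * (- 1 / (t + r) ^+ 2)).
  move=> t1; apply: derMl; apply: derV; first by rewrite gt_eqF//; lra.
  by have := derD (derX t) (derC t r); rewrite addr0.
have [|[s s1] [t t1]|[s s1] [t t1]|[t t1]|l Hl] := @nested_limit T (exist _ (-1) (lexx _))
    (fun s t => sval s <= sval t) (fun s => J (sval s) - C / (sval s + r))
    (fun s => J (sval s) + C / (sval s + r)).
- by move=> s t; case: (leP (sval s) (sval t)) => h; [left|right; exact: ltW].
- move=> /= st; pose F s := J s - C / (s + r); rewrite -/(F s) -/(F t).
  apply: (@deriv_ge0_le _ _ (fun t => f t - C * (- 1 / (t + r) ^+ 2))) => // u /andP[u0 _].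
    by apply: derB; [apply: HJ; lra|apply: dinv; lra].
  have := fb u ltac:(lra); rewrite ler_norml => /andP[+ _].
  by rewrite mulN1r mulrN; lra.
- move=> /= st; pose F s := - (J s + C / (s + r)); rewrite -lerN2 -/(F s) -/(F t).
  apply: (@deriv_ge0_le _ _ (fun t => - (f t + C * (- 1 / (t + r) ^+ 2)))) => // u /andP[u0 _].
    by apply: derN; apply: derD; [apply: HJ; lra|apply: dinv; lra].
  have := fb u ltac:(lra); rewrite ler_norml => /andP[_ +].
  by rewrite mulN1r mulrN; lra.
- have : 0 <= C / (t + r) by rewrite divr_ge0//; lra.
  by rewrite /=; lra.
- exists (fun s => J s - l); split=> [s s2|s s1].
    by rewrite -[f s]subr0; exact: (derB (HJ _ s2) (derC _ _)).
  have /= /andP[h1 h2] := Hl (exist _ s s1).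
  by rewrite ler_norml; apply/andP; split; lra.
Qed.

(** Mixed boundary conditions: [V] vanishes at infinity, which will prescribe the limit velocity,
    and [P] vanishes at 0, which will prescribe the initial position. *)
Lemma double_primitive (f : R -> R) (C r : R) : 0 <= C -> 2 <= r ->
  (forall s : R, -2 <= s -> {for s, continuous f}) ->
  (forall s : R, -1 <= s -> `|f s| <= C / (s + r) ^+ 2) ->
  exists V P : R -> R, [/\ forall s : R, -(3/2) < s -> is_derive s 1 V (f s),
    forall s : R, -(3/2) < s -> is_derive s 1 P (V s), P 0 = 0 &
    forall s : R, -1 <= s -> `|V s| <= C / (s + r)].
Proof.
move=> C0 r2 fc fb; have [V [HV Vb]] := bounded_primitive C0 r2 fc fb.
have [s s2|P HP] := @primitive_from V (-(3/2)).
  by apply: is_derive_cont; apply: HV; lra.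
exists V, (fun s => P s - P 0); split=> // [s s2|s s2|].
- by apply: HV; lra.
- by rewrite -[V s]subr0; exact: (derB (HP _ s2) (derC _ _)).
- by rewrite subrr.
Qed.

(** The bound with [C] makes [V] vanish at infinity; integrating from there replaces [C] by [D], the
    constant that the contraction has to track. *)
Lemma vanishing_primitive_bound (V dV : R -> R) (C D r : R) : 0 <= C -> 0 <= D -> 2 <= r ->
  (forall s : R, -1 <= s -> is_derive s 1 V (dV s)) ->
  (forall s : R, -1 <= s -> `|dV s| <= D / (s + r) ^+ 2) ->
  (forall s : R, -1 <= s -> `|V s| <= C / (s + r)) ->
  forall s : R, -1 <= s -> `|V s| <= D / (s + r).
Proof.
move=> C0 D0 r2 Vd dVb Vb s s1; apply/ler_addgt0Pr => eta eta0.
pose t := Num.max s (C / eta).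
have st : s <= t by rewrite le_max lexx.
have Ct : C / eta <= t by rewrite le_max lexx orbT.
have dinv (u : R) : -1 <= u -> is_derive u 1 (fun s => - (D / (s + r))) (- (D * (- 1 / (u + r) ^+ 2))).
  move=> u1; apply: derN; apply: derMl; apply: derV; first by rewrite gt_eqF//; lra.
  by have := derD (derX u) (derC u r); rewrite addr0.
have := @deriv_abs_le _ V dV (fun s => - (D / (s + r))) (fun u => - (D * (- 1 / (u + r) ^+ 2))) s t st.
move=> /(_ _ _ _) h.
have {h} h : `|V t - V s| <= D / (s + r).
  apply: (@le_trans _ _ (- (D / (t + r)) - - (D / (s + r)))); last first.
    have : 0 <= D / (t + r) by rewrite divr_ge0//; lra.
    by lra.
  apply: h => u /andP[u1 _]; [apply: Vd; lra|apply: dinv; lra|].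
  by rewrite mulN1r mulrN opprK; apply: dVb; lra.
have h2 : `|V t| <= eta.
  apply: le_trans (Vb _ _) _; first lra.
  rewrite ler_pdivrMr; last lra.
  rewrite -ler_pdivrMl// mulrC.
  by lra.
rewrite -[V s](subKr (V t)); apply: le_trans (ler_normB _ _) _.
by lra.
Qed.

Lemma sqrt_sublinear (c r eta : R) : 0 <= c -> 0 < r -> 0 < eta ->
  exists S : R, forall s, S <= s -> c * Num.sqrt (s + r) <= eta * s.
Proof.
move=> c0 r0 eta0; exists (Num.max r (2 * (c / eta) ^+ 2)) => s.
rewrite ge_max => /andP[sr sc].
have s0 : 0 < s by lra.
have ce : 0 <= c / eta by rewrite divr_ge0// ltW.
suff h : (c / eta) * Num.sqrt (s + r) <= s.
  have := ler_wpM2l (ltW eta0) h.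
  by rewrite mulrA (mulrC eta) divfK// gt_eqF.
rewrite -ler_sqr ?nnegrE ?(mulr_ge0 ce) ?sqrtr_ge0 ?(ltW s0)//.
rewrite exprMn sqr_sqrtr; last lra.
apply: (@le_trans _ _ ((c / eta) ^+ 2 * (2 * s))).
  by rewrite ler_wpM2l ?sqr_ge0//; lra.
by nra.
Qed.

End Primitives.

(** * Continuity of [U] and [gradU] on [inOmega] *)

Section Continuity.
Context {R : realType} {d N : nat}.
Variable m : 'I_N -> R.
Hypothesis m_gt0 : forall i, 0 < m i.
Implicit Types x y z : 'M[R]_(N, d).

Lemma mx_path_continuous p q (P : R -> 'M[R]_(p, q)) (dP : 'M[R]_(p, q)) (t : R) :
  (forall i k, is_derive t 1 (fun s => P s i k) (dP i k)) -> {for t, continuous P}.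
Proof.
move=> H; apply/differentiable_continuous/derivable1_diffP/derivable_mxP => i k.
by have ? := H i k; exact: ex_derive.
Qed.

Lemma coord_continuous p q (T : topologicalType) (P : T -> 'M[R]_(p, q)) t i k :
  {for t, continuous P} -> {for t, continuous (fun s => P s i k)}.
Proof.
move=> /cvgrPdist_le H; apply/cvgrPdist_le => eta eta0; have := H _ eta0.
apply: filterS => s; apply: le_trans; apply: le_trans (ler_coord_norm _ i k).
by rewrite !mxE.
Qed.

Lemma well_separated_near y c : 0 < c -> well_separated c y ->
  exists2 rho, 0 < rho & forall z, `|y - z| <= rho -> well_separated (c / 2) z.
Proof.
move=> c0 sy; have d0 : (0 : R) <= d%:R by [].
exists (c / (4 * d%:R + 1)); first by rewrite divr_gt0//; lra.
move=> z yz i j ij; have := dist_bodies_lip y z i j.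
rewrite ler_norml => /andP[_ h].
have h1 : 2 * d%:R * `|y - z| <= c / 2.
  apply: (@le_trans _ _ (2 * d%:R * (c / (4 * d%:R + 1)))).
    by rewrite ler_wpM2l// mulr_ge0.
  rewrite mulrA ler_pdivrMr; last lra.
  by nra.
by have := sy _ _ ij; lra.
Qed.

Lemma locally_lip_continuous (V W : normedModType R) (F : V -> W) (y : V) (L rho : R) : 0 < rho ->
  (forall z : V, `|y - z| <= rho -> `|F y - F z| <= L * `|y - z|) -> {for y, continuous F}.
Proof.
move=> rho0 H; apply/cvgrPdist_le => eta eta0.
have L1 : 0 < `|L| + 1 by rewrite ltr_wpDl.
near=> z.
have yz : `|y - z| <= rho by near: z; exact: cvgr_dist_le.
apply: (le_trans (H _ yz)).
apply: (@le_trans _ _ ((`|L| + 1) * `|y - z|)).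
  by rewrite ler_wpM2r//; have := ler_norm L; lra.
rewrite -ler_pdivlMl// mulrC.
near: z; apply: cvgr_dist_le => //; exact: divr_gt0.
Unshelve. all: by end_near. Qed.

Lemma gradU_continuous y : inOmega y -> {for y, continuous (gradU m)}.
Proof.
move=> /inOmega_separated[c c0 sy]; have [rho rho0 H] := well_separated_near c0 sy.
have sy' : well_separated (c / 2) y by move=> i j /sy; lra.
apply: (locally_lip_continuous rho0) => z /H sz.
by apply: (gradU_lip m_gt0 _ sy' sz); lra.
Qed.

Lemma U_continuous y : inOmega y -> {for y, continuous (U m)}.
Proof.
move=> /inOmega_separated[c c0 sy]; have [rho rho0 H] := well_separated_near c0 sy.
have sy' : well_separated (c / 2) y by move=> i j /sy; lra.
apply: (locally_lip_continuous (W := R^o) rho0) => z /H sz.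
by apply: (U_lip m_gt0 _ sy' sz); lra.
Qed.

End Continuity.

(** * Existence of a solution with limit shape [a], by successive approximations *)

Section Existence.
Context {R : realType} {d N : nat}.
Variable m : 'I_N -> R.
Hypothesis m_gt0 : forall i, 0 < m i.
Variables (a : 'M[R]_(N, d)) (e K : R).
Hypothesis tK : tube_const m a e K.
Let e_gt0 : 0 < e. Proof. by case: tK. Qed.
Let K_gt0 : 0 < K. Proof. by case: tK. Qed.
Let tubeP t y z : 0 < t -> `|y - t *: a| <= e * t -> `|z - t *: a| <= e * t ->
  [/\ inOmega y, `|gradU m y| <= K / t ^+ 2,
      `|gradU m y - gradU m z| <= K / t ^+ 3 * `|y - z|,
      U m y <= K / t & `|U m y - U m z| <= K / t ^+ 2 * `|y - z| ].
Proof. by case: tK => _ _; exact. Qed.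
Variables (r : R) (x : 'M[R]_(N, d)).
Hypothesis r4 : 4 <= r.
Hypothesis reK : K <= e * (r - 1).
Hypothesis rK : 2 * K <= r - 1.
Hypothesis xr : `|x - r *: a| <= e / 2 * r.

Let path := R -> 'M[R]_(N, d).
(** Freezes time below -1, so that accelerations are continuous on the whole line while the
    estimates hold from -1 on. There s + r is at least r - 1, which explains the [r - 1] in the
    hypotheses. *)
Let c (s : R) : R := Num.max s (-1).

Let c_ge s : -1 <= c s. Proof. by rewrite /c le_max lexx orbT. Qed.
Let cE (s : R) : -1 <= s -> c s = s. Proof. by move=> h; rewrite /c max_l. Qed.
Let c_cont : continuous c.
Proof.
move=> s; apply: (@continuous_max R R (fun s => s) (fun=> -1)); first exact: cvg_id.
exact: cvg_cst.
Qed.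

Let acc_ok (f : path) := (forall i k, continuous (fun s => f s i k)) /\
  forall s : R, -1 <= s -> `|f s| <= K / (s + r) ^+ 2.

Let integrates (f V P : path) := [/\ forall (s : R) i k, -(3/2) < s -> is_derive s 1 (fun s => V s i k) (f s i k),
  forall (s : R) i k, -(3/2) < s -> is_derive s 1 (fun s => P s i k) (V s i k), P 0 = x &
  forall s : R, -1 <= s -> `|V s - a| <= K / (s + r)].

Let integrates_exists f : acc_ok f -> exists V P, integrates f V P.
Proof.
move=> [fc fb].
have H (ik : 'I_N * 'I_d) : exists VP : (R -> R) * (R -> R),
    [/\ forall s : R, -(3/2) < s -> is_derive s 1 VP.1 (f s ik.1 ik.2),
    forall s : R, -(3/2) < s -> is_derive s 1 VP.2 (VP.1 s), VP.2 0 = 0 &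
    forall s : R, -1 <= s -> `|VP.1 s| <= K / (s + r)].
  have [|s|s s1|V [P HVP]] := @double_primitive _ (fun s => f s ik.1 ik.2) K r (ltW K_gt0).
  - by move: r4; lra.
  - by move=> _; exact: fc.
  - exact: le_trans (ler_coord_norm _ _ _) (fb _ s1).
  - by exists (V, P).
have [VP HVP] := choice H.
exists (fun s => \matrix_(i, k) (a i k + (VP (i, k)).1 s)).
exists (fun s => \matrix_(i, k) (x i k + s * a i k + (VP (i, k)).2 s)).
split.
- move=> s i k s2; have [h _ _ _] := HVP (i, k).
  under eq_fun do rewrite mxE.
  by rewrite -[f s i k]add0r; exact: (derD (derC _ _) (h _ s2)).
- move=> s i k s2; have [_ h _ _] := HVP (i, k).
  under eq_fun do rewrite mxE; rewrite mxE.
  have := derD (derD (derC s (x i k)) (derM (derX s) (derC s (a i k)))) (h _ s2).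
  by rewrite mul1r mulr0 addr0 add0r.
- by apply/matrixP => i k; rewrite mxE mul0r addr0; have [_ _ -> _] := HVP (i, k); rewrite addr0.
- move=> s s1; apply: mxnorm_le => [|i k].
    by rewrite divr_ge0 ?(ltW K_gt0)//; move: r4; lra.
  by rewrite !mxE addrC addKr; have [_ _ _ h] := HVP (i, k); exact: h.
Qed.

(** The iterates never leave the tube: an acceleration obeying the force bound produces a drift from
    [x + s *: a] of at most e |s|, and [x] itself uses only half of the aperture. *)
Let integrates_tube f V P : integrates f V P -> forall s : R, -1 <= s ->
  `|P s - (s + r) *: a| <= e * (s + r).
Proof.
move=> [Vd Pd P0 Vb] s s1.
have r4' := r4; have reK' := reK; have xr' := xr; have K0 := K_gt0; have e0 := e_gt0.
have r10 : 0 < r - 1 by lra.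
have Kr : K / (r - 1) <= e by rewrite ler_pdivrMr.
have Kr0 : 0 <= K / (r - 1) by rewrite divr_ge0//; lra.
have der i k (u : R) : -1 <= u -> is_derive u 1 (fun s => P s i k - s * a i k) (V u i k - a i k).
  move=> u1; have := derB (Pd u i k ltac:(lra)) (derM (derX u) (derC u (a i k))).
  by rewrite mul1r mulr0 addr0.
have bnd (u : R) i k : -1 <= u -> `|V u i k - a i k| <= K / (r - 1).
  move=> u1; have := ler_coord_norm (V u - a) i k; rewrite !mxE => /le_trans; apply.
  apply: (le_trans (Vb _ u1)); rewrite ler_wpM2l ?(ltW K0)// lef_pV2 ?posrE//; lra.
have h : `|P s - s *: a - x| <= K / (r - 1) * `|s|.
  apply: mxnorm_le => [|i k]; first by rewrite mulr_ge0.
  have -> : (P s - s *: a - x) i k = (P s i k - s * a i k) - (P 0 i k - 0 * a i k).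
    by rewrite !mxE P0 mul0r subr0.
  case: (leP 0 s) => s0.
    rewrite (ger0_norm s0) -[X in _ <= _ * X]subr0.
    apply: (@deriv_bound _ (fun s => P s i k - s * a i k) (fun u => V u i k - a i k)) => // u /andP[u0 _].
      by apply: der; lra.
    by apply: bnd; lra.
  rewrite (ltr0_norm s0) distrC -[X in _ <= _ * X]add0r.
  apply: (@deriv_bound _ (fun s => P s i k - s * a i k) (fun u => V u i k - a i k)) => [|u /andP[u0 _]|u /andP[u0 _]].
  - exact: ltW.
  - by apply: der; lra.
  - by apply: bnd; lra.
have -> : P s - (s + r) *: a = (P s - s *: a - x) + (x - r *: a).
  by rewrite scalerDl opprD !addrA subrK.
apply: (le_trans (ler_normD _ _)).
have h2 : K / (r - 1) * `|s| <= e * `|s| by rewrite ler_wpM2r.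
have h3 : K / (r - 1) * `|s| <= e / 1 * `|s| by lra.
(* For s in [-1, 0], [4 <= r] gives e |s| + (e / 2) r <= e (s + r). *)
case: (leP 0 s) => s0.
  by move: h h2; rewrite (ger0_norm s0); nra.
by move: h h2; rewrite (ltr0_norm s0); nra.
Qed.

(** The Picard map, from a path to the force along it; unrelated to the action potential of the same
    name. *)
Let phi (P : path) : path := fun s => gradU m (P (c s)).

Let acc_ok_phi f V P : integrates f V P -> acc_ok (phi P).
Proof.
move=> fVP; have tube := integrates_tube fVP; have r4' := r4; split=> [i k s|s s1].
  have [_ Pd _ _] := fVP.
  have cs := c_ge s.
  apply: (@coord_continuous _ _ _ _ (phi P)).
  apply: (@continuous_comp _ _ _ (fun s => P (c s)) (gradU m)).
    apply: (@continuous_comp _ _ _ c P); first exact: c_cont.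
    by apply: mx_path_continuous => i' k'; apply: Pd; lra.
  apply: gradU_continuous => //.
  by have [] := tubeP (_ : 0 < c s + r) (tube _ cs) (tube _ cs); first lra.
rewrite /phi cE//.
by have [] := tubeP (_ : 0 < s + r) (tube _ s1) (tube _ s1); first lra.
Qed.

(** Integration from infinity turns D / (s + r)^2 into D / (s + r) for the velocities, hence D (s +
    r) / (r - 1) for the positions, which agree at 0. The Lipschitz constant K / (s + r)^3 of the
    force brings back the original weight, with factor K / (r - 1) <= 1/2. *)
Let contraction f1 V1 P1 f2 V2 P2 D : 0 <= D ->
  integrates f1 V1 P1 -> integrates f2 V2 P2 ->
  (forall s : R, -1 <= s -> `|f1 s - f2 s| <= D / (s + r) ^+ 2) ->
  forall s : R, -1 <= s -> `|phi P1 s - phi P2 s| <= (D / 2) / (s + r) ^+ 2.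
Proof.
move=> D0 I1 I2 H s s1; have r4' := r4; have rK' := rK; have K0 := K_gt0.
have T1 := integrates_tube I1; have T2 := integrates_tube I2.
case: I1 => V1d P1d P10 V1b; case: I2 => V2d P2d P20 V2b.
have sr : 0 < s + r by lra.
rewrite /phi !cE//.
have [_ _ + _ _] := tubeP sr (T1 _ s1) (T2 _ s1).
move=> /le_trans; apply.
have vb i k (u : R) : -1 <= u -> `|V1 u i k - V2 u i k| <= D / (u + r).
  move: u; apply: (@vanishing_primitive_bound _ (fun u => V1 u i k - V2 u i k)
    (fun u => f1 u i k - f2 u i k) (2 * K)) => //; try lra.
  - by move=> u u1; apply: derB; [apply: V1d; lra|apply: V2d; lra].
  - move=> u u1; have := ler_coord_norm (f1 u - f2 u) i k; rewrite !mxE => /le_trans.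
    by apply; exact: H.
  - move=> u u1; have h1 := ler_coord_norm (V1 u - a) i k; have h2 := ler_coord_norm (V2 u - a) i k.
    rewrite !mxE in h1 h2; have := V1b _ u1; have := V2b _ u1.
    have -> : V1 u i k - V2 u i k = (V1 u i k - a i k) - (V2 u i k - a i k) by ring.
    by move=> h3 h4; apply: (le_trans (ler_normB _ _)); lra.
have Dr0 : 0 <= D / (r - 1) by rewrite divr_ge0//; lra.
have vb' i k (u : R) : -1 <= u -> `|V1 u i k - V2 u i k| <= D / (r - 1).
  by move=> u1; apply: (le_trans (vb _ _ _ u1)); rewrite ler_wpM2l// lef_pV2 ?posrE//; lra.
have dd i k (u : R) : -1 <= u -> is_derive u 1 (fun u => P1 u i k - P2 u i k) (V1 u i k - V2 u i k).
  by move=> u1; apply: derB; [apply: P1d; lra|apply: P2d; lra].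
have h : `|P1 s - P2 s| <= D / (r - 1) * (s + r).
  apply: (@le_trans _ _ (D / (r - 1) * `|s|)); last first.
    by rewrite ler_wpM2l//; case: (leP 0 s) => s0; [rewrite ger0_norm//|rewrite ltr0_norm//]; lra.
  apply: mxnorm_le => [|i k]; first by rewrite mulr_ge0.
  have -> : (P1 s - P2 s) i k = (P1 s i k - P2 s i k) - (P1 0 i k - P2 0 i k).
    by rewrite !mxE P10 P20 subrr subr0.
  case: (leP 0 s) => s0.
    rewrite (ger0_norm s0) -[X in _ <= _ * X]subr0.
    apply: (@deriv_bound _ (fun s => P1 s i k - P2 s i k) (fun u => V1 u i k - V2 u i k)) => // u /andP[u0 _].
      by apply: dd; lra.
    by apply: vb'; lra.
  rewrite (ltr0_norm s0) distrC -[X in _ <= _ * X]add0r.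
  apply: (@deriv_bound _ (fun s => P1 s i k - P2 s i k) (fun u => V1 u i k - V2 u i k)) => [|u /andP[u0 _]|u /andP[u0 _]].
  - exact: ltW.
  - by apply: dd; lra.
  - by apply: vb'; lra.
apply: (@le_trans _ _ (K / (s + r) ^+ 3 * (D / (r - 1) * (s + r)))).
  by rewrite ler_wpM2l// divr_ge0 ?(ltW K0)// exprn_ge0// ltW.
have -> : K / (s + r) ^+ 3 * (D / (r - 1) * (s + r)) = D * K / (r - 1) / (s + r) ^+ 2.
  by field; rewrite !gt_eqF//; lra.
rewrite ler_wpM2r ?invr_ge0 ?exprn_ge0 ?(ltW sr)// ler_pdivrMr; last lra.
have : 0 <= D * (r - 1 - 2 * K) by rewrite mulr_ge0//; lra.
by lra.
Qed.

Lemma picard_fixed_point : exists f V P, integrates f V P /\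
  forall s : R, -1 < s -> f s = gradU m (P s).
Proof.
have r4' := r4; have K0 := K_gt0.
have H (f : path) : exists VP : path * path, acc_ok f -> integrates f VP.1 VP.2.
  (* Outside [acc_ok] the pair (f, f) is a default value, so that [choice] yields a total map. *)
  have [/integrates_exists[V [P HVP]]|nf] := pselect (acc_ok f); first by exists (V, P).
  by exists (f, f).
have [VP HVP] := choice H.
pose Phi f := phi (VP f).2.
pose u n := iter n Phi (fun=> 0).
have u_ok n : acc_ok (u n).
  elim: n => [|n IH] /=.
    split=> [i k s|s s1]; last by rewrite normr0 divr_ge0 ?sqr_ge0// ltW.
    by under eq_fun do rewrite mxE; exact: cvg_cst.
  exact: acc_ok_phi (HVP _ IH).
have u_step n (s : R) : -1 <= s -> `|u n.+1 s - u n s| <= (K * 2^-1 ^+ n) / (s + r) ^+ 2.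
  elim: n s => [|n IH] s s1.
    by rewrite subr0 expr0 mulr1; have [_] := u_ok 1%N; exact.
  rewrite [K * _](_ : _ = K * 2^-1 ^+ n / 2); last by rewrite exprS; lra.
  apply: (contraction _ (HVP _ (u_ok n.+1)) (HVP _ (u_ok n))) => //.
  by rewrite mulr_ge0 ?exprn_ge0// ltW.
(* From the first one on, the iterates depend on s only through [c s], so the limit can be taken at
   [c s], where the estimates hold. *)
have uc n s : u n.+1 s = u n.+1 (c s).
  by rewrite /u/= /Phi /phi (cE (c_ge s)).
have lim (sik : R * 'I_N * 'I_d) : exists l : R, forall n,
    `|l - u n.+1 (c sik.1.1) sik.1.2 sik.2| <= 2 * (K / 2 / (c sik.1.1 + r) ^+ 2) * 2^-1 ^+ n.
  case: sik => [[s i] k] /=; have cs := c_ge s.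
  apply: geometric_limit; first by rewrite !divr_ge0 ?sqr_ge0//; lra.
  move=> n; have := u_step n.+1 _ cs; rewrite exprS => h.
  have := ler_coord_norm (u n.+2 (c s) - u n.+1 (c s)) i k; rewrite !mxE => /le_trans; apply.
  by apply: (le_trans h); rewrite le_eqVlt; apply/orP; left; apply/eqP; ring.
have [l Hl] := choice lim.
pose f s := \matrix_(i, k) l (s, i, k) : 'M[R]_(N, d).
(* The weight is kept in the rate of convergence because the last use of [contraction] requires
   it. *)
have fu s n : `|f s - u n.+1 (c s)| <= K * 2^-1 ^+ n / (c s + r) ^+ 2.
  have cs := c_ge s.
  apply: mxnorm_le => [|i k].
    by rewrite divr_ge0 ?sqr_ge0// mulr_ge0 ?exprn_ge0// ltW.
  rewrite mxB_coord [f s i k]mxE; apply: (le_trans (Hl (s, i, k) n)) => /=.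
  by rewrite le_eqVlt; apply/orP; left; apply/eqP; field; rewrite gt_eqF//; lra.
have fu1 s n : `|f s - u n.+1 (c s)| <= K * 2^-1 ^+ n.
  apply: (le_trans (fu s n)); rewrite ler_pdivrMr; last first.
    by rewrite exprn_gt0//; have := c_ge s; lra.
  rewrite ler_peMr ?mulr_ge0 ?exprn_ge0 ?(ltW K0)// -[leLHS](expr1n _ 2).
  by rewrite lerXn2r ?nnegrE//; have := c_ge s; lra.
have f_ok : acc_ok f.
  split=> [i k s|s s1].
    apply/cvgrPdist_le => eta eta0.
    have [n Hn] := @half_pow_small _ K (eta / 4) (ltW K0) ltac:(lra).
    have [uc' _] := u_ok n.+1.
    have /cvgrPdist_le/(_ (eta / 4) ltac:(lra)) := uc' i k s.
    apply: filterS => t ht.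
    have h1 := ler_coord_norm (f s - u n.+1 (c s)) i k.
    have h2 := ler_coord_norm (f t - u n.+1 (c t)) i k.
    rewrite -!uc in h1 h2.
    have := fu1 s n; have := fu1 t n; rewrite -!uc => h3 h4.
    have -> : f s i k - f t i k = (f s - u n.+1 s) i k - (f t - u n.+1 t) i k + (u n.+1 s i k - u n.+1 t i k).
      by rewrite !mxB_coord; ring.
    apply: (le_trans (ler_normD _ _)).
    have := ler_normB ((f s - u n.+1 s) i k) ((f t - u n.+1 t) i k).
    by lra.
  rewrite -subr_le0; apply: (@half_pow_le0 _ K); first exact: ltW.
  move=> n; have h := fu1 s n; rewrite cE// in h.
  have [_ /(_ _ s1) h2] := u_ok n.+1.
  have := ler_normD (f s - u n.+1 s) (u n.+1 s); rewrite subrK.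
  by lra.
exists f, (VP f).1, (VP f).2; split; first exact: HVP.
move=> s s1; have s1' := ltW s1.
apply/eqP; rewrite -subr_eq0 -normr_le0; apply: (@half_pow_le0 _ (2 * K)); first lra.
move=> n; have h1 := fu1 s n.+1; rewrite cE// in h1.
have h2 : `|Phi (u n.+1) s - Phi f s| <= (K * 2^-1 ^+ n / 2) / (s + r) ^+ 2.
  apply: (contraction _ (HVP _ (u_ok n.+1)) (HVP _ f_ok)) => //.
    by rewrite mulr_ge0 ?exprn_ge0// ltW.
  by move=> t t1; have := fu t n; rewrite cE// distrC.
have h3 : (K * 2^-1 ^+ n / 2) / (s + r) ^+ 2 <= K * 2^-1 ^+ n.
  have p0 : 0 <= K * 2^-1 ^+ n by rewrite mulr_ge0 ?exprn_ge0// ltW.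
  rewrite ler_pdivrMr; last by rewrite exprn_gt0//; lra.
  have : 1 <= (s + r) ^+ 2 by rewrite -(expr1n _ 2) lerXn2r ?nnegrE//; lra.
  by move=> q; nra.
(* [f] is close to [u n.+2], which is [Phi (u n.+1)], and [Phi] brings [u n.+1] closer to [Phi f];
   hence [f] is fixed by [Phi]. *)
have -> : f s - gradU m ((VP f).2 s) = (f s - u n.+2 s) + (Phi (u n.+1) s - Phi f s).
  by rewrite /= -/(Phi _) addrA subrK /Phi /phi cE.
apply: (le_trans (ler_normD _ _)); move: h1; rewrite exprS => h1.
have p0 : 0 <= K * 2^-1 ^+ n by rewrite mulr_ge0 ?exprn_ge0// ltW.
by lra.
Qed.

Lemma tube_sol_exists : exists g v,
  [/\ g 0 = x, newton_from m (-1) g v & tube_sol m a e r g v].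
Proof.
have r4' := r4; have K0 := K_gt0.
have [f [V [P [I fE]]]] := picard_fixed_point; exists P, V.
have T := integrates_tube I; case: I => Vd Pd P0 Vb.
have nw : newton_from m (-1) P V.
  move=> t t1; split.
  - by have [] := tubeP (_ : 0 < t + r) (T _ (ltW t1)) (T _ (ltW t1)); first lra.
  - by move=> i k; apply: Pd; lra.
  - by move=> i k; rewrite -fE//; apply: Vd; lra.
split=> //; split; [by exists 1|by move=> s s0; apply: T; lra|].
move=> eta eta0.
have r0 : 0 < r by lra.
have [S HS] := @sqrt_sublinear _ (2 * K / Num.sqrt r) r (eta / 2) ltac:(by rewrite divr_ge0 ?sqrtr_ge0//; lra) r0 ltac:(lra).
exists (Num.max (Num.max S 0) (2 * `|x| / eta)) => s; rewrite !ge_max => /andP[/andP[sS s0] sx].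
have h : `|P s - s *: a - x| <= 2 * K / Num.sqrt r * Num.sqrt (s + r).
  apply: mxnorm_le => [|i k]; first by rewrite !mulr_ge0 ?invr_ge0 ?sqrtr_ge0//; lra.
  have -> : (P s - s *: a - x) i k = (P s i k - s * a i k) - (P 0 i k - 0 * a i k).
    by rewrite !mxE P0 mul0r subr0.
  apply: (@deriv_sqrt_bound _ (fun s => P s i k - s * a i k) (fun u => V u i k - a i k)) => //.
  - exact: ltW.
  - move=> u u1; have := derB (Pd u i k ltac:(lra)) (derM (derX u) (derC u (a i k))).
    by rewrite mul1r mulr0 addr0.
  - move=> u u1; have := ler_coord_norm (V u - a) i k; rewrite !mxE => /le_trans; apply.
    by apply: Vb; lra.
have := ler_normD (P s - s *: a - x) x; rewrite subrK => /le_trans; apply.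
have := HS _ sS.
by move: sx; rewrite ler_pdivrMr//; lra.
Qed.

End Existence.

(** Lets t tend to infinity in a bound on a conserved quantity. *)
Lemma decay_le0 (R : realType) (B r s X : R) : 0 <= B -> 0 < r -> 0 <= s ->
  (forall t, s <= t -> X <= B / (t + r)) -> X <= 0.
Proof.
move=> B0 r0 s0 H; apply/ler_addgt0Pr => eta eta0; rewrite add0r.
pose t := Num.max s (B / eta).
have st : s <= t by rewrite le_max lexx.
have Bt : B / eta <= t by rewrite le_max lexx orbT.
apply: (le_trans (H _ st)); rewrite ler_pdivrMr; last lra.
rewrite -ler_pdivrMl// mulrC.
by lra.
Qed.

(** * Energy of the tube solutions, and a second-order estimate of [U] *)

Section Energy.
Context {R : realType} {d N : nat}.
Variable m : 'I_N -> R.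
Hypothesis m_gt0 : forall i, 0 < m i.
Implicit Types (x y z : 'M[R]_(N, d)) (g v : R -> 'M[R]_(N, d)).

Lemma tube_const_smaller (a : 'M[R]_(N, d)) (e e' K : R) : 0 < e' -> e' <= e ->
  tube_const m a e K -> tube_const m a e' K.
Proof.
move=> e0 ee [_ K0 H]; split=> // t y z t0 yt zt.
by apply: H => //; [apply: (le_trans yt)|apply: (le_trans zt)]; rewrite ler_pM2r.
Qed.

Lemma der_energy g v (t0 t : R) : newton_from m t0 g v -> t0 < t ->
  is_derive t 1 (fun s => 2^-1 * mnorm2 m (v s) - U m (g s)) 0.
Proof.
move=> /[apply] -[gO gd vd].
have := derB (derMl 2^-1 (der_mdot m vd vd)) (der_U m gO gd).
by rewrite (mdotC m (v t)); congr is_derive; lra.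
Qed.

(** The energy is constant, and at infinity the velocity tends to [a] while [U] tends to 0, both at
    the rate 1/t. *)
Lemma tube_sol_energy (a : 'M[R]_(N, d)) (e K r : R) g v : tube_const m a e K -> 0 < r -> tube_sol m a e r g v ->
  forall s : R, 0 <= s -> 2^-1 * mnorm2 m (v s) - U m (g s) = 2^-1 * mnorm2 m a.
Proof.
move=> tK r0 sol s s0; have [_ K0 tubeP] := tK; have [[eps eps0 nw] tb _] := sol.
have [C C0 HC] := mdot_bound (d := d) m_gt0.
pose E s := 2^-1 * mnorm2 m (v s) - U m (g s).
have Ec t : s <= t -> E t = E s.
  move=> st; apply/eqP; rewrite -subr_eq0 -normr_le0.
  apply: (@le_trans _ _ (0 * (t - s))); last by rewrite mul0r.
  apply: (@deriv_bound _ E (fun=> 0)) => // [u /andP[u0 _]|u _]; last by rewrite normr0.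
  by apply: der_energy nw _; lra.
apply/eqP; rewrite -subr_eq0 -normr_le0 -/(E s).
pose B := 2^-1 * (C * K * (K / r + 2 * `|a|)) + K.
have Kr : 0 <= K / r by rewrite divr_ge0// ltW.
have B0 : 0 <= B.
  have K1 := ltW K0; have C2 := ltW C0.
  have Kra : 0 <= K / r + 2 * `|a| by rewrite addr_ge0// mulr_ge0.
  by rewrite /B addr_ge0// mulr_ge0// mulr_ge0// mulr_ge0.
apply: (decay_le0 B0 r0 s0) => t st; rewrite -(Ec _ st).
have t0 : 0 <= t by lra. have tr : 0 < t + r by lra.
have va := tube_sol_velocity tK r0 sol t0.
have [_ _ _ Ub _] := tubeP _ _ _ tr (tb _ t0) (tb _ t0).
have U0 := U_ge0 m_gt0 (g t).
have -> : E t - 2^-1 * mnorm2 m a = 2^-1 * mdot m (v t - a) ((v t - a) + 2 *: a) - U m (g t).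
  have [w wE] : exists w, v t = w + a by exists (v t - a); rewrite subrK.
  rewrite /E /mnorm2 wE addrK !mdotDl !mdotDr mdotZr (mdotC m a w).
  by lra.
apply: (le_trans (ler_normB _ _)); rewrite (ger0_norm U0) normrM ger0_norm//.
have h : `|mdot m (v t - a) ((v t - a) + 2 *: a)| <= C * (K / (t + r)) * (K / r + 2 * `|a|).
  apply: (le_trans (HC _ _)); apply: ler_pM; rewrite ?mulr_ge0 ?(ltW C0)//.
    by rewrite ler_pM2l.
  apply: (le_trans (ler_normD _ _)); rewrite normrZ ger0_norm// lerD2r.
  apply: (le_trans va); rewrite ler_pM2l// lef_pV2 ?posrE//; lra.
have -> : B / (t + r) = 2^-1 * (C * (K / (t + r)) * (K / r + 2 * `|a|)) + K / (t + r).
  by rewrite /B; ring.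
by lra.
Qed.

(** The quadratic remainder comes from the Lipschitz bound on [gradU]; the section of the tube at
    time t is convex, so the segment from [y] to [z] stays in it. *)
Lemma U_taylor (C : R) (a : 'M[R]_(N, d)) (e K t : R) y z : (forall x y : 'M[R]_(N, d), `|mdot m x y| <= C * `|x| * `|y|) -> 0 < C ->
  tube_const m a e K -> 0 < t -> `|y - t *: a| <= e * t -> `|z - t *: a| <= e * t ->
  `|U m z - U m y - mdot m (gradU m y) (z - y)| <= C * (K / t ^+ 3) * `|z - y| ^+ 2.
Proof.
move=> HC C0 [_ K0 tubeP] t0 yt zt.
pose p (l : R) : 'M[R]_(N, d) := y + l *: (z - y).
have pt (l : R) : 0 <= l <= 1 -> `|p l - t *: a| <= e * t.
  move=> /andP[l0 l1].
  have -> : p l - t *: a = (1 - l) *: (y - t *: a) + l *: (z - t *: a).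
    by apply/matrixP => i k; rewrite !mxE; ring.
  apply: (le_trans (ler_normD _ _)); rewrite !normrZ (ger0_norm l0) ger0_norm; last lra.
  have : (1 - l) * `|y - t *: a| <= (1 - l) * (e * t) by rewrite ler_wpM2l//; lra.
  have : l * `|z - t *: a| <= l * (e * t) by rewrite ler_wpM2l.
  by lra.
pose G l := U m (p l) - l * mdot m (gradU m y) (z - y).
have Gd (l : R) : 0 <= l <= 1 -> is_derive l 1 G (mdot m (gradU m (p l) - gradU m y) (z - y)).
  move=> l01; have [pO _ _ _ _] := tubeP _ _ _ t0 (pt _ l01) (pt _ l01).
  have pd i k : is_derive l 1 (fun s => p s i k) ((z - y) i k).
    rewrite (_ : (fun s => p s i k) = (fun s => y i k + s * (z - y) i k)); last first.
      by apply/funext => s; rewrite !mxE.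
    have := derD (derC l (y i k)) (derM (derX l) (derC l ((z - y) i k))).
    by rewrite mul1r mulr0 addr0 add0r.
  rewrite mdotBl; apply: derB; first exact: der_U.
  have := derM (derX l) (derC l (mdot m (gradU m y) (z - y))).
  by rewrite mul1r mulr0 addr0.
have := @deriv_bound _ G _ (C * (K / t ^+ 3) * `|z - y| ^+ 2) 0 1 ler01 Gd.
rewrite subr0 mulr1 /G /p scale0r addr0 scale1r subrKC mul0r mul1r subr0.
rewrite addrAC; apply=> l l01.
apply: (le_trans (HC _ _)).
have [_ _ h _ _] := tubeP _ _ _ t0 (pt _ l01) yt.
have pl : `|p l - y| <= `|z - y|.
  by rewrite /p addrC addKr normrZ ger0_norm ?ler_piMl//; case/andP: l01.
have Kt : 0 <= K / t ^+ 3 by rewrite divr_ge0 ?exprn_ge0// ltW.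
rewrite [leRHS](_ : _ = C * (K / t ^+ 3 * `|z - y|) * `|z - y|); last by ring.
rewrite ler_wpM2r// ler_pM2l//.
by apply: (le_trans h); rewrite ler_wpM2l.
Qed.

End Energy.

(** * The family of solutions issued from a cone, and the approximate calibration *)

Section Calibration.
Context {R : realType} {d N : nat}.
Variable m : 'I_N -> R.
Hypothesis m_gt0 : forall i, 0 < m i.
Variables (a : 'M[R]_(N, d)) (e K : R).
Hypothesis tK : tube_const m a e K.
Hypothesis a_gt0 : 0 < mnorm2 m a.
Implicit Types (x y z : 'M[R]_(N, d)).

(** Coefficient of the mass-orthogonal projection onto [a]; it serves as the time label of a
    starting point. *)
Definition axial x := mdot m x a / mnorm2 m a.

Definition cone (eps R0 : R) x := R0 <= axial x /\ `|x - axial x *: a| <= eps * axial x.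

Definition lagrangian_density (g v : R -> 'M[R]_(N, d)) s :=
  2^-1 * mnorm2 m (v s) + U m (g s) + 2^-1 * mnorm2 m a.

(** [B x s] is the action of [G x] on [0, s] at energy |a|^2 / 2. Half of the aperture [e] is held
    in reserve for [tube_sol_recenter]. *)
Definition ray_family (R0 : R) (G V : 'M[R]_(N, d) -> R -> 'M[R]_(N, d))
    (B : 'M[R]_(N, d) -> R -> R) :=
  forall x, cone (e / 4) R0 x -> [/\ G x 0 = x, newton_from m (-1) (G x) (V x),
    tube_sol m a (e / 2) (axial x) (G x) (V x), B x 0 = 0 &
    forall s : R, 0 <= s -> is_derive s 1 (B x) (lagrangian_density (G x) (V x) s)].

Lemma ray_family_exists (R0 : R) : 4 <= R0 -> K <= e / 2 * (R0 - 1) -> 2 * K <= R0 - 1 ->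
  exists G V B, ray_family R0 G V B.
Proof.
move=> R4 ReK RK; have [e0 K0 _] := tK.
have tK2 : tube_const m a (e / 2) K by apply: tube_const_smaller tK; lra.
have H x : exists GVB : (R -> 'M[R]_(N, d)) * (R -> 'M[R]_(N, d)) * (R -> R),
    cone (e / 4) R0 x -> [/\ GVB.1.1 0 = x, newton_from m (-1) GVB.1.1 GVB.1.2,
    tube_sol m a (e / 2) (axial x) GVB.1.1 GVB.1.2, GVB.2 0 = 0 &
    forall s : R, 0 <= s -> is_derive s 1 GVB.2 (lagrangian_density GVB.1.1 GVB.1.2 s)].
  have [[xR xc]|nc] := pselect (cone (e / 4) R0 x); last by exists (fun=> 0, fun=> 0, fun=> 0).
  have h1 : K <= e / 2 * (axial x - 1).
    by apply: (le_trans ReK); rewrite ler_wpM2l//; lra.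
  have [||| g [v [g0 nw sol]]] := @tube_sol_exists _ _ _ _ m_gt0 _ _ _ tK2 (axial x) x _ h1.
  - by lra.
  - by lra.
  - by apply: (le_trans xc); lra.
  have [s s1|F HF] := @primitive_from _ (lagrangian_density g v) (-(1/2)).
    have [gO gd vd] := nw s ltac:(lra).
    apply: is_derive_cont.
    exact: (derD (derD (derMl _ (der_mdot m vd vd)) (der_U m gO gd)) (derC _ _)).
  exists (g, v, fun s => F s - F 0) => _; split=> //=; first by rewrite subrr.
  move=> s s0; rewrite -[lagrangian_density _ _ _]subr0.
  by apply: (derB (HF _ _) (derC _ _)); lra.
have [GVB HGVB] := choice H.
by exists (fun x => (GVB x).1.1), (fun x => (GVB x).1.2), (fun x => (GVB x).2).
Qed.

Lemma axialB x y : axial (x - y) = axial x - axial y.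
Proof. by rewrite /axial mdotBl mulrBl. Qed.

Lemma axialD x y : axial (x + y) = axial x + axial y.
Proof. by rewrite /axial mdotDl mulrDl. Qed.

Lemma axialZ c x : axial (c *: x) = c * axial x.
Proof. by rewrite /axial mdotZl mulrA. Qed.

Lemma axiala : axial a = 1.
Proof. by rewrite /axial divff// gt_eqF. Qed.

Lemma axial_bound : exists2 C : R, 0 < C & forall x, `|axial x| <= C * `|x|.
Proof.
have [C C0 HC] := mdot_bound (d := d) m_gt0.
exists (C * (`|a| + 1) / mnorm2 m a).
  by rewrite divr_gt0// mulr_gt0// ltr_wpDl.
move=> x; rewrite /axial normrM normfV (gtr0_norm a_gt0).
rewrite [leRHS](_ : _ = (C * `|x| * (`|a| + 1)) / mnorm2 m a); last by ring.
rewrite ler_pM2r ?invr_gt0//; apply: (le_trans (HC _ _)).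
by rewrite ler_wpM2l ?mulr_ge0 ?(ltW C0)// lerDl.
Qed.

(** Motions from two nearby points carry different labels, whereas the stability estimates compare
    motions with the same one; the spare half of the aperture pays for the change. *)
Lemma tube_sol_recenter (r r' : R) g v : 1 <= r -> `|r' - r| * (e / 2 + `|a|) <= e / 2 ->
  tube_sol m a (e / 2) r' g v -> tube_sol m a e r g v.
Proof.
have [e0 _ _] := tK.
move=> r1 rr [nw tb sl]; split=> // s s0.
have -> : g s - (s + r) *: a = (g s - (s + r') *: a) + (r' - r) *: a.
  by apply/matrixP => i k; rewrite !mxE; ring.
apply: (le_trans (ler_normD _ _)); rewrite normrZ.
have h1 := tb _ s0.
have h2 : e / 2 * (s + r') <= e / 2 * (s + r) + e / 2 * `|r' - r|.
  by rewrite -mulrDr ler_wpM2l//; have := ler_norm (r' - r); lra.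
have h3 : e / 2 * 1 <= e / 2 * (s + r) by rewrite ler_wpM2l//; lra.
by lra.
Qed.

Variables (R0 : R) (G V : 'M[R]_(N, d) -> R -> 'M[R]_(N, d)) (B : 'M[R]_(N, d) -> R -> R).
Hypothesis R04 : 4 <= R0.
Hypothesis R0K : 2 * K <= R0 - 1.
Hypothesis fam : ray_family R0 G V B.

Definition calib t x := mdot m a (G x t) - B x t.

(** A first variation formula with no derivative in the initial position. With dl the difference of
    the two motions, the increment of [calib t] is <a - V x t, dl t> - D t, where D is the
    difference of the actions minus <V x, dl>. By Newton's equation the first-order terms of D'
    cancel, so D stays within C1 t |y - x|^2 of its initial value - <V x 0, y - x>. The remaining
    term is O(1/t) times O(sqrt t). *)
Lemma calib_one_step : exists rho C1 : R, [/\ 0 < rho, 0 < C1 &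
  forall x y (t : R), cone (e / 4) R0 x -> cone (e / 4) R0 y -> `|y - x| <= rho -> 0 <= t ->
  calib t y - calib t x <= mdot m (V x 0) (y - x) + C1 * t * `|y - x| ^+ 2
     + C1 / Num.sqrt (t + 1) * `|y - x|].
Proof.
have [e0 K0 _] := tK; have R4 := R04; have RK := R0K.
have [C C0 HC] := mdot_bound (d := d) m_gt0; have [CT CT0 HT] := axial_bound.
have ea : 0 < e / 2 + `|a| by rewrite ltr_wpDr//; lra.
pose C1 := C / 2 + 9 * C * K.
have CK : 0 < C * K by rewrite mulr_gt0.
(* Within this distance the labels of [x] and [y] are close enough for [tube_sol_recenter]. The two
   parts of [C1] come from the kinetic term and from the Taylor remainder of [U]. *)
exists (e / 2 / (e / 2 + `|a|) / CT), C1; split.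
- by rewrite !divr_gt0.
- by rewrite /C1; lra.
move=> x y t xc yc yx t0.
have [Gx0 _ solx Bx0 Bxd] := fam xc; have [Gy0 _ soly By0 Byd] := fam yc.
pose r := axial x.
have rR : R0 <= r by case: xc.
have solx' : tube_sol m a e r (G x) (V x).
  apply: tube_sol_recenter solx; first lra.
  by rewrite subrr normr0 mul0r; lra.
have soly' : tube_sol m a e r (G y) (V y).
  apply: tube_sol_recenter soly; first lra.
  rewrite -ler_pdivlMr// -axialB; apply: (le_trans (HT _)).
  by rewrite -ler_pdivlMl// mulrC.
have rK : 2 * K <= r by lra.
have r0 : 0 < r by lra.
pose D0 := `|y - x|.
pose dl s : 'M[R]_(N, d) := G y s - G x s.
have sq (s : R) : 0 <= s -> [/\ 0 < s + r, 1 <= Num.sqrt (s + r) & Num.sqrt (s + r) * Num.sqrt (s + r) = s + r].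
  move=> s0; split; [by lra| |by rewrite -expr2 sqr_sqrtr//; lra].
  by rewrite -[leLHS]sqrtr1 ler_wsqrtr//; lra.
have dv (s : R) : 0 <= s -> `|V y s - V x s| <= D0.
  move=> s0; apply: (le_trans (stability_velocity tK rK soly' solx' s0)).
  rewrite Gx0 Gy0 -/D0 ler_pdivrMr; last lra.
  rewrite mulrC ler_wpM2l ?normr_ge0// ler_pdivrMr//.
  by nra.
(* The 3 is 1 + 2: the coefficient of the square root is at most 2, and the 1 is absorbed since sqrt
   (s + r) >= 1. *)
have dg (s : R) : 0 <= s -> `|dl s| <= D0 * (3 * Num.sqrt (s + r)).
  move=> s0; apply: (le_trans (stability_position tK rK soly' solx' s0)).
  rewrite Gx0 Gy0 -/D0 ler_wpM2l ?normr_ge0//.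
  have [_ h1 _] := sq _ s0.
  have [_ hr _] := sq 0 (lexx 0); rewrite add0r in hr.
  have h2 : 4 * K / r / Num.sqrt r <= 2.
    rewrite ler_pdivrMr; last lra.
    rewrite ler_pdivrMr//; nra.
  have : 4 * K / r / Num.sqrt r * Num.sqrt (s + r) <= 2 * Num.sqrt (s + r) by rewrite ler_wpM2r//; lra.
  by lra.
have [[ex ex0 nwx] tbx _] := solx'; have [[ey ey0 nwy] tby _] := soly'.
pose D s := B y s - B x s - mdot m (V x s) (dl s).
have Dd (s : R) : 0 <= s -> is_derive s 1 D (2^-1 * mnorm2 m (V y s - V x s) +
    (U m (G y s) - U m (G x s) - mdot m (gradU m (G x s)) (G y s - G x s))).
  move=> s0; have [gOx gdx vdx] := nwx s ltac:(lra); have [gOy gdy vdy] := nwy s ltac:(lra).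
  have dld i k : is_derive s 1 (fun s => dl s i k) ((V y s - V x s) i k).
    by rewrite mxB_coord; under eq_fun do rewrite mxB_coord; exact: derB.
  have := derB (derB (Byd _ s0) (Bxd _ s0)) (der_mdot m vdx dld).
  congr is_derive; rewrite /lagrangian_density /mnorm2 /dl.
  by rewrite !mdotBl !mdotBr (mdotC m (V y s) (V x s)); lra.
have Db : `|D t - D 0| <= C1 * D0 ^+ 2 * t.
  rewrite -[X in _ <= _ * X]subr0.
  apply: (deriv_bound t0) => s /andP[s0 _]; first exact: Dd.
  apply: (le_trans (ler_normD _ _)).
  have [sr h1 h2] := sq _ s0.
  have k1 : `|2^-1 * mnorm2 m (V y s - V x s)| <= C / 2 * D0 ^+ 2.
    rewrite normrM ger0_norm//; have := HC (V y s - V x s) (V y s - V x s).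
    have : C * `|V y s - V x s| * `|V y s - V x s| <= C * D0 * D0.
      by apply: ler_pM => //; rewrite ?mulr_ge0 ?(ltW C0) ?dv// ler_pM2l// dv.
    by rewrite /mnorm2 expr2; lra.
  have k2 := U_taylor HC C0 tK sr (tbx _ s0) (tby _ s0).
  (* The growth of dl uses up only one of the three powers of s + r. *)
  have k3 : C * (K / (s + r) ^+ 3) * `|G y s - G x s| ^+ 2 <= 9 * C * K * D0 ^+ 2.
    apply: (@le_trans _ _ (C * (K / (s + r) ^+ 3) * (D0 * (3 * Num.sqrt (s + r))) ^+ 2)).
      have Csr : 0 <= C * (K / (s + r) ^+ 3).
        by rewrite mulr_ge0 ?divr_ge0 ?exprn_ge0// ltW.
      rewrite ler_wpM2l// lerXn2r ?nnegrE ?dg//.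
      by rewrite mulr_ge0 ?normr_ge0// mulr_ge0// sqrtr_ge0.
    have -> : C * (K / (s + r) ^+ 3) * (D0 * (3 * Num.sqrt (s + r))) ^+ 2 =
       9 * C * K * D0 ^+ 2 / (s + r) ^+ 2.
      have -> : (D0 * (3 * Num.sqrt (s + r))) ^+ 2 = 9 * D0 ^+ 2 * (s + r).
        by rewrite -[X in _ = _ * X]h2; ring.
      by field; rewrite gt_eqF.
    have nn : 0 <= 9 * C * K * D0 ^+ 2.
      by rewrite mulr_ge0 ?sqr_ge0// mulr_ge0 ?(ltW K0)// mulr_ge0// ltW.
    rewrite ler_pdivrMr ?exprn_gt0// (ler_peMr nn)//.
    by rewrite -[leLHS](expr1n _ 2) lerXn2r ?nnegrE//; lra.
  by rewrite /C1; lra.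
have D0E : D 0 = - mdot m (V x 0) (y - x).
  by rewrite /D By0 Bx0 /dl Gx0 Gy0; ring.
have -> : calib t y - calib t x = mdot m (a - V x t) (dl t) - D t.
  by rewrite /calib /D /dl !mdotBl !mdotBr; ring.
have [tr h1 h2] := sq _ t0.
have sqt : 0 < Num.sqrt (t + 1) by rewrite sqrtr_gt0; lra.
have last : mdot m (a - V x t) (dl t) <= C1 / Num.sqrt (t + 1) * D0.
  apply: (le_trans (ler_norm _)); apply: (le_trans (HC _ _)).
  have va := tube_sol_velocity tK r0 solx' t0; rewrite distrC in va.
  apply: (@le_trans _ _ (C * (K / (t + r)) * (D0 * (3 * Num.sqrt (t + r))))).
    by apply: ler_pM; rewrite ?mulr_ge0 ?(ltW C0) ?dg// ler_pM2l.
  have -> : C * (K / (t + r)) * (D0 * (3 * Num.sqrt (t + r))) = 3 * C * K / Num.sqrt (t + r) * D0.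
    rewrite -{1}h2; field; rewrite gt_eqF//; lra.
  rewrite ler_wpM2r ?normr_ge0//; apply: ler_pM.
  - by rewrite !mulr_ge0// ltW.
  - by rewrite invr_ge0 sqrtr_ge0.
  - by rewrite /C1; lra.
  - by rewrite lef_pV2 ?posrE// ?ler_wsqrtr//; lra.
move: Db; rewrite D0E ler_norml -/D0 => /andP[Db _].
by lra.
Qed.

End Calibration.

(** * Additive statements, from short intervals to long ones *)

Section LocalToGlobal.
Context {R : realType}.

(** The supremum of the times reached from [a] is reached, and passed unless it is [b]. This takes
    the place of a sum over a fine subdivision. *)
Lemma local_to_global (P : R -> R -> Prop) (a b : R) : a <= b ->
  (forall p q r, a <= p -> p <= q -> q <= r -> r <= b -> P p q -> P q r -> P p r) ->
  (forall t, a <= t <= b -> exists2 eta, 0 < eta & forall p q, a <= p -> p <= q -> q <= b ->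
     t - eta < p -> q < t + eta -> P p q) -> P a b.
Proof.
move=> ab add loc.
pose S := [set t | a <= t <= b /\ P a t].
have Sa : S a.
  have [eta eta0 H] := loc a ltac:(by rewrite lexx).
  by split; [rewrite lexx|apply: H; lra].
have Sub : has_sup S by split; [exists a|exists b => t [/andP[]]].
pose c := sup S.
have ac : a <= c by apply: ub_le_sup => //; case: Sub.
have cb : c <= b by apply: ge_sup; [exists a|move=> t [/andP[]]].
have [eta eta0 H] := loc c ltac:(by rewrite ac).
have [t [/andP[ta tb] Pat] ct] := sup_adherent eta0 Sub; rewrite -/c in ct.
have tc : t <= c by apply: ub_le_sup; [case: Sub|split=> //; rewrite ta].
pose q := Num.min b (c + eta / 2).
have qb : q <= b by rewrite ge_min lexx.
have qc : q <= c + eta / 2 by rewrite ge_min lexx orbT.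
have cq : c <= q by rewrite le_min cb; lra.
have Paq : P a q.
  apply: (add _ t) => //; first lra.
  by apply: H => //; lra.
have Sq : S q by split=> //; apply/andP; split; lra.
have : q <= c by apply: ub_le_sup => //; case: Sub.
move: Paq; rewrite /q; case: (leP b (c + eta / 2)) => // h _.
by lra.
Qed.

End LocalToGlobal.

(** * Integrals over segments *)

Section Integrals.
Context {R : realType}.
Notation mu := (@lebesgue_measure R).
Implicit Types (f g : R -> R) (p q r : R).

(** The integral of a nonnegative function is a supremum over the simple functions below it, hence
    monotone without measurability. This covers [Uext] along a competitor that may meet
    collisions. *)
Lemma ge0_le_integral_any (D : set R) (f1 f2 : R -> \bar R) :
  (forall x, D x -> 0 <= f1 x)%E -> (forall x, D x -> 0 <= f2 x)%E ->
  (forall x, D x -> f1 x <= f2 x)%E ->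
  (\int[mu]_(x in D) f1 x <= \int[mu]_(x in D) f2 x)%E.
Proof.
move=> f10 f20 f12; rewrite !ge0_integralE//.
apply: le_ereal_sup => _ [h/= hf <-]; exists h => // x.
apply: (le_trans (hf x)); rewrite /patch; case: ifPn => // xD; apply: f12.
by rewrite inE in xD.
Qed.

Lemma integral_split f p q r : p <= q -> q <= r ->
  measurable_fun `[p, r] f -> (forall x, `[p, r]%classic x -> 0 <= f x) ->
  (\int[mu]_(x in `[p, r]) (f x)%:E =
   \int[mu]_(x in `[p, q]) (f x)%:E + \int[mu]_(x in `[q, r]) (f x)%:E)%E.
Proof.
move=> pq qr /measurable_EFinP mf f0.
have E : `[p, r]%classic = `[p, q]%classic `|` `]q, r]%classic :> set R.
  by apply: itv_bndbnd_setU; rewrite bnd_simp.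
rewrite E ge0_integral_setU//; rewrite -?E//.
- congr (_ + _)%E; apply: integral_itv_obnd_cbnd.
  by apply: measurable_funS mf => //; apply: subset_itvr; rewrite bnd_simp.
- apply/disj_set2P; rewrite -subset0 => z/=; rewrite !in_itv/= => -[/andP[_]].
  by rewrite leNgt => /negbTE ->.
Qed.

Definition has_integral p q f (X : R) :=
  mu.-integrable `[p, q] (EFin \o f) /\ Rintegral mu `[p, q] f = X.

Lemma has_integralD p q f g X Y : has_integral p q f X -> has_integral p q g Y ->
  has_integral p q (fun t => f t + g t) (X + Y).
Proof.
move=> [fi fX] [gi gY]; split; last by rewrite RintegralD// fX gY.
exact: (@integrableD _ _ _ mu `[p, q] _ (EFin \o f) (EFin \o g)).
Qed.

Lemma has_integralZ p q f X c : has_integral p q f X ->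
  has_integral p q (fun t => c * f t) (c * X).
Proof.
move=> [fi fX]; split; last by rewrite RintegralZl// fX.
exact: (@integrableZl _ _ _ mu `[p, q] _ c (EFin \o f)).
Qed.

Lemma has_integral0 p q : has_integral p q (fun=> 0) 0.
Proof.
split; first exact: integrable0.
by apply: (@eq_trans _ _ (fine 0%E)) => //; congr fine; apply: integral0_eq.
Qed.

Lemma has_integral_sum (I : Type) (s : seq I) (P : pred I) (F : I -> R -> R) (X : I -> R) p q :
  (forall i, P i -> has_integral p q (F i) (X i)) ->
  has_integral p q (fun t => \sum_(i <- s | P i) F i t) (\sum_(i <- s | P i) X i).
Proof.
move=> H; elim: s => [|i s IH].
  rewrite big_nil; under eq_fun do rewrite big_nil; exact: has_integral0.
rewrite big_cons; under eq_fun do rewrite big_cons.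
by case: ifP => // Pi; apply: has_integralD => //; exact: H.
Qed.

Lemma has_integral_le p q f g X : has_integral p q f X ->
  (forall t, `[p, q]%classic t -> 0 <= g t) -> (forall t, `[p, q]%classic t -> f t <= g t) ->
  measurable_fun `[p, q] g ->
  (X%:E <= \int[mu]_(t in `[p, q]) (g t)%:E)%E.
Proof.
move=> [fi <-] g0 fg mg.
have [->|gfin] := eqVneq (\int[mu]_(t in `[p, q]) (g t)%:E)%E +oo%E; first by rewrite leey.
have g0' : (0 <= \int[mu]_(t in `[p, q]) (g t)%:E)%E.
  by apply: integral_ge0 => t /g0; rewrite lee_fin.
have gi : mu.-integrable `[p, q] (EFin \o g).
  apply/integrableP; split; first exact/measurable_EFinP.
  apply: (@le_lt_trans _ _ (\int[mu]_(t in `[p, q]) (g t)%:E)%E); last by rewrite ltey.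
  apply: ge0_le_integral_any => t /g0 gt0 /=; rewrite ?lee_fin//.
  by rewrite ger0_norm.
rewrite /Rintegral fineK; last exact: integrable_fin_num.
by apply: le_integral => // t /[!inE] /fg; rewrite lee_fin.
Qed.

Lemma has_integral_norm p q f X : has_integral p q f X ->
  exists2 Y, has_integral p q (fun t => `|f t|) Y & `|X| <= Y.
Proof.
move=> [fi <-]; exists (Rintegral mu `[p, q] (fun t => `|f t|)).
  split=> //; exact: (integrable_norm fi).
exact: le_normr_Rintegral.
Qed.

Lemma within_continuous_dist (A : set R) f :
  (forall t, A t -> forall th : R, 0 < th ->
     exists2 eta, 0 < eta & forall s, A s -> `|s - t| < eta -> `|f s - f t| <= th) ->
  {within A, continuous f}.
Proof.
move=> H; apply/subspace_continuousP => t At; apply/cvgrPdist_le => th th0.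
have [eta eta0 K] := H _ At _ th0.
rewrite near_withinE; near=> s => As; rewrite distrC; apply: K As _.
by rewrite distrC; near: s; exact: cvgr_dist_lt.
Unshelve. all: by end_near. Qed.

End Integrals.

(** * Absolutely continuous curves: displacement, continuity, free action *)

Section Curves.
Context {R : realType} {d N : nat}.
Variable m : 'I_N -> R.
Hypothesis m_gt0 : forall i, 0 < m i.
Notation mu := (@lebesgue_measure R).
Variables (sig v : R -> 'M[R]_(N, d)) (al be : R).
Hypothesis sig_ac : abs_cont_with sig v al be.

Lemma abs_cont_has_integral i k p q : al <= p -> p <= q -> q <= be ->
  has_integral p q (fun t => v t i k) (sig q i k - sig p i k).
Proof.
move=> alp pq qbe; have [vi H] := sig_ac i k; split.
  by apply: integrableS vi => //; apply: subset_itv; rewrite bnd_simp.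
rewrite (H q) ?(H p); try by apply/andP; split; lra.
have viq : mu.-integrable `[al, q] (EFin \o (fun t => v t i k)).
  by apply: integrableS vi => //; apply: subset_itv; rewrite bnd_simp.
have := @Rintegral_itvB _ (fun t => v t i k) (BLeft al) (BRight q) p viq.
rewrite !bnd_simp => /(_ alp pq); rewrite Rintegral_itv_obnd_cbnd; last first.
  by apply: integrableS viq => //; apply: subset_itvr; rewrite bnd_simp.
by move=> <-; ring.
Qed.

Lemma abs_cont_modulus t (th : R) : al <= t <= be -> 0 < th ->
  exists2 eta, 0 < eta & forall s, al <= s <= be -> `|s - t| < eta -> `|sig s - sig t| <= th.
Proof.
move=> tab th0; have ab : al <= be by case/andP: tab; lra.
have H (ik : 'I_N * 'I_d) : \forall s \near t, al <= s <= be -> `|sig t ik.1 ik.2 - sig s ik.1 ik.2| <= th.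
  have [vi Hv] := sig_ac ik.1 ik.2.
  have /subspace_continuousP/(_ t) := parameterized_integral_continuous ab vi.
  rewrite /= in_itv/= => /(_ tab)/cvgrPdist_le/(_ _ th0); rewrite near_withinE.
  apply: filterS => s /= Hs sab; rewrite in_itv/= in Hs.
  rewrite (Hv t)// (Hv s)//.
  have E (x y z : R) : x + y - (x + z) = y - z by ring.
  by rewrite E; exact: (Hs sab).
have /nbhs_ballP[eta /= eta0 He] := filter_forall (nbhs_filter t) H.
exists eta => // s sab st.
apply: mxnorm_le => [|i k]; first exact: ltW.
rewrite mxB_coord distrC; apply: (He s _ (i, k)) => //.
by rewrite /ball/= distrC.
Qed.

Lemma has_integral_mdot w p q : al <= p -> p <= q -> q <= be ->
  has_integral p q (fun t => mdot m w (v t)) (mdot m w (sig q - sig p)).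
Proof.
move=> alp pq qbe; rewrite /mdot.
apply: has_integral_sum => i _; apply: has_integralZ.
apply: has_integral_sum => k _; apply: has_integralZ; rewrite mxB_coord.
exact: abs_cont_has_integral.
Qed.

(** The l^1 norm of the velocity: it is integrable because each coordinate is, and its integral
    dominates the sup norm of the displacement. *)
Definition speed1 t := \sum_i \sum_k `|v t i k|.

Lemma has_integral_speed1 p q : al <= p -> p <= q -> q <= be ->
  exists2 Y, has_integral p q speed1 Y & `|sig q - sig p| <= Y.
Proof.
move=> alp pq qbe.
have H (ik : 'I_N * 'I_d) : exists Y, has_integral p q (fun t => `|v t ik.1 ik.2|) Y /\
    `|sig q ik.1 ik.2 - sig p ik.1 ik.2| <= Y.
  have [Y h1 h2] := has_integral_norm (abs_cont_has_integral ik.1 ik.2 alp pq qbe).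
  by exists Y.
have [Y HY] := choice H.
have Y0 ik : 0 <= Y ik by have [_] := HY ik; apply: le_trans.
exists (\sum_i \sum_k Y (i, k)).
  by apply: has_integral_sum => i _; apply: has_integral_sum => k _; have [] := HY (i, k).
apply: mxnorm_le => [|i k]; first by apply: sumr_ge0 => i _; apply: sumr_ge0 => k _.
rewrite mxB_coord; have [_ h] := HY (i, k); apply: (le_trans h).
rewrite (bigD1 i)//= (bigD1 k)//= -addrA lerDl addr_ge0//; apply: sumr_ge0 => j _ //.
by apply: sumr_ge0 => l _.
Qed.

Lemma speed1_ge0 t : 0 <= speed1 t.
Proof. by apply: sumr_ge0 => i _; apply: sumr_ge0 => k _. Qed.

Lemma measurable_v i k : measurable_fun `[al, be] (fun t => v t i k).
Proof. by have [/integrableP[/measurable_EFinP]] := sig_ac i k. Qed.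

Lemma measurable_mnorm2_v : measurable_fun `[al, be] (fun t => mnorm2 m (v t)).
Proof.
apply: measurable_sum => i; apply: measurable_funM; first exact: measurable_cst.
by apply: measurable_sum => k; apply: measurable_funM; exact: measurable_v.
Qed.

Lemma measurable_speed1 : measurable_fun `[al, be] speed1.
Proof.
apply: measurable_sum => i; apply: measurable_sum => k.
by apply: measurableT_comp => //; exact: measurable_v.
Qed.

(** [mdot_le_halves] under the integral sign. For [b] of length |a| along the displacement it says
    that going from x to z costs at least |a||z - x|, even when [U] is dropped. *)
Lemma free_action_lower (h : R) b p q : al <= p -> p <= q -> q <= be ->
  2^-1 * mnorm2 m b <= h ->
  ((mdot m b (sig q - sig p))%:E <= \int[mu]_(t in `[p, q]) (2^-1 * mnorm2 m (v t) + h)%:E)%E.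
Proof.
move=> alp pq qbe bh; apply: (has_integral_le (has_integral_mdot b alp pq qbe)).
- move=> t _; have := mnorm2_ge0 m_gt0 (v t); have := mnorm2_ge0 m_gt0 b.
  by lra.
- by move=> t _; have := mdot_le_halves m_gt0 b (v t); lra.
- apply: (measurable_funS (E := `[al, be])) => //.
    by apply: subset_itv; rewrite bnd_simp.
  apply: measurable_funD; last exact: measurable_cst.
  apply: measurable_funM; first exact: measurable_cst.
  exact: measurable_mnorm2_v.
Qed.

Lemma sig_omega_U_within (p q : R) : al <= p -> q <= be ->
  (forall t, p <= t <= q -> inOmega (sig t)) ->
  {within `[p, q], continuous (fun t => U m (sig t))}.
Proof.
move=> alp qbe sO; apply: within_continuous_dist => t /=; rewrite in_itv/= => tpq th th0.
have /cvgrPdist_le/(_ _ th0)/nbhs_ballP[rho /= rho0 Hrho] := U_continuous m_gt0 (sO _ tpq).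
have tab : al <= t <= be by case/andP: tpq => ? ?; apply/andP; split; lra.
have [eta eta0 H] := abs_cont_modulus tab (divr_gt0 rho0 (ltr0Sn R 1)).
exists eta => // s; rewrite in_itv/= => spq st.
rewrite distrC; apply: Hrho; rewrite -ball_normE/= distrC.
apply: le_lt_trans (H s _ st) _; last lra.
by case/andP: spq => ? ?; apply/andP; split; lra.
Qed.

End Curves.

(** * The calibration inequality along segments and curves inside the cone *)

Section CalibratedCurves.
Context {R : realType} {d N : nat}.
Variable m : 'I_N -> R.
Hypothesis m_gt0 : forall i, 0 < m i.
Notation mu := (@lebesgue_measure R).
Variables (a : 'M[R]_(N, d)) (e K : R).
Hypothesis tK : tube_const m a e K.
Hypothesis a_gt0 : 0 < mnorm2 m a.
Variables (R0 : R) (G V : 'M[R]_(N, d) -> R -> 'M[R]_(N, d)) (B : 'M[R]_(N, d) -> R -> R).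
Hypothesis R04 : 4 <= R0.
Hypothesis R0K : 2 * K <= R0 - 1.
Hypothesis fam : ray_family m a e R0 G V B.
Notation cone := (cone m a (e / 4) R0).
Notation calib := (calib m a G B).
Notation axial := (axial m a).
Variables rho C1 : R.
Hypothesis rho_gt0 : 0 < rho.
Hypothesis C1_gt0 : 0 < C1.
Hypothesis one_step : forall x y t, cone x -> cone y -> `|y - x| <= rho -> 0 <= t ->
  calib t y - calib t x <= mdot m (V x 0) (y - x) + C1 * t * `|y - x| ^+ 2
     + C1 / Num.sqrt (t + 1) * `|y - x|.

Lemma cone_tube_sol x : cone x -> tube_sol m a e (axial x) (G x) (V x).
Proof.
move=> xc; have [_ _ sol _ _] := fam xc; have [e0 _ _] := tK; have R4 := R04.
apply: (tube_sol_recenter tK _ _ sol); first by case: xc; lra.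
by rewrite subrr normr0 mul0r; lra.
Qed.

(** A Hamilton-Jacobi equation for [V x 0], the approximate gradient of [calib t]: it turns
    [mdot_le_halves] into a lower bound for the Lagrangian. *)
Lemma cone_energy x : cone x -> 2^-1 * mnorm2 m (V x 0) = 2^-1 * mnorm2 m a + U m x.
Proof.
move=> xc; have R4 := R04; have [Gx0 _ _ _ _] := fam xc.
have := tube_sol_energy m_gt0 tK (_ : 0 < axial x) (cone_tube_sol xc) (lexx 0).
by rewrite Gx0 => <-; [lra|case: xc; lra].
Qed.

Lemma cone_inOmega x : cone x -> inOmega x.
Proof.
move=> xc; have [Gx0 nw _ _ _] := fam xc; have [+ _ _] := nw 0 ltac:(lra).
by rewrite Gx0.
Qed.

(** The order of the choices matters: t is already large, which controls the linear error, and [th]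
    is then small depending on t, which controls the quadratic one. *)
Lemma one_step_small (kap t : R) : 0 < kap -> 0 <= t -> C1 / Num.sqrt (t + 1) <= kap / 2 ->
  exists2 th, 0 < th & forall x y, cone x -> cone y -> `|y - x| <= th ->
    calib t y - calib t x <= mdot m (V x 0) (y - x) + kap * `|y - x|.
Proof.
move=> kap0 t0 tk; have C0 := C1_gt0; have r0 := rho_gt0.
have Ct : 0 < 2 * (C1 * (t + 1)) by rewrite !mulr_gt0//; lra.
exists (Num.min rho (kap / (2 * (C1 * (t + 1))))); first by rewrite lt_min rho_gt0 divr_gt0.
move=> x y xc yc; rewrite le_min => /andP[yx1 yx2].
apply: (le_trans (one_step xc yc yx1 t0)); rewrite -addrA lerD2l.
have h1 : C1 / Num.sqrt (t + 1) * `|y - x| <= kap / 2 * `|y - x| by rewrite ler_wpM2r.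
have h2 : C1 * t * `|y - x| ^+ 2 <= kap / 2 * `|y - x|.
  rewrite expr2 mulrA ler_wpM2r//.
  move: yx2; rewrite ler_pdivlMr// => yx2.
  have : 0 <= `|y - x| * C1 by rewrite mulr_ge0// ltW.
  by nra.
by lra.
Qed.

(** The cone is convex, and on it the initial velocities are within K / R0 of [a]. This serves for
    the part of a curve before its last exit, where only the two end points are known to be in the
    cone. *)
Lemma calib_segment (C : R) : (forall x y : 'M[R]_(N, d), `|mdot m x y| <= C * `|x| * `|y|) -> 0 < C ->
  forall (kap t : R) x z, 0 < kap -> 0 <= t ->
  C1 / Num.sqrt (t + 1) <= kap / 2 -> cone x -> cone z ->
  calib t z - calib t x <= mdot m a (z - x) + (C * K / R0 + kap) * `|z - x|.
Proof.
move=> HC C0; have [e0 K0 _] := tK; have R4 := R04.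
move=> kap t x z kap0 t0 tk xc zc.
have [th th0 Hth] := one_step_small kap0 t0 tk.
pose p (l : R) : 'M[R]_(N, d) := x + l *: (z - x).
have pc l : 0 <= l <= 1 -> cone (p l).
  move=> /andP[l0 l1]; have [x1 x2] := xc; have [z1 z2] := zc.
  have pE : p l = (1 - l) *: x + l *: z by apply/matrixP => i k; rewrite !mxE; ring.
  have aE : axial (p l) = (1 - l) * axial x + l * axial z by rewrite pE axialD !axialZ.
  have l1' : 0 <= 1 - l by lra.
  split.
    rewrite aE.
    have : (1 - l) * R0 <= (1 - l) * axial x by rewrite ler_wpM2l.
    have : l * R0 <= l * axial z by rewrite ler_wpM2l.
    by lra.
  have -> : p l - axial (p l) *: a = (1 - l) *: (x - axial x *: a) + l *: (z - axial z *: a).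
    by rewrite aE pE; apply/matrixP => i k; rewrite !mxE; ring.
  apply: (le_trans (ler_normD _ _)); rewrite !normrZ (ger0_norm l0) (ger0_norm l1') aE.
  have := ler_wpM2l l1' x2; have := ler_wpM2l l0 z2.
  by lra.
pose Q (l l' : R) := calib t (p l') - calib t (p l) <=
   (l' - l) * (mdot m a (z - x) + (C * K / R0 + kap) * `|z - x|).
suff : Q 0 1 by rewrite /Q /p scale0r addr0 scale1r subrKC subr0 mul1r.
apply: (@local_to_global _ Q) => [//|u w y _ _ _ _|l l01]; first by rewrite /Q; lra.
exists (th / (`|z - x| + 1) / 2); first by rewrite !divr_gt0// ltr_wpDl.
move=> u w u0 uw w1 h1 h2; rewrite /Q.
have pu : cone (p u) by apply: pc; apply/andP; split; lra.
have pw : cone (p w) by apply: pc; apply/andP; split; lra.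
have pE : p w - p u = (w - u) *: (z - x).
  by rewrite /p opprD addrACA subrr add0r scalerBl.
have uw0 : 0 <= w - u by lra.
have wu : w - u <= th / (`|z - x| + 1) by lra.
have pn : `|p w - p u| <= th.
  rewrite pE normrZ (ger0_norm uw0).
  move: wu; rewrite ler_pdivlMr ?ltr_wpDl// => wu; nra.
apply: (le_trans (Hth _ _ pu pw pn)); rewrite pE mdotZr normrZ (ger0_norm uw0).
have rE : 0 < axial (p u) by case: pu; lra.
have vel := tube_sol_velocity tK rE (cone_tube_sol pu) (lexx 0).
have h3 : mdot m (V (p u) 0) (z - x) <= mdot m a (z - x) + C * K / R0 * `|z - x|.
  rewrite -lerBlDl -mdotBl; apply: (le_trans (ler_norm _)); apply: (le_trans (HC _ _)).
  rewrite ler_wpM2r// -mulrA ler_pM2l//; apply: (le_trans vel).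
  rewrite add0r ler_pM2l// lef_pV2 ?posrE//; last lra.
  by case: pu.
have := ler_wpM2l uw0 h3.
by lra.
Qed.

(** On a short interval from p, the constant vector [V (sig p) 0] is paired with the velocity. In
    the extra term, kap times 1 pays for the oscillation of [U], and kap times [speed1] for the
    error of the one-step inequality. *)
Lemma calib_curve (sig v : R -> 'M[R]_(N, d)) (al be tau kap t : R) :
  abs_cont_with sig v al be -> al <= tau -> tau <= be ->
  (forall s, tau <= s <= be -> cone (sig s)) ->
  0 < kap -> 0 <= t -> C1 / Num.sqrt (t + 1) <= kap / 2 ->
  ((calib t (sig be) - calib t (sig tau))%:E <= \int[mu]_(s in `[tau, be])
     (2^-1 * mnorm2 m (v s) + 2^-1 * mnorm2 m a + U m (sig s) + kap * (1 + speed1 v s))%:E)%E.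
Proof.
move=> ac altau taube sc kap0 t0 tk; have a0 := a_gt0.
have [th th0 Hth] := one_step_small kap0 t0 tk.
pose f s := 2^-1 * mnorm2 m (v s) + 2^-1 * mnorm2 m a + U m (sig s) + kap * (1 + speed1 v s).
have f0 s : 0 <= f s.
  rewrite /f addr_ge0//; last by rewrite mulr_ge0 ?addr_ge0 ?speed1_ge0// ltW.
  by rewrite !addr_ge0 ?mulr_ge0 ?U_ge0 ?mnorm2_ge0.
have sO s : tau <= s <= be -> inOmega (sig s) by move=> /sc /cone_inOmega.
have Uc := sig_omega_U_within m_gt0 ac altau (lexx be) sO.
have sub : (`[tau, be] : set (measurableTypeR R)) `<=` `[al, be].
  by apply: subset_itv; rewrite bnd_simp.
have mf : measurable_fun `[tau, be] f.
  apply: measurable_funD; last first.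
    apply: measurable_funM; first exact: measurable_cst.
    apply: measurable_funD; first exact: measurable_cst.
    by apply: measurable_funS sub (measurable_speed1 ac).
  apply: measurable_funD; last exact: subspace_continuous_measurable_fun.
  apply: measurable_funD; last exact: measurable_cst.
  apply: measurable_funM; first exact: measurable_cst.
  by apply: measurable_funS sub (measurable_mnorm2_v m ac).
pose Q (p q : R) := ((calib t (sig q) - calib t (sig p))%:E <= \int[mu]_(s in `[p, q]) (f s)%:E)%E.
suff : Q tau be by [].
apply: (@local_to_global _ Q) => // [p q r taup pq qr rbe Q1 Q2|u utb].
  rewrite /Q (@integral_split _ f p q r)//; last first.
    apply: measurable_funS mf => //.
    by apply: subset_itv; rewrite bnd_simp.
  have -> : calib t (sig r) - calib t (sig p) =
     (calib t (sig q) - calib t (sig p)) + (calib t (sig r) - calib t (sig q)) by ring.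
  by rewrite EFinD leeD.
have uab : al <= u <= be by case/andP: utb => ? ?; apply/andP; split; lra.
have [eta1 eta10 H1] := abs_cont_modulus ac uab (divr_gt0 th0 (ltr0Sn R 1)).
have /subspace_continuousP/(_ u) := Uc; rewrite /= in_itv/= => /(_ utb).
move=> /cvgrPdist_le/(_ _ (divr_gt0 kap0 (ltr0Sn R 1))); rewrite near_withinE => /nbhs_ballP[eta2 /= eta20 H2].
exists (Num.min eta1 eta2); first by rewrite lt_min eta10.
move=> p q taup pq qbe up uq.
have near_u s : p <= s <= q -> [/\ `|sig s - sig u| <= th / 2, `|U m (sig u) - U m (sig s)| <= kap / 2 & cone (sig s)].
  move=> /andP[ps sq].
  have su : `|s - u| < Num.min eta1 eta2 by rewrite ltr_norml; apply/andP; split; lra.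
  rewrite lt_min in su; case/andP: su => su1 su2; split.
  - by apply: H1 => //; apply/andP; split; lra.
  - apply: H2; rewrite ?in_itv/=; last by apply/andP; split; lra.
    by rewrite /ball/= distrC.
  - by apply: sc; apply/andP; split; lra.
have [p1 p2 pc] := near_u p ltac:(by rewrite lexx).
have [q1 q2 qc] := near_u q ltac:(by rewrite lexx andbT).
have pqd : `|sig q - sig p| <= th.
  have -> : sig q - sig p = (sig q - sig u) - (sig p - sig u) by rewrite opprB addrA subrK.
  by apply: (le_trans (ler_normB _ _)); lra.
have alp : al <= p by lra.
have [Y hY YY] := has_integral_speed1 ac alp pq qbe.
have hI := has_integralD (has_integral_mdot m ac (V (sig p) 0) alp pq qbe) (has_integralZ kap hY).
have step := Hth _ _ pc qc pqd.
rewrite /Q; apply: (@le_trans _ _ (mdot m (V (sig p) 0) (sig q - sig p) + kap * Y)%:E).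
  rewrite lee_fin; apply: (le_trans step); rewrite lerD2l ler_wpM2l//; exact: ltW.
apply: (has_integral_le hI) => [s _|s|].
- exact: f0.
- rewrite /= in_itv/= => spq; have [_ s2 _] := near_u _ spq.
  have := mdot_le_halves m_gt0 (V (sig p) 0) (v s); rewrite (cone_energy pc) /f.
  move: p2 s2; rewrite !ler_norml => /andP[p2 _] /andP[_ s2].
  by lra.
- apply: measurable_funS mf => //.
  by apply: subset_itv; rewrite bnd_simp.
Qed.

End CalibratedCurves.

(** * Geometry of the cones *)

Section ConeGeometry.
Context {R : realType} {d N : nat}.
Variable m : 'I_N -> R.
Hypothesis m_gt0 : forall i, 0 < m i.
Variables (a : 'M[R]_(N, d)) (e : R).
Hypothesis e_gt0 : 0 < e.
Hypothesis a_gt0 : 0 < mnorm2 m a.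
Notation axial := (axial m a).
Notation cone := (cone m a).

(* [b] is the vector of length [|a|] pointing from [x] to [z]: leaving the cone costs more
   than the calibration because [z - x] makes a definite angle with [a]. *)
Lemma cone_exit_excess : exists2 kap0 : R, 0 < kap0 & forall R0 x z, 0 < R0 ->
  cone (e / 8) R0 x -> cone (e / 4) R0 z ->
  axial z <= R0 \/ e / 4 * axial z <= `|z - axial z *: a| ->
  exists2 b, mnorm2 m b = mnorm2 m a & kap0 * `|z - x| <= mdot m (b - a) (z - x).
Proof.
have [c c0 Hc] := mnorm2_lower (d := d) m_gt0.
have e0 := e_gt0; have a0 := a_gt0.
pose A := Num.sqrt (mnorm2 m a).
have A0 : 0 < A by rewrite sqrtr_gt0.
have AA : A ^+ 2 = mnorm2 m a by rewrite sqr_sqrtr// ltW.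
(* The transversal part of z - x has squared mass norm at least q times the square of its axial
   coordinate, when the latter is positive. So the cosine of its angle with [a] is at most [th] =
   |a| / sqrt (|a|^2 + q). *)
pose q := c * (e / 8) ^+ 2.
have q0 : 0 < q by rewrite mulr_gt0// exprn_gt0//; lra.
pose Aq := Num.sqrt (mnorm2 m a + q).
have Aq0 : 0 < Aq by rewrite sqrtr_gt0; lra.
have AqE : Aq ^+ 2 = mnorm2 m a + q by rewrite sqr_sqrtr//; lra.
have AAq : A < Aq by rewrite ltr_sqrt; lra.
pose th := A / Aq.
have th0 : 0 <= th by rewrite divr_ge0// ltW.
have th1 : th < 1 by rewrite ltr_pdivrMr// mul1r.
have sc0 : 0 < Num.sqrt c by rewrite sqrtr_gt0.
exists (A * (1 - th) * Num.sqrt c); first by rewrite !mulr_gt0//; lra.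
move=> R0 x z R00 [x1 x2] [z1 z2] zb.
have [D0|D0] := eqVneq (z - x) 0.
  by exists a => //; rewrite D0 normr0 mulr0 subrr -(scale0r (0 : 'M[R]_(N, d))) mdotZl mul0r.
pose D := z - x.
have D2 : 0 < mnorm2 m D.
  by apply: lt_le_trans (Hc D); rewrite mulr_gt0// exprn_gt0// normr_gt0.
pose n := Num.sqrt (mnorm2 m D).
have n0 : 0 < n by rewrite sqrtr_gt0.
have nn : n ^+ 2 = mnorm2 m D by rewrite sqr_sqrtr// ltW.
have scn : Num.sqrt c * `|D| <= n.
  rewrite -ler_sqr ?nnegrE ?mulr_ge0 ?sqrtr_ge0// exprMn sqr_sqrtr ?(ltW c0)// nn.
  exact: Hc.
exists ((A / n) *: D).
  by rewrite /mnorm2 mdotZl mdotZr -/(mnorm2 m D) -nn -/(mnorm2 m a) -AA; field; rewrite gt_eqF.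
pose al := axial D.
have aD : mdot m a D = al * A ^+ 2.
  by rewrite AA /al /axial mdotC divfK// gt_eqF.
rewrite -/D mdotBl mdotZl aD.
have -> : A / n * mdot m D D = A * n.
  by rewrite -/(mnorm2 m D) -nn; field; rewrite gt_eqF.
suff h : al * A <= th * n.
  apply: (@le_trans _ _ (A * (1 - th) * n)).
    by rewrite -[leLHS]mulrA ler_wpM2l// mulr_ge0//; [exact: ltW|lra].
  have := ler_wpM2l (ltW A0) h.
  by rewrite expr2; lra.
have [al0|al0] := leP al 0.
  apply: (@le_trans _ _ 0); last by rewrite mulr_ge0// ltW.
  by rewrite mulr_le0_ge0// ltW.
have axz : axial z = axial x + al by rewrite /al axialB addrC subrK.
(* An exit through the base, [axial z <= R0], is incompatible with a positive [al]. *)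
case: zb => [zb|zb]; first lra.
pose P := D - al *: a.
(* [x] has transversal part at most e / 8 of its axial coordinate and [z] at least e / 4 of a larger
   one. *)
have P1 : e / 8 * al <= `|P|.
  have PE : P = (z - axial z *: a) - (x - axial x *: a).
    by rewrite axz /P /D; apply/matrixP => i k; rewrite !mxE; ring.
  have := ler_normD P (x - axial x *: a); rewrite PE subrK => h.
  have : e / 8 * axial x <= e / 8 * axial z by rewrite ler_wpM2l//; lra.
  have : e / 8 * al <= e / 8 * axial z by rewrite ler_wpM2l//; lra.
  by lra.
have aP : mdot m a P = 0.
  by rewrite /P mdotBr mdotZr aD -/(mnorm2 m a) -AA subrr.
have nE : n ^+ 2 = al ^+ 2 * mnorm2 m a + mnorm2 m P.
  have gen (P' : 'M[R]_(N, d)) l : mdot m a P' = 0 ->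
      mnorm2 m (P' + l *: a) = l ^+ 2 * mnorm2 m a + mnorm2 m P'.
    move=> aP'; rewrite /mnorm2 mdotDl !mdotDr !mdotZl !mdotZr (mdotC m P' a) aP'.
    by ring.
  by rewrite nn -gen// subrK.
have h2 : (al * Aq) ^+ 2 <= n ^+ 2.
  rewrite exprMn AqE nE mulrDr lerD2l; apply: le_trans (Hc P).
  rewrite mulrC /q -mulrA ler_pM2l// -exprMn lerXn2r ?nnegrE//.
  by rewrite mulr_ge0 ?(ltW al0)//; lra.
have h3 : al * Aq <= n.
  by rewrite -ler_sqr ?nnegrE// ?(ltW n0)// mulr_ge0// ltW.
have -> : al * A = th * (al * Aq) by rewrite /th; field; rewrite gt_eqF.
by rewrite ler_wpM2l.
Qed.

Lemma cone_continuous_interior eps R0 z : R0 < axial z -> `|z - axial z *: a| < eps * axial z ->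
  0 < eps ->
  exists2 rho, 0 < rho & forall y, `|y - z| <= rho -> cone eps R0 y.
Proof.
move=> z1 z2 eps0; have [C C0 HC] := axial_bound m_gt0 a_gt0.
pose g := Num.min (axial z - R0) (eps * axial z - `|z - axial z *: a|).
have g0 : 0 < g by rewrite lt_min !subr_gt0 z1.
have g1 : g <= axial z - R0 by rewrite ge_min lexx.
have g2 : g <= eps * axial z - `|z - axial z *: a| by rewrite ge_min lexx orbT.
pose M := C + 1 + C * `|a| + eps * C.
have Ca : 0 <= C * `|a| by rewrite mulr_ge0// ltW.
have eC : 0 <= eps * C by rewrite mulr_ge0// ltW.
have M0 : 0 < M by rewrite /M; lra.
exists (g / M); first by rewrite divr_gt0.
move=> y; rewrite ler_pdivlMr// => yz.
have ay : `|axial y - axial z| <= C * `|y - z| by rewrite -axialB.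
have yz0 : 0 <= `|y - z| by [].
have yzM : `|y - z| * C <= g /\ `|y - z| * (1 + C * `|a| + eps * C) <= g.
  by rewrite /M in yz; split; nra.
move: (ay); rewrite ler_norml => /andP[ay1 ay2].
split; first by lra.
have -> : y - axial y *: a = (z - axial z *: a) + ((y - z) - (axial y - axial z) *: a).
  by apply/matrixP => i k; rewrite !mxE; ring.
apply: (le_trans (ler_normD _ _)).
have h1 : `|(y - z) - (axial y - axial z) *: a| <= `|y - z| + C * `|y - z| * `|a|.
  by apply: (le_trans (ler_normB _ _)); rewrite normrZ lerD2l ler_wpM2r.
have h2 : eps * axial z - eps * (C * `|y - z|) <= eps * axial y.
  by rewrite -mulrBr ler_pM2l//; lra.
by lra.
Qed.

Lemma cone_closed eps R0 z : 0 <= eps ->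
  (forall rho, 0 < rho -> exists2 y, `|y - z| <= rho & cone eps R0 y) -> cone eps R0 z.
Proof.
move=> eps0 H; have [C C0 HC] := axial_bound m_gt0 a_gt0.
have Ca : 0 <= C * `|a| by rewrite mulr_ge0// ltW.
have eC : 0 <= eps * C by rewrite mulr_ge0// ltW.
pose M := C + 1 + C * `|a| + eps * C.
have M0 : 0 < M by rewrite /M; lra.
have key (eta : R) : 0 < eta -> exists2 y, cone eps R0 y & [/\ `|axial y - axial z| <= eta &
    `|z - axial z *: a| <= `|y - axial y *: a| + eps * (axial z - axial y) + eta].
  move=> eta0; have [y yz yc] := H (eta / M) (divr_gt0 eta0 M0).
  rewrite ler_pdivlMr// in yz.
  have ay : `|axial y - axial z| <= C * `|y - z| by rewrite -axialB.
  have yz0 : 0 <= `|y - z| by [].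
  have [k1 k2] : `|y - z| * C <= eta /\ `|y - z| * (1 + C * `|a| + eps * C) <= eta.
    by rewrite /M in yz; split; nra.
  exists y => //; split; first by apply: (le_trans ay); lra.
  have -> : z - axial z *: a = (y - axial y *: a) - ((y - z) - (axial y - axial z) *: a).
    by apply/matrixP => i k; rewrite !mxE; ring.
  apply: (le_trans (ler_normB _ _)).
  have h1 : `|(y - z) - (axial y - axial z) *: a| <= `|y - z| + C * `|y - z| * `|a|.
    by apply: (le_trans (ler_normB _ _)); rewrite normrZ lerD2l ler_wpM2r.
  have h2 : eps * (axial y - axial z) <= eps * (C * `|y - z|).
    by rewrite ler_wpM2l//; have := ler_norm (axial y - axial z); lra.
  by lra.
split; apply/ler_addgt0Pr => eta eta0; have [y [y1 y2] [k1 k2]] := key _ eta0.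
  by move: k1; rewrite ler_norml => /andP[]; lra.
by lra.
Qed.

End ConeGeometry.

(** The supremum of the bad times. Whether it is itself bad is left open: bad times exist
    arbitrarily near it and only good ones after it, which will place the curve on the boundary of
    the cone. *)
Lemma last_exit_time (R : realType) (P : R -> Prop) (al be : R) : al <= be -> ~ (forall s, al <= s <= be -> P s) ->
  exists2 tau, al <= tau <= be & (forall s, tau < s -> s <= be -> P s) /\
    forall eta, 0 < eta -> exists2 s, al <= s <= be & `|s - tau| < eta /\ ~ P s.
Proof.
move=> ab /existsNP[s0 /not_implyP[s0ab nPs0]].
pose E := [set s | al <= s <= be /\ ~ P s].
have Es : has_sup E by split; [exists s0|exists be => s [/andP[]]].
have up : al <= sup E by apply: le_trans (ub_le_sup _ (_ : E s0)) => //; [case/andP: s0ab|case: Es].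
have dn : sup E <= be by apply: ge_sup; [exists s0|move=> s [/andP[]]].
exists (sup E); first by rewrite up.
split=> [s ts sb|eta eta0].
  apply: contrapT => nP; have : s <= sup E.
    by apply: ub_le_sup; [case: Es|split=> //; apply/andP; split; lra].
  by lra.
have [s [sab nP] ss] := sup_adherent eta0 Es.
have ss' : s <= sup E by apply: ub_le_sup; [case: Es|split].
by exists s => //; split=> //; rewrite ltr_norml; apply/andP; split; lra.
Qed.

(** * Invariance of the inner cone, and the calibration along the solutions *)

Section Rays.
Context {R : realType} {d N : nat}.
Variable m : 'I_N -> R.
Hypothesis m_gt0 : forall i, 0 < m i.
Notation mu := (@lebesgue_measure R).
Variables (a : 'M[R]_(N, d)) (e K : R).
Hypothesis tK : tube_const m a e K.
Hypothesis a_gt0 : 0 < mnorm2 m a.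
Variables (R0 : R) (G V : 'M[R]_(N, d) -> R -> 'M[R]_(N, d)) (B : 'M[R]_(N, d) -> R -> R).
Hypothesis R04 : 4 <= R0.
Hypothesis R0K : 2 * K <= R0 - 1.
Hypothesis fam : ray_family m a e R0 G V B.
Notation cone := (cone m a).
Notation calib := (calib m a G B).
Notation axial := (axial m a).
Variable CT : R.
Hypothesis CT_gt0 : 0 < CT.
Hypothesis HCT : forall x, `|axial x| <= CT * `|x|.
Hypothesis R0_1 : CT * K <= R0 / 2.
Hypothesis R0_2 : (1 + CT * `|a|) * K <= e / 16 * R0.
Hypothesis R0_3 : (`|a| + e) * CT * K <= e / 2 * R0.

Lemma cone_inner x : cone (e / 8) R0 x -> cone (e / 4) R0 x.
Proof.
have [e0 _ _] := tK; have R4 := R04; move=> [x1 x2]; split=> //.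
by apply: (le_trans x2); rewrite ler_wpM2r//; lra.
Qed.

Lemma ray_drift x s : cone (e / 4) R0 x -> 0 <= s ->
  `|G x s - x - s *: a| <= K / axial x * s.
Proof.
move=> xc s0; have [e0 K0 _] := tK; have R4 := R04.
have r0 : 0 < axial x by case: xc; lra.
have sol := cone_tube_sol tK R04 fam xc.
have [[eps eps0 nw] _ _] := sol; have [Gx0 _ _ _ _] := fam xc.
apply: mxnorm_le => [|i k]; first by rewrite mulr_ge0// divr_ge0// ltW.
have -> : (G x s - x - s *: a) i k = (G x s i k - s * a i k) - (G x 0 i k - 0 * a i k).
  by rewrite Gx0 !mxE; ring.
rewrite -[X in _ <= _ * X]subr0.
apply: (@deriv_bound _ (fun s => G x s i k - s * a i k) (fun s => V x s i k - a i k)) => // u /andP[u0 _].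
  have [_ gd _] := nw u ltac:(lra).
  have := derB (gd i k) (derM (derX u) (derC u (a i k))).
  by rewrite mul1r mulr0 addr0.
rewrite -mxB_coord; apply: (le_trans (ler_coord_norm _ _ _)).
apply: (le_trans (tube_sol_velocity tK r0 sol u0)).
by rewrite ler_pM2l// lef_pV2 ?posrE//; lra.
Qed.

(** The drift from [x + s *: a] is at most (K / R0) s. For [R0] large the axial coordinate gains at
    least s / 2, while the transversal part grows by at most (e / 16) s, that is e / 8 times s /
    2. *)
Lemma inner_cone_invariant x s : cone (e / 8) R0 x -> 0 <= s -> cone (e / 8) R0 (G x s).
Proof.
move=> xi s0; have [e0 K0 _] := tK; have R4 := R04; have h1 := R0_1; have h2 := R0_2.
have CT0 := CT_gt0.
have dr := ray_drift (cone_inner xi) s0; move: xi => [x1 x2].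
have r0 : 0 < axial x by lra.
pose D := G x s - x - s *: a.
have GE : G x s = x + s *: a + D by rewrite /D; apply/matrixP => i k; rewrite !mxE; ring.
have aE : axial (G x s) = axial x + s + axial D.
  by rewrite GE !axialD axialZ axiala// mulr1.
have aD := HCT D.
have Kr : K / axial x * s <= K / R0 * s.
  by rewrite ler_wpM2r// ler_pM2l// lef_pV2 ?posrE//; lra.
have D1 : `|D| <= K / R0 * s by apply: le_trans Kr.
have k1 : CT * (K / R0 * s) <= s / 2.
  rewrite mulrA [X in X <= _]mulrC [s / 2]mulrC mulrC ler_wpM2r//.
  by rewrite mulrA ler_pdivrMr//; lra.
have aD2 : `|axial D| <= s / 2.
  by apply: (le_trans aD); apply: le_trans k1; rewrite ler_pM2l.
move: (aD2); rewrite ler_norml => /andP[aD3 aD4].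
split; first by lra.
have -> : G x s - axial (G x s) *: a = (x - axial x *: a) + (D - axial D *: a).
  by rewrite aE GE; apply/matrixP => i k; rewrite !mxE; ring.
apply: (le_trans (ler_normD _ _)).
have k2 : `|D - axial D *: a| <= e / 16 * s.
  apply: (le_trans (ler_normB _ _)); rewrite normrZ.
  have : `|axial D| * `|a| <= CT * `|D| * `|a| by rewrite ler_wpM2r.
  have k3 : (1 + CT * `|a|) * `|D| <= (1 + CT * `|a|) * (K / R0 * s).
    by rewrite ler_wpM2l// addr_ge0// mulr_ge0// ltW.
  have : (1 + CT * `|a|) * (K / R0 * s) <= e / 16 * s.
    rewrite mulrA ler_wpM2r// mulrA ler_pdivrMr//; lra.
  by lra.
rewrite aE.
have : e / 8 * (s / 2) <= e / 8 * (s + axial D) by rewrite ler_wpM2l//; lra.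
by lra.
Qed.

(** Follows from uniqueness once the shifted motion is seen as a tube solution with the label of
    [G x s]. That label differs from s + axial x by a small multiple of s, which the spare half of
    the aperture absorbs. *)
Lemma ray_semigroup x s t : cone (e / 8) R0 x -> 0 <= s -> 0 <= t ->
  G (G x s) t = G x (s + t) /\ V (G x s) t = V x (s + t).
Proof.
move=> xi s0 t0; have [e0 K0 _] := tK; have R4 := R04; have h1 := R0_1; have h3 := R0_3.
have RK := R0K; have CT0 := CT_gt0.
have yi := inner_cone_invariant xi s0.
have dr := ray_drift (cone_inner xi) s0.
have [Gx0 nwx [[eps eps0 nw] tb sl] _ _] := fam (cone_inner xi).
have [Gy0 _ _ _ _] := fam (cone_inner yi).
have soly := cone_tube_sol tK R04 fam (cone_inner yi).
have rx : R0 <= axial x by case: xi.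
pose r := axial x; pose r' := axial (G x s).
have rR : R0 <= r by case: xi.
have rR' : R0 <= r' by case: yi.
have rr' : `|r' - (s + r)| <= CT * (K / R0 * s).
  have -> : r' - (s + r) = axial (G x s - x - s *: a).
    by rewrite !axialB axialZ axiala// mulr1 /r' /r; ring.
  apply: (le_trans (HCT _)); rewrite ler_pM2l//; apply: (le_trans dr).
  by rewrite ler_wpM2r// ler_pM2l// lef_pV2 ?posrE//; lra.
have sh : tube_sol m a e r' (fun t => G x (t + s)) (fun t => V x (t + s)).
  split.
  - by exists 1 => //; exact: newton_from_shift.
  - move=> u u0; have := tb (u + s) ltac:(lra); rewrite -/r => tbu.
    have -> : G x (u + s) - (u + r') *: a = (G x (u + s) - (u + s + r) *: a) - (r' - (s + r)) *: a.
      by apply/matrixP => i k; rewrite !mxE; ring.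
    apply: (le_trans (ler_normB _ _)); rewrite normrZ.
    have k1 : `|r' - (s + r)| * (`|a| + e) <= e / 2 * s.
      apply: (@le_trans _ _ (CT * (K / R0 * s) * (`|a| + e))).
        by rewrite ler_wpM2r// addr_ge0// ltW.
      rewrite (_ : _ * _ = (`|a| + e) * CT * K / R0 * s); last by ring.
      by rewrite ler_wpM2r// ler_pdivrMr//; lra.
    have k2 : e * (s + r - r') <= e * `|r' - (s + r)|.
      by rewrite ler_pM2l// distrC; exact: ler_norm.
    have : 0 <= e / 2 * (u + r) by rewrite mulr_ge0//; lra.
    by lra.
  - exact: sublinear_shift.
have rK' : 2 * K <= r' by lra.
have := tube_sol_unique tK rK' soly sh _ t0; rewrite Gy0 add0r => /(_ erefl).
by rewrite (addrC t s).
Qed.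

Lemma ray_action_semigroup x s t : cone (e / 8) R0 x -> 0 <= s -> 0 <= t ->
  B (G x s) t = B x (s + t) - B x s.
Proof.
move=> xi s0 t0; have yi := inner_cone_invariant xi s0.
have [_ _ _ _ Bx] := fam (cone_inner xi); have [_ _ _ By0 By] := fam (cone_inner yi).
pose F u := B (G x s) u - B x (u + s).
have : `|F t - F 0| <= 0 * (t - 0).
  apply: (@deriv_bound _ F (fun=> 0)) => // [u /andP[u0 _]|u _]; last by rewrite normr0.
  have us : 0 <= u + s by lra.
  have := derB (By _ u0) (der_shift (Bx _ us)).
  rewrite /lagrangian_density; have [-> ->] := ray_semigroup xi s0 u0.
  by rewrite (addrC s u) subrr.
rewrite mul0r normr_le0 subr_eq0 /F By0 !add0r (addrC t s) => /eqP h.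
by lra.
Qed.

(** By the semigroup property, the increment of [calib t] is the action plus the increment of <a, G
    x> - B x from s1 + t to s2 + t. The derivative of that function is the opposite of |V x - a|^2 /
    2 + U, which is O(1/t). *)
Lemma calib_along_ray : exists2 C' : R, 0 < C' & forall x (s1 s2 t : R), cone (e / 8) R0 x ->
  0 <= s1 -> s1 <= s2 -> 0 <= t ->
  B x s2 - B x s1 <= calib t (G x s2) - calib t (G x s1) + C' / (t + 1) * (s2 - s1).
Proof.
have [C C0 HC] := mdot_bound (d := d) m_gt0; have [e0 K0 tubeP] := tK; have R4 := R04.
have CK : 0 < C * K ^+ 2 by rewrite mulr_gt0// exprn_gt0.
exists (C * K ^+ 2 + K); first lra.
move=> x s1 s2 t xi s10 s12 t0.
have s20 : 0 <= s2 by lra.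
have xc := cone_inner xi; have sol := cone_tube_sol tK R04 fam xc.
have r0 : R0 <= axial x by case: xi.
have [_ _ _ _ Bd] := fam xc; have [[eps eps0 nw] tb _] := sol.
pose Z u := mdot m a (G x u) - B x u.
have Zd (u : R) : 0 <= u -> is_derive u 1 Z (mdot m a (V x u) - lagrangian_density m a (G x) (V x) u).
  move=> u0; have [_ gd _] := nw u ltac:(lra).
  have z i k : is_derive u 1 (fun=> a i k) ((0 : 'M[R]_(N, d)) i k) by rewrite mxE; exact: derC.
  have := derB (der_mdot m z gd) (Bd _ u0).
  by rewrite -(scale0r (0 : 'M[R]_(N, d))) mdotZl mul0r add0r.
have Zb : `|Z (s2 + t) - Z (s1 + t)| <= (C * K ^+ 2 + K) / (t + 1) * ((s2 + t) - (s1 + t)).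
  apply: (@deriv_bound _ Z (fun u => mdot m a (V x u) - lagrangian_density m a (G x) (V x) u)) => [|u /andP[u1 _]|u /andP[u1 _]].
  - by lra.
  - by apply: Zd; lra.
  have u0 : 0 <= u by lra.
  have ur : 0 < u + axial x by lra.
  have rr : 0 < axial x by lra.
  have vel := tube_sol_velocity tK rr sol u0.
  have [_ _ _ Ub _] := tubeP _ _ _ ur (tb _ u0) (tb _ u0).
  have U0 := U_ge0 m_gt0 (G x u).
  have -> : mdot m a (V x u) - lagrangian_density m a (G x) (V x) u =
      - (2^-1 * mnorm2 m (V x u - a) + U m (G x u)).
    rewrite /lagrangian_density /mnorm2 !mdotBl !mdotBr (mdotC m (V x u) a).
    by lra.
  have n0 := mnorm2_ge0 m_gt0 (V x u - a).
  rewrite normrN ger0_norm; last lra.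
  have h1 : mnorm2 m (V x u - a) <= C * K ^+ 2 / (t + 1).
    apply: (le_trans (ler_norm _)); apply: (le_trans (HC _ _)).
    apply: (@le_trans _ _ (C * (K / (u + axial x)) * (K / (u + axial x)))).
      by apply: ler_pM => //; rewrite ?mulr_ge0 ?(ltW C0)// ler_pM2l.
    rewrite (_ : _ * _ = C * K ^+ 2 / (u + axial x) ^+ 2); last by field; rewrite gt_eqF.
    rewrite ler_pM2l// lef_pV2 ?posrE ?exprn_gt0//; last lra.
    by rewrite expr2; nra.
  have h2 : U m (G x u) <= K / (t + 1).
    by apply: (le_trans Ub); rewrite ler_pM2l// lef_pV2 ?posrE//; lra.
  have : 0 <= C * K ^+ 2 / (t + 1) by rewrite divr_ge0 ?(ltW CK)//; lra.
  by rewrite mulrDl; lra.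
rewrite /calib (ray_action_semigroup xi s10 t0) (ray_action_semigroup xi s20 t0).
have [-> _] := ray_semigroup xi s10 t0; have [-> _] := ray_semigroup xi s20 t0.
move: Zb; rewrite /Z ler_norml !(addrC t) => /andP[Zb _].
by lra.
Qed.

End Rays.

(** * Coordinatewise solutions and solutions in terms of [derive1] *)

Section NewtonData.
Context {R : realType} {d N : nat}.
Variable m : 'I_N -> R.
Implicit Types (g v : R -> 'M[R]_(N, d)).

Lemma Uext_ge0 (x : 'M[R]_(N, d)) : (forall i, 0 < m i) -> (0 <= Uext m x)%E.
Proof. by move=> m0; rewrite /Uext; case: pselect => [h|h]; rewrite ?lee_fin ?U_ge0 ?leey. Qed.

Lemma Uext_inOmega (x : 'M[R]_(N, d)) : inOmega x -> Uext m x = (U m x)%:E.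
Proof. by move=> xO; rewrite /Uext; case: pselect. Qed.

Lemma is_derive_mx_derive1 g (w : 'M[R]_(N, d)) (t : R) :
  (forall i k, is_derive t 1 (fun s => g s i k) (w i k)) -> derivable g t 1 /\ derive1 g t = w.
Proof.
move=> H; have gd : derivable g t 1.
  by apply/derivable_mxP => i k; have ? := H i k; exact: ex_derive.
split=> //; rewrite derive1E derive_mx//; apply/matrixP => i k; rewrite mxE.
by have ? := H i k; exact: derive_val.
Qed.

Lemma derive1_is_derive_mx g (t : R) : derivable g t 1 ->
  forall i k, is_derive t 1 (fun s => g s i k) (derive1 g t i k).
Proof.
move=> gd i k; have := gd => /derivable_mxP /(_ i k) gik.
by apply: DeriveDef => //; rewrite derive1E derive_mx// mxE.
Qed.

Lemma newton_from_solution (eps : R) g v : 0 < eps -> newton_from m (- eps) g v ->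
  newton_solution_on_ray m g /\ forall t, - eps < t -> derive1 g t = v t.
Proof.
move=> eps0 nw.
have dg t : - eps < t -> derive1 g t = v t.
  by move=> /nw[_ gd _]; have [] := is_derive_mx_derive1 gd.
split=> //; exists eps; split=> // t te; have [gO gd vd] := nw t te.
have [h1 h2] := is_derive_mx_derive1 gd.
have vd' i k : is_derive t 1 (fun s => derive1 g s i k) (gradU m (g t) i k).
  apply: der_near (vd i k); near=> s; rewrite dg//.
  by near: s; exact: lt_nbhsr.
by have [] := is_derive_mx_derive1 vd'.
Unshelve. all: by end_near. Qed.

Lemma newton_solution_from g : newton_solution_on_ray m g ->
  exists2 eps, 0 < eps & newton_from m (- eps) g (derive1 g).
Proof.
move=> [eps [eps0 H]]; exists eps => // t te; have [gO [gd [gdd gE]]] := H t te.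
split=> //; first exact: derive1_is_derive_mx.
by rewrite -gE; exact: derive1_is_derive_mx.
Qed.

End NewtonData.

(** * The solutions from the inner cone minimize the action *)

Section Minimality.
Context {R : realType} {d N : nat}.
Variable m : 'I_N -> R.
Hypothesis m_gt0 : forall i, 0 < m i.
Notation mu := (@lebesgue_measure R).
Variables (a : 'M[R]_(N, d)) (e K : R).
Hypothesis tK : tube_const m a e K.
Hypothesis a_gt0 : 0 < mnorm2 m a.
Variables (R0 : R) (G V : 'M[R]_(N, d) -> R -> 'M[R]_(N, d)) (B : 'M[R]_(N, d) -> R -> R).
Hypothesis R04 : 4 <= R0.
Hypothesis R0K : 2 * K <= R0 - 1.
Hypothesis fam : ray_family m a e R0 G V B.
Notation cone := (cone m a).
Notation calib := (calib m a G B).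
Notation axial := (axial m a).
Variable CT : R.
Hypothesis CT_gt0 : 0 < CT.
Hypothesis HCT : forall x, `|axial x| <= CT * `|x|.
Hypothesis R0_1 : CT * K <= R0 / 2.
Hypothesis R0_2 : (1 + CT * `|a|) * K <= e / 16 * R0.
Hypothesis R0_3 : (`|a| + e) * CT * K <= e / 2 * R0.
Variables kap0 Cs : R.
Hypothesis kap0_gt0 : 0 < kap0.
Hypothesis exit_excess : forall x z, cone (e / 8) R0 x -> cone (e / 4) R0 z ->
  axial z <= R0 \/ e / 4 * axial z <= `|z - axial z *: a| ->
  exists2 b, mnorm2 m b = mnorm2 m a & kap0 * `|z - x| <= mdot m (b - a) (z - x).
Variables rho C1 : R.
Hypothesis rho_gt0 : 0 < rho.
Hypothesis C1_gt0 : 0 < C1.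
Hypothesis one_step : forall x y t, cone (e / 4) R0 x -> cone (e / 4) R0 y -> `|y - x| <= rho -> 0 <= t ->
  calib t y - calib t x <= mdot m (V x 0) (y - x) + C1 * t * `|y - x| ^+ 2
     + C1 / Num.sqrt (t + 1) * `|y - x|.
Hypothesis segment : forall (kap t : R) x z, 0 < kap -> 0 <= t ->
  C1 / Num.sqrt (t + 1) <= kap / 2 -> cone (e / 4) R0 x -> cone (e / 4) R0 z ->
  calib t z - calib t x <= mdot m a (z - x) + (Cs / R0 + kap) * `|z - x|.
Hypothesis R0_4 : 2 * Cs <= kap0 * R0.

Let inner_inv x s : cone (e / 8) R0 x -> 0 <= s -> cone (e / 8) R0 (G x s).
Proof. exact: (inner_cone_invariant tK a_gt0 R04 fam CT_gt0). Qed.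
Let inner x : cone (e / 8) R0 x -> cone (e / 4) R0 x.
Proof. exact: (cone_inner tK R04). Qed.

(** For a curve that stays in the wide cone, [tau = al] and [b = a], with a void excess. Otherwise
    the point at [tau] is in the cone, which is closed, but not in its interior, since bad times
    accumulate there. *)
Lemma last_exit (sig v : R -> 'M[R]_(N, d)) (al be : R) : al <= be ->
  abs_cont_with sig v al be -> cone (e / 8) R0 (sig al) -> cone (e / 8) R0 (sig be) ->
  exists2 tau, al <= tau <= be & (forall s, tau <= s <= be -> cone (e / 4) R0 (sig s)) /\
   exists2 b, mnorm2 m b = mnorm2 m a &
     kap0 * `|sig tau - sig al| <= mdot m (b - a) (sig tau - sig al).
Proof.
move=> ab ac ai bi; have [e0 _ _] := tK.
have [all|nall] := pselect (forall s, al <= s <= be -> cone (e / 4) R0 (sig s)).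
  exists al; first by rewrite lexx.
  split=> //; exists a => //.
  by rewrite !subrr normr0 mulr0 -(scale0r (0 : 'M[R]_(N, d))) mdotZl mul0r.
have [tau tab [after esc]] := last_exit_time ab nall.
have [taua taub] : al <= tau /\ tau <= be by apply/andP.
have tc : cone (e / 4) R0 (sig tau).
  have [tb|tb] := ltP tau be; last by have -> : tau = be by [lra]; exact: inner.
  apply: (cone_closed m_gt0 a_gt0); first lra.
  move=> r r0; have [eta eta0 H] := abs_cont_modulus ac tab r0.
  pose s := Num.min be (tau + eta / 2).
  have s1 : s <= be by rewrite ge_min lexx.
  have s2 : s <= tau + eta / 2 by rewrite ge_min lexx orbT.
  have s3 : tau < s by rewrite lt_min tb; lra.
  exists (sig s); last exact: after.
  apply: H; first by apply/andP; split; lra.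
  by rewrite ger0_norm; lra.
exists tau => //; split.
  move=> s /andP[ts sb]; move: ts; rewrite le_eqVlt => /predU1P[<-//|ts].
  exact: after.
apply: exit_excess => //; apply: contrapT => /not_orP[/negP n1 /negP n2].
rewrite -!ltNge in n1 n2.
have [r r0 Hr] := cone_continuous_interior m_gt0 a_gt0 n1 n2 ltac:(lra).
have [eta eta0 H] := abs_cont_modulus ac tab r0.
have [s sab [st ns]] := esc _ eta0.
by apply: ns; apply: Hr; exact: H.
Qed.

Lemma time_large (kap c eps : R) : 0 < kap -> 0 <= c -> 0 < eps ->
  exists t, [/\ 0 <= t, C1 / Num.sqrt (t + 1) <= kap / 2 & c / (t + 1) <= eps].
Proof.
move=> kap0' c0 eps0; have C0 := C1_gt0.
pose q := 2 * C1 / kap; have q0 : 0 < q by rewrite divr_gt0//; lra.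
have ce : 0 <= c / eps by rewrite divr_ge0// ltW.
exists (q ^+ 2 + c / eps); split; first by rewrite addr_ge0// sqr_ge0.
- have q2 : 0 <= q ^+ 2 by rewrite sqr_ge0.
  have sq : q <= Num.sqrt (q ^+ 2 + c / eps + 1).
    rewrite -[leLHS]ger0_norm ?(ltW q0)// -sqrtr_sqr ler_wsqrtr//; lra.
  rewrite ler_pdivrMr; last by apply: lt_le_trans sq.
  apply: (@le_trans _ _ (kap / 2 * q)); last by rewrite ler_wpM2l//; lra.
  by rewrite /q le_eqVlt; apply/orP; left; apply/eqP; field; rewrite gt_eqF.
- have q2 : 0 <= q ^+ 2 by rewrite sqr_ge0.
  rewrite ler_pdivrMr; last lra.
  apply: (@le_trans _ _ (eps * (c / eps))); last by rewrite ler_wpM2l ?(ltW eps0)//; lra.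
  by rewrite le_eqVlt; apply/orP; left; apply/eqP; field; rewrite gt_eqF.
Qed.

(** Before [tau] the curve may collide and [U] is dropped; after it [Uext] is the continuous
    function [U]. Restricting [U] to the second interval gives a measurable minorant of the whole
    integrand. *)
Lemma action_split (sig v : R -> 'M[R]_(N, d)) (al tau be : R) :
  abs_cont_with sig v al be -> al <= tau -> tau <= be ->
  (forall s, tau <= s <= be -> inOmega (sig s)) ->
  (\int[mu]_(s in `[al, tau]) (2^-1 * mnorm2 m (v s) + 2^-1 * mnorm2 m a)%:E +
   \int[mu]_(s in `[tau, be]) (2^-1 * mnorm2 m (v s) + 2^-1 * mnorm2 m a + U m (sig s))%:E
   <= action m (2^-1 * mnorm2 m a) sig v al be)%E.
Proof.
move=> ac altau taube sO; have a0 := a_gt0.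
pose kin s := 2^-1 * mnorm2 m (v s) + 2^-1 * mnorm2 m a.
have kin0 s : 0 <= kin s by have := mnorm2_ge0 m_gt0 (v s); rewrite /kin; lra.
pose f s := kin s + ((fun s => U m (sig s)) \_ `[tau, be]) s.
have patch0 s : 0 <= ((fun s => U m (sig s)) \_ `[tau, be]) s.
  by rewrite patchE; case: ifP => // _; exact: U_ge0.
have f0 s : 0 <= f s by rewrite addr_ge0.
have sub : (`[tau, be] : set (measurableTypeR R)) `<=` `[al, be].
  by apply: subset_itv; rewrite bnd_simp.
have mkin : measurable_fun `[al, be] kin.
  apply: measurable_funD; last exact: measurable_cst.
  apply: measurable_funM; first exact: measurable_cst.
  exact: measurable_mnorm2_v ac.
have Uc := sig_omega_U_within m_gt0 ac altau (lexx be) sO.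
have mf : measurable_fun `[al, be] f.
  apply: measurable_funD => //; apply/measurable_restrict => //.
  rewrite setIidr//; exact: subspace_continuous_measurable_fun.
apply: (@le_trans _ _ (\int[mu]_(s in `[al, be]) (f s)%:E)%E); last first.
  apply: ge0_le_integral_any => [s _|s _|s]; first by rewrite lee_fin.
    by rewrite adde_ge0 ?Uext_ge0// lee_fin; exact: kin0.
  rewrite /= in_itv/= => sab; rewrite /f EFinD leeD2l// patchE.
  case: ifPn => [|_].
    by rewrite inE/= in_itv/= => /sO so; rewrite Uext_inOmega.
  exact: Uext_ge0.
rewrite (@integral_split _ f al tau be)//; apply: leeD.
- apply: ge0_le_integral_any => s _; rewrite lee_fin ?kin0 ?f0//.
  by rewrite /f lerDl.
- apply: ge0_le_integral_any => s; rewrite /= in_itv/= => sab; rewrite lee_fin ?f0//.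
    by rewrite addr_ge0 ?kin0 ?U_ge0.
  by rewrite /f patchE ifT// inE/= in_itv.
Qed.

(** The action of the ray is nearly the increment of [calib t]. From the start to the last exit
    point z that increment is at most <a, z - x> + kap0 |z - x|, hence at most <b, z - x> and the
    free action; from there on [calib_curve] applies. *)
Lemma ray_minimal x (s1 s2 : R) (sig v : R -> 'M[R]_(N, d)) (al be : R) :
  cone (e / 8) R0 x -> 0 <= s1 -> s1 <= s2 -> al <= be ->
  abs_cont_with sig v al be -> sig al = G x s1 -> sig be = G x s2 ->
  ((B x s2 - B x s1)%:E <= action m (2^-1 * mnorm2 m a) sig v al be)%E.
Proof.
move=> xi s10 s12 ab ac sal sbe; have s20 : 0 <= s2 by lra.
have R4 := R04; have k0 := kap0_gt0.
(* Half of the excess [kap0] pays for the spread of the initial velocities in the cone, the other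
   half for [kap]. *)
have CsR : Cs / R0 <= kap0 / 2 by rewrite ler_pdivrMr; [move: R0_4; lra|lra].
have yi1 := inner_inv xi s10; have yi2 := inner_inv xi s20.
have [||tau tab [tcone [b bE excess]]] := last_exit ab ac; rewrite ?sal ?sbe//.
have [altau taube] : al <= tau /\ tau <= be by apply/andP.
have sO s : tau <= s <= be -> inOmega (sig s) by move=> /tcone; exact: (cone_inOmega fam).
have [C' C'0 along] := calib_along_ray m_gt0 tK a_gt0 R04 R0K fam CT_gt0 HCT R0_1 R0_2 R0_3.
have [Y hY _] := has_integral_speed1 ac altau taube (lexx be).
have h1 : has_integral tau be (fun=> 1) (Rintegral mu `[tau, be] (fun=> 1)).
  split=> //; apply: continuous_compact_integrable; first exact: segment_compact.
  by apply: continuous_subspaceT => z; exact: cvg_cst.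
pose L := Rintegral mu `[tau, be] (fun=> 1) + Y.
have hL : has_integral tau be (fun s => 1 + speed1 v s) L := has_integralD h1 hY.
apply/lee_addgt0Pr => eps eps0.
(* [L] depends on the competitor, so [kap] is chosen after it, and t after [kap]. *)
pose kap := Num.min (kap0 / 2) (eps / 2 / (`|L| + 1)).
have L1 : 0 < `|L| + 1 by rewrite ltr_wpDl.
have kap_gt0 : 0 < kap by rewrite lt_min !divr_gt0.
have kap1 : kap <= kap0 / 2 by rewrite ge_min lexx.
have kap2 : kap * L <= eps / 2.
  apply: (@le_trans _ _ (kap * (`|L| + 1))).
    by rewrite ler_wpM2l ?(ltW kap_gt0)//; have := ler_norm L; lra.
  by rewrite -ler_pdivlMr// ge_min lexx orbT.
have s21 : 0 <= s2 - s1 by lra.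
have [t [t0 t1 t2]] := time_large kap_gt0 (mulr_ge0 (ltW C'0) s21) (divr_gt0 eps0 (ltr0Sn R 1)).
have al1 := along x s1 s2 t xi s10 s12 t0.
have seg := segment kap_gt0 t0 t1 (inner yi1) (tcone tau ltac:(by rewrite lexx)).
have crv := calib_curve m_gt0 tK a_gt0 R04 fam rho_gt0 C1_gt0 one_step ac altau taube tcone kap_gt0 t0 t1.
have fre := @free_action_lower _ _ _ _ m_gt0 _ _ _ _ ac (2^-1 * mnorm2 m a) b al tau (lexx al) altau taube ltac:(by rewrite bE).
rewrite sal in fre excess; rewrite sbe in crv.
set I1 := (\int[mu]_(s in `[al, tau]) _)%E in fre.
pose I2 := (\int[mu]_(s in `[tau, be]) (2^-1 * mnorm2 m (v s) + 2^-1 * mnorm2 m a + U m (sig s))%:E)%E.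
have I3 : (\int[mu]_(s in `[tau, be]) (2^-1 * mnorm2 m (v s) + 2^-1 * mnorm2 m a + U m (sig s) + kap * (1 + speed1 v s))%:E = I2 + (kap * L)%:E)%E.
  have [ki <-] := has_integralZ kap hL.
  rewrite /Rintegral fineK; last exact: integrable_fin_num.
  rewrite /I2 -ge0_integralD//=.
  - move=> s _; rewrite lee_fin; have := mnorm2_ge0 m_gt0 (v s); have := U_ge0 m_gt0 (sig s).
    by have := a_gt0; lra.
  - apply/measurable_EFinP.
    have sub : (`[tau, be] : set (measurableTypeR R)) `<=` `[al, be].
      by apply: subset_itv; rewrite bnd_simp.
    apply: measurable_funD; last first.
      by apply: subspace_continuous_measurable_fun => //; exact: (sig_omega_U_within m_gt0 ac altau (lexx be) sO).
    apply: measurable_funD; last exact: measurable_cst.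
    apply: measurable_funM; first exact: measurable_cst.
    exact: (measurable_funS _ sub (measurable_mnorm2_v m ac)).
  - by move=> s _; rewrite lee_fin mulr_ge0 ?addr_ge0 ?speed1_ge0// ltW.
  - by have /integrableP[] := ki.
rewrite I3 in crv.
have asp := action_split ac altau taube sO; rewrite -/I1 -/I2 in asp.
have real_part : B x s2 - B x s1 <= mdot m b (sig tau - G x s1) + (calib t (G x s2) - calib t (sig tau)) + eps / 2.
  have sg : (Cs / R0 + kap) * `|sig tau - G x s1| <= kap0 * `|sig tau - G x s1|.
    rewrite ler_wpM2r//.
    by apply: le_trans (lerD CsR kap1) _; rewrite -splitr.
  have t2' : C' / (t + 1) * (s2 - s1) <= eps / 2.
    by apply: le_trans t2; rewrite le_eqVlt; apply/orP; left; apply/eqP; ring.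
  move: excess; rewrite mdotBl => excess.
  by lra.
apply: (@le_trans _ _ ((mdot m b (sig tau - G x s1))%:E + (calib t (G x s2) - calib t (sig tau))%:E + (eps / 2)%:E)%E).
  by rewrite -!EFinD lee_fin.
apply: (@le_trans _ _ (I1 + (I2 + (kap * L)%:E) + (eps / 2)%:E)%E).
  by rewrite leeD2r// leeD.
rewrite addeA -addeA; apply: leeD => //.
by rewrite -EFinD lee_fin; lra.
Qed.

End Minimality.

Section FTC.
Context {R : realType}.
Notation mu := (@lebesgue_measure R).

Lemma ftc_is_derive (F f : R -> R) (a b : R) : a < b ->
  (forall s, a <= s <= b -> is_derive s 1 F (f s)) ->
  (forall s, a <= s <= b -> {for s, continuous f}) ->
  (\int[mu]_(x in `[a, b]) (f x)%:E = (F b - F a)%:E)%E.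
Proof.
move=> ab Fd fc; rewrite EFinB; apply: continuous_FTC2 => //.
- apply: continuous_in_subspaceT => x; rewrite inE/= in_itv/= => xab.
  exact: fc.
- split.
  + move=> x; rewrite in_itv/= => /andP[ax xb].
    by have ? := Fd x ltac:(by rewrite !ltW); exact: ex_derive.
  + apply: cvg_at_right_filter; apply: (is_derive_cont (Fd a _)).
    by rewrite lexx ltW.
  + apply: cvg_at_left_filter; apply: (is_derive_cont (Fd b _)).
    by rewrite lexx andbT ltW.
- move=> x; rewrite in_itv/= => /andP[ax xb].
  have ? := Fd x ltac:(by rewrite !ltW).
  by rewrite derive1E; exact: derive_val.
Qed.

End FTC.

(** * Conservation of the total momentum *)

Section CenterOfMass.
Context {R : realType} {d N : nat}.
Variable m : 'I_N -> R.
Implicit Types (x y : 'M[R]_(N, d)).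

Lemma inX_coord x : inX m x <-> forall k, \sum_i m i * x i k = 0.
Proof.
split=> [/rowP xX k|H]; last apply/rowP => k.
  have := xX k; rewrite summxE [RHS]mxE => h; rewrite -[RHS]h.
  by apply: eq_bigr => i _; rewrite !mxE.
by rewrite summxE [RHS]mxE -[RHS](H k); apply: eq_bigr => i _; rewrite !mxE.
Qed.

Lemma newton_com_velocity (eps : R) (g v : R -> 'M[R]_(N, d)) k : 0 < eps -> newton_from m (- eps) g v ->
  forall s, 0 <= s -> \sum_i m i * v s i k = \sum_i m i * v 0 i k.
Proof.
move=> eps0 nw s s0; apply/eqP; rewrite -subr_eq0 -normr_le0.
apply: (@le_trans _ _ (0 * (s - 0))); last by rewrite mul0r.
apply: (@deriv_bound _ (fun s => \sum_i m i * v s i k) (fun=> 0)) => // [u /andP[u0 _]|u _]; last by rewrite normr0.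
rewrite -[X in is_derive _ _ _ X](gradU_com m (g u) k); apply: der_sum => i _; apply: derMl.
by have [_ _ vd] := nw u ltac:(lra).
Qed.

Lemma newton_com_position (eps : R) (g v : R -> 'M[R]_(N, d)) : 0 < eps -> newton_from m (- eps) g v ->
  inX m (g 0) -> inX m (v 0) -> forall s, 0 <= s -> inX m (g s).
Proof.
move=> eps0 nw /inX_coord g0 /inX_coord v0 s s0; apply/inX_coord => k.
apply/eqP; rewrite -normr_le0 -[X in `|X|]subr0 -[X in _ - X](g0 k).
apply: (@le_trans _ _ (0 * (s - 0))); last by rewrite mul0r.
apply: (@deriv_bound _ (fun s => \sum_i m i * g s i k) (fun=> 0)) => // [u /andP[u0 _]|u _]; last by rewrite normr0.
rewrite -[X in is_derive _ _ _ X](v0 k) -(newton_com_velocity k eps0 nw u0); apply: der_sum => i _; apply: derMl.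
by have [_ gd _] := nw u ltac:(lra).
Qed.

End CenterOfMass.

(** * Geodesic rays with limit shape [a] from every point of a cone *)

Section GeodesicRays.
Context {R : realType} {d N : nat}.
Variable m : 'I_N -> R.
Hypothesis m_gt0 : forall i, 0 < m i.
Notation mu := (@lebesgue_measure R).
Implicit Types (x : 'M[R]_(N, d)).

(** The total momentum is constant and tends to that of [a], which is zero. *)
Lemma tube_sol_com_velocity (a : 'M[R]_(N, d)) (e K r : R) g v : tube_const m a e K -> 0 < r ->
  tube_sol m a e r g v -> inX m a -> inX m (v 0).
Proof.
move=> tK r0 sol /inX_coord aX; apply/inX_coord => k; have [_ K0 _] := tK.
have [[eps eps0 nw] _ _] := sol.
pose M := \sum_i m i; have M0 : 0 <= M by rewrite sumr_ge0// => i _; exact/ltW.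
apply/eqP; rewrite -normr_le0; apply: (decay_le0 (mulr_ge0 M0 (ltW K0)) r0 (lexx 0)) => t t0.
rewrite -(newton_com_velocity k eps0 nw t0) -[X in `|X|]subr0 -[X in _ - X](aX k) -sumrB.
apply: (le_trans (ler_norm_sum _ _ _)); rewrite /M -mulrA mulr_suml; apply: ler_sum => i _.
rewrite -mulrBr normrM gtr0_norm// ler_pM2l// -mxB_coord.
exact: le_trans (ler_coord_norm _ _ _) (tube_sol_velocity tK r0 sol t0).
Qed.

Lemma hyperbolic_sublinear (a : 'M[R]_(N, d)) g : inOmega a ->
  hyperbolic_with_shape g a <-> sublinear (fun t => g t - t *: a).
Proof.
move=> aO; split=> [[_ /cvgrPdist_le H] eta eta0|sl].
  have [M [Mr HM]] := H _ eta0.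
  exists (Num.max (M + 1) 1) => s; rewrite ge_max => /andP[sM s1].
  have s0 : 0 < s by lra.
  have := HM s ltac:(lra); rewrite /= sub0r normrN normrZ normfV (gtr0_norm s0).
  by rewrite mulrC ler_pdivrMr.
split=> //; apply/cvgrPdist_le => eta eta0; have [S HS] := sl _ eta0.
exists (Num.max S 1); split; first exact: num_real.
move=> s; rewrite gt_max => /andP[sS s1]; have s0 : 0 < s by lra.
rewrite /= sub0r normrN normrZ normfV (gtr0_norm s0) mulrC ler_pdivrMr//.
by apply: HS; exact: ltW.
Qed.

Theorem cone_geodesic_rays (a : 'M[R]_(N, d)) : inOmega a -> 0 < mnorm2 m a ->
  exists e R0 : R, [/\ 0 < e, 0 < R0 & forall x, cone m a e R0 x ->
  exists g : R -> 'M[R]_(N, d), [/\ g 0 = x, newton_solution_on_ray m g,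
    geodesic_ray m (energy m x (derive1 g 0)) g, hyperbolic_with_shape g a &
    inOmega x /\ (inX m a -> inX m (derive1 g 0))] ].
Proof.
move=> aO a_gt0; have [e [K tK]] := tube_const_exists m_gt0 aO.
have [e0 K0 _] := tK.
have [CT CT0 HCT] := axial_bound m_gt0 a_gt0.
have [kap0 kap00 excess] := cone_exit_excess m_gt0 e0 a_gt0.
(* Each [q] is a threshold for one smallness condition; [R0] is larger than their sum, so that all
   conditions hold together. *)
pose q1 := 2 * K / e; pose q2 := 2 * (CT * K); pose q3 := (1 + CT * `|a|) * K * 16 / e.
have [C C0 HC] := mdot_bound (d := d) m_gt0.
pose q4 := (`|a| + e) * CT * K * 2 / e.
have q10 : 0 <= q1 by rewrite divr_ge0 ?mulr_ge0// ltW.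
have q20 : 0 <= q2 by rewrite mulr_ge0// mulr_ge0// ltW.
have Ca : 0 <= CT * `|a| by rewrite mulr_ge0// ltW.
have q30 : 0 <= q3 by rewrite divr_ge0 ?(ltW e0)// mulr_ge0// mulr_ge0 ?(ltW K0)//; lra.
have q40 : 0 <= q4.
  rewrite divr_ge0 ?(ltW e0)// mulr_ge0// mulr_ge0 ?(ltW K0)// mulr_ge0 ?(ltW CT0)//.
  by have := normr_ge0 a; lra.
pose q5 := 2 * (C * K) / kap0.
have q50 : 0 <= q5 by rewrite divr_ge0 ?(ltW kap00)// mulr_ge0// mulr_ge0// ltW.
pose R0 := 4 + 2 * K + q1 + q2 + q3 + q4 + q5.
have R04 : 4 <= R0 by rewrite /R0; lra.
have R0K : 2 * K <= R0 - 1 by rewrite /R0; lra.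
have R0e : K <= e / 2 * (R0 - 1).
  have -> : K = e / 2 * q1 by rewrite /q1; field; rewrite gt_eqF.
  by rewrite ler_wpM2l//; rewrite /R0; lra.
have R0_1 : CT * K <= R0 / 2 by rewrite /R0 /q2; lra.
have R0_2 : (1 + CT * `|a|) * K <= e / 16 * R0.
  have -> : (1 + CT * `|a|) * K = e / 16 * q3 by rewrite /q3; field; rewrite gt_eqF.
  by rewrite ler_wpM2l//; [lra|rewrite /R0; lra].
have R0_3 : (`|a| + e) * CT * K <= e / 2 * R0.
  have -> : (`|a| + e) * CT * K = e / 2 * q4 by rewrite /q4; field; rewrite gt_eqF.
  by rewrite ler_wpM2l//; [lra|rewrite /R0; lra].
have R0_4 : 2 * (C * K) <= kap0 * R0.
  have -> : 2 * (C * K) = kap0 * q5 by rewrite /q5; field; rewrite gt_eqF.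
  by rewrite ler_pM2l// /R0; lra.
have [G [V [B fam]]] := ray_family_exists m_gt0 tK R04 R0e R0K.
have [rho [C1 [rho0 C10 one_step]]] := calib_one_step m_gt0 tK a_gt0 R04 R0K fam.
have segment := calib_segment tK R04 fam rho0 C10 one_step HC C0.
exists (e / 8), R0; split; [by lra|by lra|move=> x xi].
have xc := cone_inner tK R04 xi.
have [Gx0 nw sol Bx0 Bd] := fam x xc.
have sol' := cone_tube_sol tK R04 fam xc.
have r0 : 0 < axial m a x by case: xi; lra.
have [nsol dG] := newton_from_solution ltr01 nw.
have [eps' eps'0 nw'] := newton_solution_from nsol.
have dG0 : derive1 (G x) 0 = V x 0 by apply: dG; lra.
have xO := cone_inOmega fam xc.
exists (G x); split=> //.
- have -> : energy m x (derive1 (G x) 0) = 2^-1 * mnorm2 m a.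
    rewrite /energy dG0; have := tube_sol_energy m_gt0 tK r0 sol' (lexx 0).
    by rewrite Gx0.
  split; first by rewrite mulr_ge0// ltW.
  split=> // s t s0 st.
  have s1 u : s <= u -> -1 < u by lra.
  have se u : s <= u -> - eps' < u by lra.
  pose f := lagrangian_density m a (G x) (V x).
  have actE : action m (2^-1 * mnorm2 m a) (G x) (derive1 (G x)) s t = (B x t - B x s)%:E.
    have Bd' (u : R) : s <= u <= t -> is_derive u 1 (B x) (f u).
      by move=> /andP[su ut]; apply: Bd; exact: le_trans su.
    have fc u : s <= u <= t -> {for u, continuous f}.
      move=> /andP[su ut]; have [gO gd vd] := nw u (s1 _ su).
      apply: is_derive_cont.
      exact: (derD (derD (derMl _ (der_mdot m vd vd)) (der_U m gO gd)) (derC _ _)).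
    rewrite -(ftc_is_derive st Bd' fc).
    apply: eq_integral => u; rewrite inE/= in_itv/= => /andP[su ut].
    have [gO _ _] := nw u (s1 _ su).
    rewrite Uext_inOmega// (dG _ (s1 _ su)).
    by rewrite -EFinD /f /lagrangian_density addrAC.
  have ac : abs_cont_with (G x) (derive1 (G x)) s t.
    move=> i k.
    have wc u : s <= u -> {for u, continuous (fun u => derive1 (G x) u i k)}.
      move=> su; have [_ _ vd] := nw' u (se _ su).
      exact: is_derive_cont (vd i k).
    split.
      apply: continuous_compact_integrable; first exact: segment_compact.
      apply: continuous_in_subspaceT => u; rewrite inE/= in_itv/= => /andP[su _].
      exact: wc.
    move=> u /andP[su ut]; move: su; rewrite le_eqVlt => /predU1P[<-|su].
      by rewrite set_itv1 Rintegral_set1 addr0.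
    have Gd (w : R) : s <= w <= u -> is_derive w 1 (fun u => G x u i k) (derive1 (G x) w i k).
      by move=> /andP[sw _]; have [_ gd _] := nw' w (se _ sw).
    have Gc w : s <= w <= u -> {for w, continuous (fun u => derive1 (G x) u i k)}.
      by move=> /andP[sw _]; exact: wc.
    by rewrite /Rintegral (ftc_is_derive su Gd Gc)/= addrC subrK.
  (* Every competitor costs at least as much as the ray, and the ray is one of them. *)
  rewrite actE; apply/eqP; rewrite eq_le; apply/andP; split.
    apply/ereal_infP => _ [sig [v [al [be [ab [sac [sal [sbe ->]]]]]]]].
    by apply: (ray_minimal m_gt0 tK a_gt0 R04 R0K fam CT0 HCT R0_1 R0_2 R0_3 kap00 _ rho0 C10 one_step segment R0_4 xi s0 (ltW st) (ltW ab) sac sal sbe) => y z; apply: excess; lra.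
  by apply: ereal_inf_lbound; exists (G x), (derive1 (G x)), s, t.
- by apply/(hyperbolic_sublinear _ aO); case: sol.
- split=> // aX; rewrite dG0; exact: tube_sol_com_velocity tK r0 sol' aX.
Qed.

End GeodesicRays.

(** * Null sets of the Hausdorff measure *)

Section HausdorffNull.
Context {R : realType} {V : normedModType R}.
Implicit Types (A B : set V) (s : R).

Lemma ediam_le A (c : R) : (forall x y, A x -> A y -> `|x - y| <= c) -> (ediam A <= c%:E)%E.
Proof. by move=> H; apply/ereal_supP => _ [x [y [Ax [Ay ->]]]]; rewrite lee_fin H. Qed.

Lemma ediam_dist A x y : A x -> A y -> (`|x - y|%:E <= ediam A)%E.
Proof. by move=> Ax Ay; apply: ereal_sup_ubound; exists x, y. Qed.

Lemma ediam_set0 : ediam (set0 : set V) = -oo%E.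
Proof.
rewrite /ediam -ereal_sup0; congr ereal_sup; apply/seteqP; split=> // r.
by case=> x [y []].
Qed.

Lemma ediam_ge0 A x : A x -> (0 <= ediam A)%E.
Proof. by move=> Ax; have := ediam_dist Ax Ax; rewrite subrr normr0. Qed.

Lemma diam_pow_ge0 A s : (0 <= diam_pow A s)%E.
Proof. by rewrite /diam_pow; case: ediam => [r| |]; rewrite ?leey ?lee_fin ?powR_ge0. Qed.

Lemma diam_pow_set0 s : diam_pow (set0 : set V) s = 0%E.
Proof. by rewrite /diam_pow ediam_set0. Qed.

Lemma diam_pow_le A (c s : R) : 0 <= s -> 0 <= c -> (ediam A <= c%:E)%E ->
  (diam_pow A s <= (c `^ s)%:E)%E.
Proof.
move=> s0 c0; rewrite /diam_pow.
have [->|/set0P[x Ax]] := eqVneq A set0; first by rewrite ediam_set0 lee_fin powR_ge0.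
have := ediam_ge0 Ax; case: ediam => [r| |]//.
by rewrite !lee_fin => r0 rc; apply: ge0_ler_powR => //; rewrite nnegrE.
Qed.

Lemma hausdorff_nullP s A : hausdorff_measure s A = 0%E <->
  forall eps delta : R, 0 < eps -> 0 < delta -> exists C : nat -> set V,
  [/\ A `<=` \bigcup_n C n, forall n, (ediam (C n) <= delta%:E)%E &
      (\sum_(0 <= n <oo) diam_pow (C n) s <= eps%:E)%E].
Proof.
split=> [H eps delta eps0 delta0|H].
  have : (hausdorff_delta s delta A < eps%:E)%E.
    apply: (@le_lt_trans _ _ 0%E); last by rewrite lte_fin.
    by rewrite -H; apply: ereal_sup_ubound; exists delta.
  move=> /ereal_inf_lt[_ [C [AC [dC ->]]] /ltW h].
  by exists C.
apply/eqP; rewrite eq_le; apply/andP; split.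
  apply/ereal_supP => _ [delta [delta0 ->]]; apply/lee_addgt0Pr => eps eps0.
  rewrite add0e; have [C [AC dC sC]] := H _ _ eps0 delta0.
  by apply: le_trans sC; apply: ereal_inf_lbound; exists C.
apply: (@le_trans _ _ (hausdorff_delta s 1 A)); last first.
  by apply: ereal_sup_ubound; exists 1.
apply/ereal_infP => _ [C [_ [_ ->]]].
by apply: nneseries_ge0 => n _ _; exact: diam_pow_ge0.
Qed.

Lemma hausdorff_null_sub s A B : A `<=` B -> hausdorff_measure s B = 0%E ->
  hausdorff_measure s A = 0%E.
Proof.
move=> AB /hausdorff_nullP H; apply/hausdorff_nullP => eps delta eps0 delta0.
have [C [BC dC sC]] := H _ _ eps0 delta0; exists C; split=> //.
exact: subset_trans BC.
Qed.

Lemma hausdorff_null_bigcup s (A : nat -> set V) :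
  (forall n, hausdorff_measure s (A n) = 0%E) -> hausdorff_measure s (\bigcup_n A n) = 0%E.
Proof.
move=> H; apply/hausdorff_nullP => eps delta eps0 delta0.
have H' n : exists C : nat -> set V, [/\ A n `<=` \bigcup_n C n, forall n, (ediam (C n) <= delta%:E)%E &
      (\sum_(0 <= n <oo) diam_pow (C n) s <= (eps / (2 ^ n.+1)%:R)%:E)%E].
  have /hausdorff_nullP := H n; apply => //.
  by rewrite divr_gt0// ltr0n expn_gt0.
have [C HC] := choice H'.
have /card_esym/ppcard_eqP[f] := card_nat2.
exists (fun q => C (f q).1 (f q).2); split.
- move=> x [n _]; have [AC _ _] := HC n => /AC[j _ Cx].
  by exists (f^-1%FUN (n, j)) => //=; rewrite invK ?inE.
- by move=> q; have [_ dC _] := HC (f q).1.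
pose F (ij : nat * nat) := diam_pow (C ij.1 ij.2) s.
have F0 ij : (0 <= F ij)%E by exact: diam_pow_ge0.
rewrite nneseries_esumT; last by move=> n; exact: diam_pow_ge0.
have -> : (\esum_(i in [set: nat]) diam_pow (C (f i).1 (f i).2) s = \esum_(ij in [set: nat * nat]) F ij)%E.
  by rewrite (reindex_esum setT setT f).
have -> : ([set: nat * nat] = [set: nat] `*`` (fun=> [set: nat]))%classic.
  by apply/seteqP; split.
rewrite -(esum_esum (a := fun i j => F (i, j)))//.
apply: (@le_trans _ _ (\esum_(i in [set: nat]) (eps / (2 ^ i.+1)%:R)%:E)%E).
  apply: le_esum => i _; have [_ _ sC] := HC i.
  rewrite -nneseries_esumT; last by move=> j; exact: diam_pow_ge0.
  exact: sC.
rewrite -nneseries_esumT; first by apply: epsilon_trick0; exact: ltW.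
by move=> n; rewrite lee_fin divr_ge0// ltW.
Qed.

(** Covers are sequences by definition, so a finite one is padded with empty sets, whose [diam_pow]
    is 0. *)
Lemma finite_cover_sum (T : finType) (D : T -> set V) s :
  exists C : nat -> set V, [/\ \bigcup_n C n = \bigcup_w D w,
    forall n, C n = set0 \/ exists w, C n = D w &
    (\sum_(0 <= n <oo) diam_pow (C n) s = \sum_w diam_pow (D w) s)%E].
Proof.
pose C n := nth set0 [seq D w | w <- enum T] n.
have Cw n : C n = set0 \/ exists w, C n = D w.
  have [nT|nT] := ltnP n #|T|; last by left; rewrite /C nth_default// size_map -cardE.
  right; have [w0 _] : exists w : T, w \in enum T.
    by exists (enum_val (Ordinal nT)); rewrite mem_enum.
  by exists (nth w0 (enum T) n); rewrite /C (nth_map w0)// -cardE.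
exists C; split=> //.
- apply/seteqP; split=> [x [n _]|x [w _ Dx]].
    by case: (Cw n) => [->//|[w ->]] Dx; exists w.
  exists (index w (enum T)) => //.
  by rewrite /C (nth_map w) ?nth_index ?index_mem ?mem_enum.
rewrite (@nneseries_split _ _ 0%N #|T|); last by move=> k _; exact: diam_pow_ge0.
rewrite [X in (_ + X)%E]eseries0 ?adde0; last first.
  move=> i Ti _; rewrite /C nth_default ?diam_pow_set0// size_map -cardE.
  by rewrite add0n in Ti.
rewrite add0n -big_enum/= -(big_map D xpredT (fun B => diam_pow B s)).
by rewrite (big_nth set0) size_map -cardE.
Qed.

End HausdorffNull.

(** * Lipschitz images and the upper bound for the dimension *)

Section LipschitzImages.
Context {R : realType} {V : normedModType R}.

(** The images of M^k small cubes have diameter at most c / M, so the sum is at most c^s M^(k - s),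
    which tends to 0. *)
Lemma lip_cube_null k (f : 'rV[R]_k -> V) (L p s : R) : 0 < L -> 0 < p -> k%:R < s ->
  (forall x y, `|f x - f y| <= L * `|x - y|) ->
  hausdorff_measure s (f @` [set z | `|z| <= p]) = 0%E.
Proof.
move=> L0 p0 ks fL; apply/hausdorff_nullP => eps delta eps0 delta0.
have s0 : 0 < s by apply: le_lt_trans ks.
pose c := 4 * L * p.
have c0 : 0 < c by rewrite /c !mulr_gt0.
(* M > c / delta makes the pieces small enough, and M^(s - k) >= c^s / eps makes their sum at most
   eps. *)
pose X := Num.max (c / delta) ((c `^ s / eps) `^ (s - k%:R)^-1).
have X0 : 0 <= X by rewrite le_max divr_ge0// ltW.
pose M := (Num.Def.archi_bound X).+1.
have MX : X < M%:R.
  by apply: lt_trans (archi_boundP X0) _; rewrite ltr_nat.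
have M0 : 0 < M%:R :> R by rewrite ltr0n.
pose node (j : 'I_M) : R := - p + 2 * p * j%:R / M%:R.
pose D (w : {ffun 'I_k -> 'I_M}) := f @` [set z : 'rV[R]_k | forall i, `|z ord0 i - node (w i)| <= 2 * p / M%:R].
have [C [CD Cw Cs]] := finite_cover_sum D s.
have Dd w : (ediam (D w) <= (c / M%:R)%:E)%E.
  apply: ediam_le => _ _ [x Hx <-] [y Hy <-]; apply: (le_trans (fL _ _)).
  rewrite (_ : c / M%:R = L * (4 * p / M%:R)); last by rewrite /c; ring.
  rewrite ler_pM2l//; apply: mxnorm_le => [|i j].
    by rewrite divr_ge0 ?mulr_ge0// ltW.
  rewrite ord1 mxB_coord.
  have -> : x 0 j - y 0 j = (x 0 j - node (w j)) - (y 0 j - node (w j)) by ring.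
  apply: (le_trans (ler_normB _ _)); have := Hx j; have := Hy j.
  rewrite (_ : 4 * p / M%:R = 2 * p / M%:R + 2 * p / M%:R); last by ring.
  by move=> h1 h2; exact: lerD.
exists C; split.
- rewrite CD => _ [z zp <-].
  have H i : exists j : 'I_M, `|z ord0 i - node j| <= 2 * p / M%:R.
    pose y := (z ord0 i + p) * M%:R / (2 * p).
    have zi : - p <= z ord0 i <= p by rewrite -ler_norml; apply: le_trans (ler_coord_norm _ _ _) zp.
    case/andP: zi => z1 z2.
    have y0 : 0 <= y by rewrite /y divr_ge0 ?mulr_ge0 ?(ltW p0)//; lra.
    have yM : y <= M%:R.
      by rewrite /y ler_pdivrMr; nra.
    pose n := Num.Def.trunc y.
    have /andP[n1 n2] : n%:R <= y < n.+1%:R by apply: trunc_itv.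
    have zE : z ord0 i = - p + 2 * p * y / M%:R by rewrite /y; field; rewrite !gt_eqF.
    (* The face where the coordinate equals p gives n = M, outside of the index set; it is assigned
       to the last slice. *)
    have [nM|nM] := ltnP n M.
      exists (Ordinal nM); rewrite /node/= zE.
      have -> : - p + 2 * p * y / M%:R - (- p + 2 * p * n%:R / M%:R) = 2 * p / M%:R * (y - n%:R) by ring.
      have pM : 0 < 2 * p / M%:R by rewrite divr_gt0// mulr_gt0.
      rewrite normrM (gtr0_norm pM) ler_piMr ?(ltW pM)// ger0_norm ?subr_ge0//.
      by move: n2; rewrite -natr1; lra.
    exists ord_max; rewrite /node/= zE.
    have M1 : (n%:R : R) >= M%:R by rewrite ler_nat.
    have yE : y = M%:R by lra.
    have -> : - p + 2 * p * y / M%:R - (- p + 2 * p * M.-1%:R / M%:R) = 2 * p / M%:R.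
      have -> : (M.-1%:R : R) = M%:R - 1 by rewrite /M/= -natr1; ring.
      by rewrite yE; field; rewrite gt_eqF.
    by rewrite ger0_norm// divr_ge0 ?mulr_ge0// ltW.
  have [w Hw] := choice H.
  by exists [ffun i => w i] => //; exists z => // i; rewrite ffunE.
- move=> n; case: (Cw n) => [->|[w ->]]; first by rewrite ediam_set0 leNye.
  apply: (le_trans (Dd w)); rewrite lee_fin ler_pdivrMr// mulrC -ler_pdivrMr//.
  by apply: ltW; apply: le_lt_trans MX; rewrite le_max lexx.
- rewrite Cs; apply: (@le_trans _ _ (\sum_(w : {ffun 'I_k -> 'I_M}) ((c / M%:R) `^ s)%:E)%E).
    apply: lee_sum => w _; apply: diam_pow_le (Dd w); first exact: ltW.
    by rewrite divr_ge0// ltW.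
  rewrite sumEFin sumr_const card_ffun !card_ord lee_fin.
  have kap : 0 < s - k%:R by rewrite subr_gt0.
  have Ms : M%:R `^ s = M%:R `^ (s - k%:R) * M%:R ^+ k.
    by rewrite -powR_mulrn ?(ltW M0)// -powRD ?subrK// gt_eqF// implybT.
  have Mp : 0 < M%:R `^ (s - k%:R) by rewrite powR_gt0.
  have Mk : 0 < (M%:R : R) ^+ k by rewrite exprn_gt0.
  rewrite powRM ?invr_ge0 ?(ltW c0) ?(ltW M0)// -powR_inv1 ?(ltW M0)// -powRrM mulN1r powRN.
  rewrite -[leLHS]mulr_natr natrX Ms.
  rewrite [leLHS](_ : _ = c `^ s / M%:R `^ (s - k%:R)); last by field; rewrite !gt_eqF.
  rewrite ler_pdivrMr// -ler_pdivrMl// mulrC.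
  have cs0 : 0 <= c `^ s / eps by rewrite divr_ge0 ?powR_ge0// ltW.
  have -> : c `^ s / eps = ((c `^ s / eps) `^ (s - k%:R)^-1) `^ (s - k%:R).
    by rewrite -powRrM mulVf ?powRr1// gt_eqF.
  apply: ge0_ler_powR; rewrite ?nnegrE ?powR_ge0 ?(ltW kap) ?(ltW M0)//.
  by apply: ltW; apply: le_lt_trans MX; rewrite le_max lexx orbT.
Qed.

End LipschitzImages.

Section HausdorffUpper.
Context {R : realType} {V : normedModType R}.

Lemma rectifiable_null k (A : set V) (s : R) : k%:R < s -> countably_rectifiable k A ->
  hausdorff_measure s A = 0%E.
Proof.
move=> ks [f [fL Af]].
apply: (@hausdorff_null_sub _ _ _ _ (\bigcup_n \bigcup_p (f n @` [set z | `|z| <= p.+1%:R]))).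
  move=> x /Af[n _ [z _ <-]]; exists n => //.
  exists (Num.Def.archi_bound `|z|) => //; exists z => //=.
  by apply: ltW; apply: lt_trans (archi_boundP _) _; rewrite ?ltr_nat.
apply: hausdorff_null_bigcup => n; apply: hausdorff_null_bigcup => p.
have [L HL] := fL n.
have L1 : 0 < `|L| + 1 by rewrite ltr_wpDl.
apply: (lip_cube_null L1 _ ks) => //.
move=> x y; apply: (le_trans (HL _ _)); rewrite ler_wpM2r//.
by have := ler_norm L; lra.
Qed.

Lemma hausdorff_dim_le_rectifiable k (A : set V) : countably_rectifiable k A ->
  (hausdorff_dim A <= k%:R%:E)%E.
Proof.
move=> Ar; apply/lee_addgt0Pr => eps eps0; rewrite -EFinD; apply: ereal_inf_lbound.
exists (k%:R + eps); split; [by rewrite addr_ge0// ltW|split=> //].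
by apply: rectifiable_null Ar; rewrite ltrDl.
Qed.

End HausdorffUpper.

(** * Covers of the unit cube, by counting grid points *)

Section CubeLower.
Context {R : realType}.

Lemma grid_count1 (M : nat) (c r : R) : (0 < M)%N -> 0 < r ->
  #|[set j : 'I_M | `|j%:R / M%:R - c| < r]%SET|%:R <= 2 * r * M%:R + 1.
Proof.
move=> M0 r0; set S := [set j | _]%SET; have MR : (0 : R) < M%:R by rewrite ltr0n.
have [->|[j0 j0S]] := set_0Vmem S; first by rewrite cards0 addr_ge0// !mulr_ge0// ltW.
pose j1 := [arg min_(j < j0 in S) (j : nat)]; pose j2 := [arg max_(j > j0 in S) (j : nat)].
have [j1S j1m] : j1 \in S /\ forall j, j \in S -> (j1 <= j)%N.
  by rewrite /j1; case: arg_minnP.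
have [j2S j2m] : j2 \in S /\ forall j, j \in S -> (j <= j2)%N.
  by rewrite /j2; case: arg_maxnP.
have cardS : (#|S| <= (j2 - j1).+1)%N.
  rewrite -[X in (_ <= X)%N]card_ord.
  apply: (@leq_card_in _ _ (fun j : 'I_M => inord (j - j1) : 'I_((j2 - j1).+1)) S) => j l jS lS.
  move=> /(congr1 val) /=; rewrite !inordK ?ltnS ?leq_sub2r ?j2m// => h.
  apply: val_inj; rewrite /= -(subnK (j1m _ jS)) -(subnK (j1m _ lS)).
  by congr (_ + _)%N.
apply: (@le_trans _ _ (j2 - j1).+1%:R); first by rewrite ler_nat.
rewrite -natr1 lerD2r natrB ?j1m//.
move: j1S j2S; rewrite !inE !ltr_norml => /andP[h1 _] /andP[_ h2].
have h : (j2%:R - j1%:R) / M%:R <= 2 * r by rewrite mulrBl; lra.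
by rewrite -ler_pdivrMr.
Qed.

(** In each coordinate there are at most 2 r M + 1 grid points; [1 <= r * M%:R] absorbs the 1 into
    the factor 3. *)
Lemma grid_count k (M : nat) (c : 'rV[R]_k) (r : R) : (0 < M)%N -> 0 < r -> 1 <= r * M%:R ->
  #|[set w : {ffun 'I_k -> 'I_M} | [forall i, `|(w i)%:R / M%:R - c ord0 i| < r]]%SET|%:R
   <= (3 * r * M%:R) ^+ k.
Proof.
move=> M0 r0 rM; set S := [set w | _]%SET.
pose F i := [set j : 'I_M | `|j%:R / M%:R - c ord0 i| < r]%SET.
have -> : #|S| = (\prod_i #|F i|)%N.
  transitivity #|family F|; last by rewrite card_family foldrE big_map big_enum.
  apply: eq_card => w; rewrite inE.
  by apply/forallP/familyP => H i; have := H i; rewrite inE.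
rewrite natr_prod -[k in leRHS]card_ord -prodr_const; apply: ler_prod => i _.
rewrite ler0n/=; apply: le_trans (grid_count1 _ M0 r0) _.
by lra.
Qed.

(** A volume comparison made discrete: by compactness finitely many balls suffice, and on a grid
    fine for all of them the ball n holds at most (3 r_n M)^k of the M^k points. *)
Lemma unit_cube_cover k (c : nat -> 'rV[R]_k) (r : nat -> R) : (forall n, 0 < r n) ->
  (forall z : 'rV[R]_k, (forall i, 0 <= z ord0 i <= 1) -> exists n, `|z - c n| < r n) ->
  exists n0, 1 <= \sum_(n < n0) (3 * r n) ^+ k.
Proof.
move=> r0 cov.
pose Q := [set v : 'rV[R]_k | forall i, `[(0 : R), 1]%classic (v ord0 i)].
have Qc : compact Q by apply: (@rV_compact R k (fun=> `[(0 : R), 1]%classic)) => i; exact: segment_compact.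
move: Qc; rewrite compact_cover => /(_ nat setT (fun n => ball (c n) (r n))).
case=> [n _|z Qz|F _ QF].
- exact: ball_open.
- have [i|n zn] := cov z; first by have := Qz i; rewrite /= in_itv.
  by exists n => //; rewrite -ball_normE/= distrC.
pose n0 := (\max_(n <- finmap.enum_fset F) n).+1; exists n0.
have cov' (z : 'rV[R]_k) : (forall i, 0 <= z ord0 i <= 1) -> exists n : 'I_n0, `|z - c n| < r n.
  move=> zQ; have [i|n /= nF zn] := QF z; first by rewrite /= in_itv; exact: zQ.
  have nn : (n < n0)%N by rewrite ltnS; apply: (@leq_bigmax_seq _ _ xpredT (fun n => n)).
  by exists (Ordinal nn); move: zn; rewrite -ball_normE/= distrC.
pose X := \sum_(n < n0) (r n)^-1.
have X0 : 0 <= X by apply: sumr_ge0 => n _; rewrite invr_ge0 ltW.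
pose M := (Num.Def.archi_bound X).+1.
have MX : X < M%:R by apply: lt_trans (archi_boundP X0) _; rewrite ltr_nat.
have MR : (0 : R) < M%:R by rewrite ltr0n.
have rM (n : 'I_n0) : 1 <= r n * M%:R.
  rewrite -ler_pdivrMl// mulr1; apply: ltW; apply: le_lt_trans MX.
  by rewrite /X (bigD1 n)//= lerDl sumr_ge0// => j _; rewrite invr_ge0 ltW.
pose T := {ffun 'I_k -> 'I_M}.
pose S (n : 'I_n0) := [set w : T | [forall i, `|(w i)%:R / M%:R - c n ord0 i| < r n]]%SET.
have H (w : T) : exists n, w \in S n.
  have [i|n Hn] := cov' (\row_i ((w i)%:R / M%:R)).
    rewrite mxE divr_ge0//= ler_pdivrMr// mul1r ler_nat; exact/ltnW/ltn_ord.
  exists n; rewrite inE; apply/forallP => i; apply: le_lt_trans Hn.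
  by have := ler_coord_norm (\row_i ((w i)%:R / M%:R) - c n) ord0 i; rewrite mxB_coord mxE.
have cardT : (#|{: T}| <= \sum_(n < n0) #|S n|)%N.
  have -> : #|{: T}| = #|(\bigcup_n S n)%SET|.
    by apply: eq_card => w; rewrite inE; apply/esym/finset.bigcupP; have [n Sn] := H w; exists n.
  elim/big_ind2: _ => [|A x B y Ax By|//]; first by rewrite cards0.
  exact: leq_trans (leq_card_setU _ _) (leq_add Ax By).
rewrite -(ler_pM2r (exprn_gt0 k MR)) mul1r.
apply: (@le_trans _ _ (#|{: T}|%:R)); first by rewrite card_ffun !card_ord natrX.
apply: (@le_trans _ _ (\sum_(n < n0) #|S n|)%:R); first by rewrite ler_nat.
rewrite natr_sum mulr_suml; apply: ler_sum => n _; rewrite -exprMn.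
by apply: grid_count.
Qed.

End CubeLower.

(** * The lower bound for the dimension, from a Lipschitz map onto the cube *)

Section HausdorffLower.
Context {R : realType} {V : normedModType R}.

(** If s < k, then for diameters at most 1 the sum of the k-th powers is below that of the s-th
    powers. A cover with a small sum would be mapped to a cover of the cube that contradicts
    [unit_cube_cover]. *)
Lemma hausdorff_null_dim_ge k (A : set V) (E : V -> 'rV[R]_k) (L s : R) : 0 <= s -> 0 < L ->
  (forall x y, `|E x - E y| <= L * `|x - y|) ->
  (forall z : 'rV[R]_k, (forall i, 0 <= z ord0 i <= 1) -> exists2 x, A x & E x = z) ->
  hausdorff_measure s A = 0%E -> k%:R <= s.
Proof.
move=> s0 L0 EL EA /hausdorff_nullP Hn; rewrite leNgt; apply/negP => sk.
have k0 : (0 < k)%N by rewrite -(ltr0n R); exact: le_lt_trans s0 sk.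
pose c6 := (6 : R) ^+ k; have c60 : 0 < c6 by rewrite exprn_gt0.
pose Lk := (6 * L) ^+ k; have Lk0 : 0 < Lk by rewrite exprn_gt0// mulr_gt0.
(* The cover and the margins [h] each contribute at most 1/4 to a sum that would have to be at least
   1. *)
have q4 : 0 < 4^-1 / Lk by rewrite divr_gt0// invr_gt0.
have [C [AC dC sC]] := Hn _ _ q4 ltr01.
pose eta := Num.min 1 (4^-1 / c6).
have eta0 : 0 < eta by rewrite lt_min ltr01/= divr_gt0//; lra.
(* A summable margin keeps the radii positive, even for sets of diameter 0, and lets open balls
   contain the images. *)
pose h n := eta / 2 ^+ n.+1.
have h0 n : 0 < h n by rewrite divr_gt0// exprn_gt0.
have h1 n : h n <= 1.
  rewrite ler_pdivrMr ?exprn_gt0// mul1r; apply: (@le_trans _ _ 1); first by rewrite ge_min lexx.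
  by rewrite exprn_ege1//; lra.
have H n : exists D : 'rV[R]_k * R, [/\ 0 <= D.2, (forall x, C n x -> `|E x - D.1| <= L * D.2) &
    ((D.2 ^+ k)%:E <= diam_pow (C n) s)%E].
  have [C0|/set0P[x Cx]] := eqVneq (C n) set0.
    exists (0, 0); rewrite C0; split=> //=; rewrite diam_pow_set0 expr0n.
    by rewrite gtn_eqF.
  have := ediam_ge0 Cx; have := dC n; rewrite /diam_pow; case Ed : (ediam (C n)) => [dd| |]//.
  rewrite !lee_fin => d1 d0; exists (E x, dd); split=> //=.
    move=> y Cy; apply: (le_trans (EL _ _)); rewrite ler_pM2l//.
    by have := ediam_dist Cy Cx; rewrite Ed lee_fin.
  rewrite lee_fin -powR_mulrn//.
  have [->|dn0] := eqVneq dd 0.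
    by rewrite (powR_mulrn k (lexx 0)) expr0n gtn_eqF// powR_ge0.
  by apply: ger_powR; rewrite ?(ltW sk)// d1 andbT lt_neqAle eq_sym dn0.
have [D HD] := choice H.
pose r n := L * (D n).2 + h n.
have r0 n : 0 < r n by have [d0 _ _] := HD n; rewrite ltr_wpDl// mulr_ge0// ltW.
have [z zQ|n0 big] := @unit_cube_cover _ k (fun n => (D n).1) r r0.
  have [x Ax <-] := EA z zQ; have [n _ Cx] := AC _ Ax; exists n.
  by have [_ H1 _] := HD n; apply: le_lt_trans (H1 _ Cx) _; rewrite ltrDl.
have powD (x y : R) : 0 <= x -> 0 <= y -> (x + y) ^+ k <= (2 * x) ^+ k + (2 * y) ^+ k.
  move=> x0 y0; have [xy|yx] := leP x y.
    apply: (@le_trans _ _ ((2 * y) ^+ k)); last by rewrite lerDr exprn_ge0// mulr_ge0.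
    by rewrite lerXn2r ?nnegrE ?addr_ge0 ?mulr_ge0//; lra.
  apply: (@le_trans _ _ ((2 * x) ^+ k)); last by rewrite lerDl exprn_ge0// mulr_ge0.
  by rewrite lerXn2r ?nnegrE ?addr_ge0 ?mulr_ge0//; lra.
have term n : (3 * r n) ^+ k <= Lk * (D n).2 ^+ k + c6 * h n.
  have [d0 _ _] := HD n.
  rewrite /r mulrDr; apply: (le_trans (powD _ _ _ _)).
  - by rewrite !mulr_ge0// ltW.
  - by rewrite mulr_ge0// ltW.
  apply: lerD.
    by rewrite /Lk -exprMn; rewrite le_eqVlt; apply/orP; left; apply/eqP; congr (_ ^+ _); ring.
  rewrite (_ : 2 * (3 * h n) = 6 * h n); last by ring.
  rewrite exprMn ler_wpM2l ?(ltW c60)// -[leRHS]expr1.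
  by apply: ler_wiXn2l => //; rewrite ltW.
have sumd : \sum_(n < n0) (D n).2 ^+ k <= 4^-1 / Lk.
  rewrite -lee_fin -sumEFin; apply: le_trans sC.
  apply: (@le_trans _ _ (\sum_(0 <= n < n0) diam_pow (C n) s)%E); last first.
    by apply: nneseries_lim_ge => n _ _; exact: diam_pow_ge0.
  by rewrite big_mkord; apply: lee_sum => n _; have [_ _] := HD n.
have sumh n : \sum_(i < n) h i = eta * (1 - (2 ^+ n)^-1).
  elim: n => [|n IH]; first by rewrite big_ord0 expr0 invr1 subrr mulr0.
  by rewrite big_ord_recr/= IH /h exprS; field; rewrite expf_neq0.
have : 1 <= Lk * (4^-1 / Lk) + c6 * eta.
  apply: (le_trans big); apply: (le_trans (ler_sum _ (fun (i : 'I_n0) _ => term i))).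
  rewrite big_split/=; apply: lerD; rewrite -mulr_sumr ler_pM2l//.
  rewrite sumh ler_piMr ?(ltW eta0)//.
have : c6 * eta <= c6 * (4^-1 / c6) by rewrite ler_pM2l// ge_min lexx orbT.
rewrite (mulrC c6 (_ / _)) (mulrC Lk) !divfK ?gt_eqF//.
by lra.
Qed.

Lemma hausdorff_dim_ge_cube k (A : set V) (E : V -> 'rV[R]_k) (L : R) : 0 < L ->
  (forall x y, `|E x - E y| <= L * `|x - y|) ->
  (forall z : 'rV[R]_k, (forall i, 0 <= z ord0 i <= 1) -> exists2 x, A x & E x = z) ->
  (k%:R%:E <= hausdorff_dim A)%E.
Proof.
move=> L0 EL EA; apply/ereal_infP => _ [s [s0 [Hs ->]]]; rewrite lee_fin.
exact: hausdorff_null_dim_ge s0 L0 EL EA Hs.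
Qed.

End HausdorffLower.

(** * Linear coordinates on the center-of-mass space *)

Section Coordinates.
Context {R : realType} {d N : nat}.
Variable m : 'I_N -> R.
Hypothesis m_gt0 : forall i, 0 < m i.
Hypothesis N_gt0 : (0 < N)%N.
Implicit Types x y : 'M[R]_(N, d).

Let w (i : 'I_(N - 1)) : 'I_N := widen_ord (leq_subr 1 N) i.
Let last_lt : (N - 1 < N)%N. Proof. by rewrite ltn_subrL. Qed.
Let last : 'I_N := Ordinal last_lt.

Lemma sum_but_last (F : 'I_N -> R) : \sum_i F i = \sum_i F (w i) + F last.
Proof.
pose F' k := oapp F 0 (insub k).
have FE i : F i = F' i by rewrite /F' valK.
under eq_bigr do rewrite FE; under [X in _ = X + _]eq_bigr do rewrite FE.
rewrite [F last]FE /=.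
rewrite -!(big_mkord xpredT F').
by rewrite -big_nat_recr// -[(N - 1).+1]addn1 subnK.
Qed.

Lemma but_last_cases (i : 'I_N) : i = last \/ exists j, i = w j.
Proof.
have [h|h] := ltnP i (N - 1); first by right; exists (Ordinal h); exact: val_inj.
left; apply: val_inj => /=; apply/eqP; rewrite eqn_leq h andbT.
by rewrite -ltnS -[X in (_ < X)%N]addn1 subnK.
Qed.

(* The last body is dropped: on [X] its position is determined by the others. *)
Definition coords x : 'rV[R]_(d * (N - 1)) := mxvec (\matrix_(k < d, i < N - 1) x (w i) k).

Lemma coordsE x k i : coords x ord0 (mxvec_index k i) = x (w i) k.
Proof. by rewrite mxvecE mxE. Qed.

Lemma coordsB x y : coords (x - y) = coords x - coords y.
Proof. by rewrite -raddfB/=; congr mxvec; apply/matrixP => k i; rewrite !mxE. Qed.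

Lemma coordsD x y : coords (x + y) = coords x + coords y.
Proof. by rewrite -raddfD/=; congr mxvec; apply/matrixP => k i; rewrite !mxE. Qed.

Lemma coordsZ c x : coords (c *: x) = c *: coords x.
Proof. by rewrite -linearZ/=; congr mxvec; apply/matrixP => k i; rewrite !mxE. Qed.

Lemma coords_le x : `|coords x| <= `|x|.
Proof.
apply: mxnorm_le => // i j; rewrite ord1; case/mxvec_indexP: j => k l.
by rewrite coordsE ler_coord_norm.
Qed.

Lemma coords_lower : exists2 C : R, 0 < C & forall x, inX m x -> `|x| <= C * `|coords x|.
Proof.
pose C := 1 + \sum_i m (w i) / m last.
have C1 : 1 <= C by rewrite lerDl sumr_ge0// => i _; rewrite divr_ge0// ltW.
exists C; first exact: lt_le_trans ltr01 C1.
move=> x /inX_coord xX.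
have wb i k : `|x (w i) k| <= `|coords x| by rewrite -coordsE ler_coord_norm.
apply: mxnorm_le => [|i k]; first by rewrite mulr_ge0// (le_trans ler01).
have [->|[j ->]] := but_last_cases i; last first.
  by apply: (le_trans (wb j k)); rewrite ler_peMl.
have -> : x last k = - \sum_i m (w i) / m last * x (w i) k.
  have := xX k; rewrite sum_but_last => /eqP; rewrite addrC addr_eq0 => /eqP h.
  apply: (mulfI (lt0r_neq0 (m_gt0 last))); rewrite h mulrN mulr_sumr; congr (- _).
  by apply: eq_bigr => j _; field; rewrite gt_eqF.
rewrite normrN; apply: (le_trans (ler_norm_sum _ _ _)).
apply: (@le_trans _ _ (\sum_i m (w i) / m last * `|coords x|)).
  apply: ler_sum => j _; have h : 0 <= m (w j) / m last by rewrite divr_ge0// ltW.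
  by rewrite normrM (ger0_norm h) ler_wpM2l.
by rewrite -mulr_suml ler_wpM2r// /C lerDr.
Qed.

Lemma coords_surj (z : 'rV[R]_(d * (N - 1))) : exists2 x, inX m x & coords x = z.
Proof.
pose A := vec_mx z.
pose x : 'M[R]_(N, d) := \matrix_(i, k)
  if insub (val i) is Some j then A k j else - \sum_j m (w j) / m last * A k j.
have xw j k : x (w j) k = A k j.
  rewrite mxE; case: insubP => [j' _ jj'|/negP[]]; last exact: (ltn_ord j).
  by congr (A k _); exact: val_inj.
have xl k : x last k = - \sum_j m (w j) / m last * A k j.
  by rewrite mxE; case: insubP => //=; rewrite ltnn.
exists x.
  apply/inX_coord => k; rewrite sum_but_last xl mulrN mulr_sumr.
  apply/eqP; rewrite subr_eq0; apply/eqP; apply: eq_bigr => j _.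
  by rewrite xw; field; rewrite gt_eqF.
rewrite -[RHS]vec_mxK; congr mxvec; apply/matrixP => k i.
by rewrite mxE xw.
Qed.

Lemma inXB x y : inX m x -> inX m y -> inX m (x - y).
Proof.
move=> /inX_coord xX /inX_coord yX; apply/inX_coord => k.
under eq_bigr do rewrite mxB_coord mulrBr.
by rewrite sumrB xX yX subrr.
Qed.

Lemma inXD x y : inX m x -> inX m y -> inX m (x + y).
Proof.
move=> /inX_coord xX /inX_coord yX; apply/inX_coord => k.
under eq_bigr do rewrite mxE mulrDr.
by rewrite big_split/= xX yX addr0.
Qed.

Lemma inXZ c x : inX m x -> inX m (c *: x).
Proof.
move=> /inX_coord xX; apply/inX_coord => k.
under eq_bigr do rewrite mxE mulrCA.
by rewrite -mulr_sumr xX mulr0.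
Qed.

End Coordinates.

(** * Lipschitz extension *)

Section McShane.
Context {R : realType}.

(** McShane's formula, the infimum over p of phi p + C |z - c p|. The hypothesis makes [phi] factor
    through [c] on [A], so no inverse of [c] has to be named. *)
Lemma mcshane (T : Type) (W : normedModType R) (A : set T) (c : T -> W) (phi : T -> R) (C : R) p0 :
  0 <= C -> A p0 -> (forall p q, A p -> A q -> `|phi p - phi q| <= C * `|c p - c q|) ->
  exists2 F : W -> R, (forall z y, `|F z - F y| <= C * `|z - y|) & forall p, A p -> F (c p) = phi p.
Proof.
move=> C0 Ap0 H.
pose S z := [set phi p + C * `|z - c p| | p in A].
have S0 z : S z !=set0 by exists (phi p0 + C * `|z - c p0|), p0.
have Slb z : has_lbound (S z).
  exists (phi p0 - C * `|z - c p0|) => _ [p Ap <-].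
  have := H _ _ Ap0 Ap; rewrite ler_norml => /andP[_ h].
  have : C * `|c p0 - c p| <= C * (`|z - c p0| + `|z - c p|).
    rewrite ler_wpM2l// (_ : c p0 - c p = (z - c p) - (z - c p0)); last by rewrite opprB [RHS]addrC addrA subrK.
    by rewrite [leRHS]addrC ler_normB.
  by lra.
pose F z := inf (S z).
have Fle z y : F z <= F y + C * `|z - y|.
  rewrite -lerBlDr; apply: lb_le_inf => // _ [p Ap <-]; rewrite lerBlDr.
  apply: (@le_trans _ _ (phi p + C * `|z - c p|)); first by apply: ge_inf => //; exists p.
  rewrite -addrA lerD2l -mulrDr ler_wpM2l//.
  rewrite (_ : z - c p = (y - c p) + (z - y)); last by rewrite [RHS]addrC addrA subrK.
  exact: ler_normD.
exists F.
  move=> z y; have h1 := Fle z y; have h2 := Fle y z; rewrite distrC in h2.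
  by rewrite ler_norml; apply/andP; split; lra.
move=> p Ap; apply/eqP; rewrite eq_le; apply/andP; split.
  by apply: ge_inf => //; exists p => //; rewrite subrr normr0 mulr0 addr0.
apply: lb_le_inf => // _ [q Aq <-]; have := H _ _ Ap Aq; rewrite ler_norml.
by move=> /andP[_]; lra.
Qed.

(** The norm is a maximum over coordinates, so extending each coordinate separately keeps the
    constant [C]. *)
Lemma lipschitz_inverse_extension (d N : nat) (W : normedModType R)
    (A : set ('M[R]_(N, d) * 'M[R]_(N, d))) (c : 'M[R]_(N, d) * 'M[R]_(N, d) -> W) (C : R) :
  0 <= C -> (forall p q, A p -> A q -> `|p - q| <= C * `|c p - c q|) ->
  exists f : W -> 'M[R]_(N, d) * 'M[R]_(N, d),
    (forall x y, `|f x - f y| <= C * `|x - y|) /\ A `<=` range f.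
Proof.
move=> C0 H; have [->|/set0P[p0 Ap0]] := eqVneq A set0.
  by exists (fun=> 0); split=> // x y; rewrite subrr normr0 mulr_ge0.
have H1 (ik : 'I_N * 'I_d) p q : A p -> A q -> `|p.1 ik.1 ik.2 - q.1 ik.1 ik.2| <= C * `|c p - c q|.
  move=> Ap Aq; apply: le_trans (H _ _ Ap Aq); rewrite -mxB_coord.
  by apply: le_trans (ler_coord_norm _ _ _) _; rewrite prod_normE/= le_max lexx.
have H2 (ik : 'I_N * 'I_d) p q : A p -> A q -> `|p.2 ik.1 ik.2 - q.2 ik.1 ik.2| <= C * `|c p - c q|.
  move=> Ap Aq; apply: le_trans (H _ _ Ap Aq); rewrite -mxB_coord.
  by apply: le_trans (ler_coord_norm _ _ _) _; rewrite prod_normE/= le_max lexx orbT.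
have E1 ik : exists F : W -> R, (forall z y, `|F z - F y| <= C * `|z - y|) /\
    forall p, A p -> F (c p) = p.1 ik.1 ik.2.
  by have [F F1 F2] := mcshane (phi := fun p : 'M[R]_(N, d) * 'M[R]_(N, d) => p.1 ik.1 ik.2) C0 Ap0 (H1 ik); exists F.
have E2 ik : exists F : W -> R, (forall z y, `|F z - F y| <= C * `|z - y|) /\
    forall p, A p -> F (c p) = p.2 ik.1 ik.2.
  by have [F F1 F2] := mcshane (phi := fun p : 'M[R]_(N, d) * 'M[R]_(N, d) => p.2 ik.1 ik.2) C0 Ap0 (H2 ik); exists F.
have [F1 HF1] := choice E1; have [F2 HF2] := choice E2.
exists (fun z => (\matrix_(i, k) F1 (i, k) z, \matrix_(i, k) F2 (i, k) z)); split.
  move=> x y; rewrite prod_normE/= ge_max; apply/andP; split; apply: mxnorm_le => [|i k];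
    rewrite ?mulr_ge0// mxB_coord !mxE.
    by have [h _] := HF1 (i, k).
  by have [h _] := HF2 (i, k).
move=> [p1 p2] Ap; exists (c (p1, p2)) => //; congr (_, _); apply/matrixP => i k; rewrite mxE.
  by have [_ ->] := HF1 (i, k).
by have [_ ->] := HF2 (i, k).
Qed.

End McShane.

(** * A backward Gronwall estimate for Newton's equation *)

Section Gronwall.
Context {R : realType} {d N : nat}.
Variable m : 'I_N -> R.
Hypothesis m_gt0 : forall i, 0 < m i.

(** Sums of squares replace the sup norm, which is not differentiable. For the squared distance E of
    the data, E' + Q E >= 0, so E 0 <= E T exp (Q T); the separation on [0, T] supplies the
    Lipschitz constant of the force. *)
Lemma newton_gronwall (eta T : R) : 0 < eta -> 0 <= T -> exists2 C : R, 0 < C &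
  forall (eps : R) (g1 v1 g2 v2 : R -> 'M[R]_(N, d)), 0 < eps ->
  newton_from m (- eps) g1 v1 -> newton_from m (- eps) g2 v2 ->
  (forall t, 0 <= t <= T -> well_separated eta (g1 t) /\ well_separated eta (g2 t)) ->
  `|g1 0 - g2 0| <= C * (`|g1 T - g2 T| + `|v1 T - v2 T|) /\
  `|v1 0 - v2 0| <= C * (`|g1 T - g2 T| + `|v1 T - v2 T|).
Proof.
move=> eta0 T0.
pose L := (\sum_i m i) * (4 * (2 * d.+1%:R)) / eta ^+ 3.
have L0 : 0 <= L.
  rewrite divr_ge0 ?exprn_ge0 ?(ltW eta0)// mulr_ge0// sumr_ge0// => i _; exact: ltW.
pose S := (N * d)%:R : R.
have S0 : 0 <= S by [].
pose Q := 2 + L ^+ 2 * S.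
exists (Num.sqrt ((S + 1) * expR (Q * T))).
  by rewrite sqrtr_gt0 mulr_gt0 ?expR_gt0//; lra.
move=> eps g1 v1 g2 v2 eps0 nw1 nw2 sep.
pose dg t : 'M[R]_(N, d) := g1 t - g2 t; pose dv t : 'M[R]_(N, d) := v1 t - v2 t.
pose sq (x : 'M[R]_(N, d)) := \sum_i \sum_k x i k ^+ 2.
have sumE (c : R) : \sum_(i < N) \sum_(k < d) c = S * c.
  by rewrite sumr_const card_ord sumr_const card_ord -mulrnA -mulr_natl mulnC.
have sq_ge (x : 'M[R]_(N, d)) : `|x| ^+ 2 <= sq x.
  have sq0 : 0 <= sq x by apply: sumr_ge0 => i _; apply: sumr_ge0 => k _; exact: sqr_ge0.
  rewrite -[leRHS](sqr_sqrtr sq0) lerXn2r ?nnegrE ?sqrtr_ge0//.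
  apply: mxnorm_le => [|i k]; first exact: sqrtr_ge0.
  rewrite -sqrtr_sqr ler_wsqrtr// /sq (bigD1 i)//= (bigD1 k)//= -addrA lerDl addr_ge0//.
    by apply: sumr_ge0 => l _; exact: sqr_ge0.
  by apply: sumr_ge0 => l _; apply: sumr_ge0 => l' _; exact: sqr_ge0.
have sq_le x : sq x <= S * `|x| ^+ 2.
  rewrite -sumE; apply: ler_sum => i _; apply: ler_sum => k _.
  by rewrite -real_normK ?num_real// lerXn2r ?nnegrE// ler_coord_norm.
pose E t := sq (dg t) + sq (dv t).
pose dF t : 'M[R]_(N, d) := gradU m (g1 t) - gradU m (g2 t).
pose dE t := \sum_i \sum_k (dv t i k * dg t i k + dg t i k * dv t i k)
   + \sum_i \sum_k (dF t i k * dv t i k + dv t i k * dF t i k).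
have Ed (t : R) : 0 <= t -> is_derive t 1 E (dE t).
  move=> t0; have [_ gd1 vd1] := nw1 t ltac:(lra); have [_ gd2 vd2] := nw2 t ltac:(lra).
  apply: derD; apply: der_sum => i _; apply: der_sum => k _; apply: derM.
  - by rewrite mxB_coord; under eq_fun do rewrite mxB_coord; exact: derB.
  - by rewrite mxB_coord; under eq_fun do rewrite mxB_coord; exact: derB.
  - by rewrite mxB_coord; under eq_fun do rewrite mxB_coord; exact: derB.
  - by rewrite mxB_coord; under eq_fun do rewrite mxB_coord; exact: derB.
have Eb (t : R) : 0 <= t <= T -> 0 <= dE t + Q * E t.
  move=> tT; have [s1 s2] := sep t tT.
  have lip := gradU_lip m_gt0 eta0 s1 s2; rewrite -/L -/(dF t) -/(dg t) in lip.
  have dF2 : sq (dF t) <= L ^+ 2 * S * sq (dg t).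
    apply: (le_trans (sq_le _)); rewrite (mulrC (L ^+ 2)) -mulrA ler_wpM2l//.
    apply: (@le_trans _ _ ((L * `|dg t|) ^+ 2)).
      by rewrite lerXn2r ?nnegrE// mulr_ge0.
    by rewrite exprMn ler_wpM2l ?sqr_ge0.
  have sqv0 : 0 <= sq (dv t) by apply: sumr_ge0 => i _; apply: sumr_ge0 => k _; exact: sqr_ge0.
  have sqg0 : 0 <= sq (dg t) by apply: sumr_ge0 => i _; apply: sumr_ge0 => k _; exact: sqr_ge0.
  have nn (x y : 'M[R]_(N, d)) : - (sq x + sq y) <= \sum_i \sum_k (x i k * y i k + y i k * x i k).
    rewrite /sq -big_split/= -sumrN; apply: ler_sum => i _; rewrite -big_split/= -sumrN.
    by apply: ler_sum => k _; have := sqr_ge0 (x i k + y i k); rewrite !expr2; lra.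
  have n1 := nn (dv t) (dg t); have n2 := nn (dF t) (dv t).
  have : 0 <= L ^+ 2 * S * sq (dv t) by rewrite mulr_ge0// mulr_ge0// sqr_ge0.
  by rewrite /dE /Q /E; lra.
have gr : E 0 <= E T * expR (Q * T).
  pose Z t := E t * expR (Q * t).
  have : Z 0 <= Z T.
    apply: (@deriv_ge0_le _ Z (fun t => dE t * expR (Q * t) + E t * (expR (Q * t) * Q))) => // t tT.
      have ex : is_derive t 1 (fun t => expR (Q * t)) (expR (Q * t) * Q).
        have := derMl Q (derX t); rewrite mulr1 => h.
        exact: (@der_comp _ expR (fun t => Q * t) t _ _ (is_derive_expR _) h).
      by apply: derM => //; apply: Ed; case/andP: tT.
    have -> : dE t * expR (Q * t) + E t * (expR (Q * t) * Q) = (dE t + Q * E t) * expR (Q * t) by ring.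
    by rewrite mulr_ge0 ?Eb// expR_ge0.
  by rewrite /Z mulr0 expR0 mulr1.
have ET : E T <= (S + 1) * (`|dg T| + `|dv T|) ^+ 2.
  have h1 := sq_le (dg T); have h2 := sq_le (dv T).
  have : 0 <= `|dg T| * `|dv T| by rewrite mulr_ge0.
  have : 0 <= S * (`|dg T| * `|dv T|) by rewrite mulr_ge0// mulr_ge0.
  have := sqr_ge0 `|dg T|; have := sqr_ge0 `|dv T|.
  rewrite sqrrD /E !mulr2n.
  by move: h1 h2; nra.
have key x : sq x <= E 0 -> `|x| <= Num.sqrt ((S + 1) * expR (Q * T)) * (`|dg T| + `|dv T|).
  move=> xE; have p0 : 0 <= (S + 1) * expR (Q * T) by rewrite mulr_ge0 ?expR_ge0//; lra.
  have q0 : 0 <= Num.sqrt ((S + 1) * expR (Q * T)) * (`|dg T| + `|dv T|).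
    by rewrite mulr_ge0 ?sqrtr_ge0// addr_ge0.
  rewrite -ler_sqr ?nnegrE// exprMn sqr_sqrtr//.
  apply: (le_trans (sq_ge _)); apply: (le_trans xE); apply: (le_trans gr).
  by rewrite mulrAC ler_wpM2r ?expR_ge0.
have nn x : 0 <= sq x by apply: sumr_ge0 => i _; apply: sumr_ge0 => k _; exact: sqr_ge0.
by split; apply: key; rewrite /E ?lerDl ?lerDr nn.
Qed.

End Gronwall.

(** * The two conclusions for [GR_X] *)

Section Rectifiability.
Context {R : realType} {d N : nat}.
Variable m : 'I_N -> R.
Hypothesis m_gt0 : forall i, 0 < m i.
Hypothesis N_gt0 : (0 < N)%N.

Lemma newton_path_separated (eps : R) (g v : R -> 'M[R]_(N, d)) (T : R) : 0 < eps -> 0 <= T ->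
  newton_from m (- eps) g v ->
  exists2 eta, 0 < eta & forall t, 0 <= t <= T -> well_separated eta (g t).
Proof.
move=> eps0 T0 nw.
pose P (p q : R) := exists2 eta, 0 < eta & forall t, p <= t <= q -> well_separated eta (g t).
suff : P 0 T by [].
apply: (@local_to_global _ P) => // [p q r _ pq qr _ [e1 e10 H1] [e2 e20 H2]|t /andP[t0 _]].
  exists (Num.min e1 e2); first by rewrite lt_min e10.
  move=> t /andP[pt tr] i j ij; rewrite ge_min; apply/orP.
  have [tq|tq] := leP t q; [left; apply: H1|right; apply: H2] => //.
    by rewrite pt.
  by rewrite (ltW tq).
have [gO gd _] := nw t ltac:(lra).
have [c c0 sc] := inOmega_separated gO.
have [rho rho0 Hrho] := well_separated_near c0 sc.
have /cvgrPdist_le/(_ _ rho0)/nbhs_ballP[eta /= eta0 He] := mx_path_continuous gd.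
exists eta => // p q p0 pq qT tp qt; exists (c / 2); first lra.
move=> u /andP[pu uq]; apply: Hrho; apply: He.
by rewrite /ball/= ltr_norml; apply/andP; split; lra.
Qed.

Variable a : 'M[R]_(N, d).
Hypothesis a_Omega : inOmega a.

(** One integer plays three parts: the time from which the motion is in the tube, its label there,
    and the inverse of the separation up to that time. For fixed [n] all constants are then
    uniform. *)
Definition late_data (e : R) (n : nat) : set ('M[R]_(N, d) * 'M[R]_(N, d)) :=
  [set p | exists2 g : R -> 'M[R]_(N, d),
     [/\ g 0 = p.1, derive1 g 0 = p.2, inX m p.1 & inX m p.2] &
     [/\ exists2 eps, 0 < eps & newton_from m (- eps) g (derive1 g),
         sublinear (fun t => g t - t *: a),
         forall t, n%:R <= t -> `|g t - t *: a| <= e * t &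
         forall t, 0 <= t <= n%:R -> well_separated n%:R^-1 (g t)]].

(** The parameter is the position at time n. Stability bounds the velocity difference at that time
    by the position difference, and Gronwall carries both back to time 0. *)
Lemma late_data_lipschitz (e K : R) (n : nat) : tube_const m a e K -> 2 * K <= n%:R ->
  exists c : 'M[R]_(N, d) * 'M[R]_(N, d) -> 'rV[R]_(d * (N - 1)), exists2 C : R, 0 <= C &
    forall p q, late_data e n p -> late_data e n q -> `|p - q| <= C * `|c p - c q|.
Proof.
move=> tK nK; have [e0 K0 _] := tK.
have n0 : 0 < n%:R :> R by lra.
have ni : 0 < (n%:R^-1 : R) by rewrite invr_gt0.
have H p : exists g : R -> 'M[R]_(N, d), late_data e n p ->
     [/\ g 0 = p.1, derive1 g 0 = p.2, inX m p.1 & inX m p.2] /\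
     [/\ exists2 eps, 0 < eps & newton_from m (- eps) g (derive1 g),
         sublinear (fun t => g t - t *: a),
         forall t, n%:R <= t -> `|g t - t *: a| <= e * t &
         forall t, 0 <= t <= n%:R -> well_separated n%:R^-1 (g t)].
  by have [[g g1 g2]|np] := pselect (late_data e n p); [exists g|exists (fun=> 0)].
have [G HG] := choice H.
have [Cx Cx0 HCx] := coords_lower (d := d) m_gt0 N_gt0.
have [CG CG0 HCG] := newton_gronwall (d := d) m_gt0 ni (ltW n0).
pose Cv := 2 * K / n%:R / n%:R.
have Cv0 : 0 <= Cv by rewrite !divr_ge0 ?mulr_ge0// ltW.
exists (fun p => coords (G p n%:R)), (CG * ((1 + Cv) * Cx)).
  by rewrite !mulr_ge0 ?addr_ge0// ltW.
move=> p q /HG[[p1 p2 pX pX'] [[ep ep0 nwp] slp tbp spp]] /HG[[q1 q2 qX qX'] [[eq eq0 nwq] slq tbq spq]].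
have sol g : (exists2 eps, 0 < eps & newton_from m (- eps) g (derive1 g)) ->
    sublinear (fun t => g t - t *: a) -> (forall t, n%:R <= t -> `|g t - t *: a| <= e * t) ->
    tube_sol m a e n%:R (fun s => g (s + n%:R)) (fun s => derive1 g (s + n%:R)).
  move=> [eps eps0 nw] sl tb; split.
  - by exists eps; last exact: (newton_from_shift (ltW n0) nw).
  - by move=> s s0; apply: tb; lra.
  - by apply: sublinear_shift => //; exact: ltW.
have solp := sol _ (ex_intro2 _ _ ep ep0 nwp) slp tbp.
have solq := sol _ (ex_intro2 _ _ eq eq0 nwq) slq tbq.
have := stability_velocity tK nK solp solq (lexx 0); rewrite !add0r => vel.
pose epm := Num.min ep eq.
have epm0 : 0 < epm by rewrite lt_min ep0.
have nwp' : newton_from m (- epm) (G p) (derive1 (G p)).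
  by move=> t tm; apply: nwp; have : epm <= ep by [rewrite ge_min lexx]; lra.
have nwq' : newton_from m (- epm) (G q) (derive1 (G q)).
  by move=> t tm; apply: nwq; have : epm <= eq by [rewrite ge_min lexx orbT]; lra.
have [h1 h2] := HCG _ _ _ _ _ epm0 nwp' nwq' (fun t tn => conj (spp t tn) (spq t tn)).
rewrite p1 q1 p2 q2 in h1 h2.
have pXn : inX m (G p n%:R) by apply: (newton_com_position ep0 nwp); rewrite ?p1 ?p2// ltW.
have qXn : inX m (G q n%:R) by apply: (newton_com_position eq0 nwq); rewrite ?q1 ?q2// ltW.
have := HCx _ (inXB pXn qXn); rewrite coordsB => pos.
set D := `|G p n%:R - G q n%:R| in h1 h2 vel pos.
have vel' : `|derive1 (G p) n%:R - derive1 (G q) n%:R| <= Cv * D.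
  by apply: (le_trans vel); rewrite le_eqVlt; apply/orP; left; apply/eqP; rewrite /Cv; ring.
have big : CG * (D + `|derive1 (G p) n%:R - derive1 (G q) n%:R|) <=
    CG * ((1 + Cv) * Cx) * `|coords (G p n%:R) - coords (G q n%:R)|.
  rewrite -mulrA ler_pM2l// -mulrA.
  apply: (@le_trans _ _ ((1 + Cv) * D)); first by lra.
  by rewrite ler_wpM2l// addr_ge0.
by rewrite prod_normE/= ge_max; apply/andP; split; apply: le_trans big.
Qed.

(** After some time T the tube separates the bodies by at least a constant, on [0, T] compactness
    does, and n exceeds the inverses of both separations. *)
Lemma GR_X_late (e : R) : 0 < e ->
  forall p, GR_X m a p -> exists n1, forall n, (n1 <= n)%N -> late_data e n p.
Proof.
move=> e0 p [[_ pX] [pX' [g [g0 [dg0 [ns [_ hyp]]]]]]].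
have sl := (hyperbolic_sublinear g a_Omega).1 hyp.
have [eps eps0 nw] := newton_solution_from ns.
have [e1 [c1 [e10 c10 sepT]]] := tube_separated a_Omega.
have [S1 HS1] := sl _ e0; have [S2 HS2] := sl _ e10.
pose T := Num.max (Num.max S2 1) 0.
have T1 : 1 <= T by rewrite !le_max lexx orbT.
have TS : S2 <= T by rewrite !le_max lexx.
have T0 : 0 <= T by lra.
have [eta eta0 Heta] := newton_path_separated eps0 T0 nw.
pose X := Num.max (Num.max S1 0) (Num.max eta^-1 c1^-1).
have X0 : 0 <= X by rewrite !le_max lexx orbT.
exists (Num.Def.archi_bound X) => n Xn.
have nX : X <= n%:R by apply: ltW; apply: lt_le_trans (archi_boundP X0) _; rewrite ler_nat.
move: nX; rewrite !ge_max => /andP[/andP[nS1 n0] /andP[n1 n2]].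
have n00 : 0 < n%:R :> R by apply: lt_le_trans n1; rewrite invr_gt0.
exists g => //; split=> //.
- by exists eps.
- by move=> t nt; apply: HS1; lra.
move=> t /andP[t0 tn] i j ij.
have [tT|tT] := leP t T.
  have := Heta t ltac:(by rewrite t0) i j ij; apply: le_trans.
  by rewrite -[leRHS]invrK lef_pV2 ?posrE ?invr_gt0.
have t00 : 0 < t by lra.
have := sepT t (g t) t00 (HS2 t ltac:(lra)) i j ij; apply: le_trans.
apply: (@le_trans _ _ c1); last by rewrite ler_peMr// ?(ltW c10)//; lra.
by rewrite -[leRHS]invrK lef_pV2 ?posrE ?invr_gt0.
Qed.

Theorem GR_X_rectifiable : countably_rectifiable (d * (N - 1)) (GR_X m a).
Proof.
have [e [K tK]] := tube_const_exists m_gt0 a_Omega; have [e0 K0 _] := tK.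
(* The shift by [n0] skips the stages where [2 * K <= n%:R] may fail. *)
pose n0 := Num.Def.archi_bound (2 * K).
have n0K n : 2 * K <= (n + n0)%N%:R.
  apply: ltW; apply: lt_le_trans (archi_boundP _) _; first lra.
  by rewrite ler_nat leq_addl.
have H n : exists f : 'rV[R]_(d * (N - 1)) -> 'M[R]_(N, d) * 'M[R]_(N, d),
    (exists L : R, forall x y, `|f x - f y| <= L * `|x - y|) /\ late_data e (n + n0) `<=` range f.
  have [c [C C0 HC]] := late_data_lipschitz tK (n0K n).
  have [f [fL fr]] := lipschitz_inverse_extension C0 HC.
  by exists f; split=> //; exists C.
have [f Hf] := choice H; exists f; split=> [n|p].
  by have [] := Hf n.
move=> /(GR_X_late e0)[n1 Hn1]; exists n1 => //.
by have [_] := Hf n1; apply; apply: Hn1; rewrite leq_addr.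
Qed.

(** Rescaling positions around a point [x0] inside the cone of [cone_geodesic_rays] maps [GR_X] onto
    a set containing the unit cube. *)
Theorem GR_X_dim_ge : inX m a -> ((d * (N - 1))%:R%:E <= hausdorff_dim (GR_X m a))%E.
Proof.
(* For a single body [a] is 0 and there is no cone, but the claimed bound is 0. *)
move=> aX; have [N1|N1] := leqP N 1.
  have -> : (d * (N - 1) = 0)%N.
    by apply/eqP; rewrite muln_eq0 subn_eq0 N1 orbT.
  by apply/ereal_infP => _ [s [s0 [_ ->]]]; rewrite lee_fin.
have a_gt0 : 0 < mnorm2 m a.
  have [c c0 Hc] := mnorm2_lower (d := d) m_gt0; apply: lt_le_trans (Hc a).
  rewrite mulr_gt0// exprn_gt0// normr_gt0; apply/eqP => az.
  have := @a_Omega (Ordinal N_gt0) (Ordinal N1) isT; rewrite az !row0.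
  by rewrite eqxx.
have [e [R0 [e0 R00 rays]]] := cone_geodesic_rays m_gt0 a_Omega a_gt0.
pose x0 := (R0 + 1) *: a.
have ax0 : axial m a x0 = R0 + 1 by rewrite axialZ axiala// mulr1.
have [||rho rho0 Hrho] := @cone_continuous_interior _ _ _ _ m_gt0 a a_gt0 e R0 x0 _ _ e0.
- by rewrite ax0; lra.
- by rewrite ax0 subrr normr0 mulr_gt0//; lra.
have [Cx Cx0 HCx] := coords_lower (d := d) m_gt0 N_gt0.
(* At this scale the unit cube in coordinates corresponds to displacements of size at most [rho]. *)
pose r := rho / Cx; have r0 : 0 < r by rewrite divr_gt0.
apply: (@hausdorff_dim_ge_cube _ _ _ _ (fun p => r^-1 *: (coords p.1 - coords x0)) r^-1).
- by rewrite invr_gt0.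
- move=> x y; rewrite -scalerBr normrZ gtr0_norm ?invr_gt0// ler_pM2l ?invr_gt0//.
  rewrite opprB addrA subrK -coordsB; apply: (le_trans (coords_le _)).
  by rewrite prod_normE/= le_max lexx.
move=> z zQ; have [y yX yz] := coords_surj (d := d) m_gt0 N_gt0 z.
have zn : `|z| <= 1.
  apply: mxnorm_le => // i j; rewrite ord1 ler_norml.
  by case/andP: (zQ j) => h1 h2; apply/andP; split; lra.
pose x := x0 + r *: y.
have xX : inX m x by apply: inXD; exact: inXZ.
have [|g [g0 ns geo hyp [xO vX]]] := rays x.
  apply: Hrho; rewrite /x addrC addKr normrZ (gtr0_norm r0).
  have : `|y| <= Cx by apply: (le_trans (HCx _ yX)); rewrite yz ler_piMr// ltW.
  by move=> h; rewrite /r mulrAC ler_pdivrMr// ler_wpM2l// ltW.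
exists (x, derive1 g 0).
  by split=> //=; split; [exact: vX|exists g].
rewrite /= /x coordsD (coordsZ r y) yz addrC addKr scalerA mulVf ?scale1r//.
by rewrite gt_eqF.
Qed.

End Rectifiability.

Theorem theorem1p2 (R : realType) (d N : nat) (m : 'I_N -> R) (a : 'M[R]_(N, d)) :
  (2 <= d)%N -> (0 < N)%N -> (forall i, 0 < m i) ->
  inOmegaX m a ->
  countably_rectifiable (d * (N - 1)) (GR_X m a) /\
  hausdorff_dim (GR_X m a) = ((d * (N - 1))%:R)%:E.
Proof.
move=> _ N0 m0 [aO aX]; have rect := GR_X_rectifiable m0 N0 aO; split=> //.
apply/eqP; rewrite eq_le (hausdorff_dim_le_rectifiable rect)/=.
exact: GR_X_dim_ge.
Qed.
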